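(* Let $p$ be a prime and let $k$ be a commutative noetherian ring containing a field of characteristic $p$. If $C$ is a $B_\infty$-algebra over $k$, then $\Sigma \mathrm{H}_*(C)$ is naturally a restricted graded Lie algebra. A map of $B_\infty$-algebras induces a map of restricted graded Lie algebras in homology. In particular, if $\phi:A\to B$ is a fully faithful embedding of dg categories then $\phi^*:\mathrm{HH}^*(B,B)\to\mathrm{HH}^*(A,A)$ is (after shifting) a homomorphism of restricted Lie algebras.
   Context: Shift: $(\Sigma M)_i=M_{i-1}$; thus an element of cohomological degree $n$ in $C$ has degree $n-1$ in $\Sigma C$. Below $|\cdot|$ denotes this shifted degree. $B_\infty$-algebra: a graded $k$-module $C$ together with a differential and a product on the bar construction $BC=\bigoplus_{i\ge 0}(\Sigma C)^{\otimes i}$ which, with its canonical (deconcatenation) coproduct and with unit $1\in k=(\Sigma C)^{\otimes 0}$, make $BC$ a dg Hopf algebra. The homology $\mathrm{H}_*(C)$ is taken with respect to the component $\Sigma C\to\Sigma C$ of the differential. A map of $B_\infty$-algebras is a map preserving all of this structure. The component $\Sigma C\otimes(\Sigma C)^{\otimes s}\to\Sigma C$ of the product is written $x\{y_1,\dots,y_s\}$, and $x\circ y=x\{y\}$. The structure on $\Sigma\mathrm{H}_*(C)$: the bracket is the Gerstenhaber bracket $[x,y]=x\circ y-(-1)^{|x||y|}y\circ x$, the reduced square is $x^{[2]}=x\circ x$ for $|x|$ odd, and the $p$-power operation is given by the formula $x^{[p]}=((x\circ x)\circ\cdots)\circ x$ ($x$ appearing $p$ times) for $|x|$ even. Graded Lie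 algebra: a graded $k$-module $L$ with a degree-preserving bilinear bracket and a reduced square $(-)^{[2]}:L^{2i+1}\to L^{4i+2}$ such that $[x,y]=-(-1)^{|x||y|}[y,x]$; $[x,x]=0$ for $|x|$ even; $[x,[y,z]]=[[x,y],z]+(-1)^{|x||y|}[y,[x,z]]$; $[x,[x,x]]=0$ for $|x|$ odd; $(x+y)^{[2]}=x^{[2]}+y^{[2]}+[x,y]$, $(\alpha x)^{[2]}=\alpha^2x^{[2]}$ and $[x^{[2]},z]=[x,[x,z]]$ for $x,y$ odd of the same degree and $\alpha\in k$. Restricted graded Lie algebra: a graded Lie algebra with an operation $(-)^{[p]}:L^{2i}\to L^{2ip}$ such that $(\alpha x)^{[p]}=\alpha^px^{[p]}$, $[x^{[p]},y]=\mathrm{ad}(x)^p(y)$, and $(x+y)^{[p]}=x^{[p]}+y^{[p]}+\sum_{i=1}^{p-1}s_i(x,y)$, where $i\,s_i(x,y)$ is the coefficient of $t^{i-1}$ in $\mathrm{ad}(tx+y)^{p-1}(x)$. Hochschild cochains: for a small dg category $A$ over $k$ write ${}_bA_a=\mathrm{Hom}_A(a,b)$. Its Hochschild cochain complex $C^*(A,A)$ is the product over $n\ge0$ and over objects $a_0,\dots,a_n$ of the complexes $\mathrm{Hom}_k({}_{a_n}A_{a_{n-1}}\otimes\cdots\otimes{}_{a_1}A_{a_0},{}_{a_n}A_{a_0})$ placed with an additional degree $n$, with the Hochschild differential. The dg categories are taken to be projective over $k$, so that the cohomology of $C^*(A,A)$ is $\mathrm{HH}^*(A,A)=\mathrm{Ext}^*_{A^{\mathrm{op}}\otimes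 A}(A,A)$. The complex $C^*(A,A)$ is a $B_\infty$-algebra with the cup product ($x\otimes y$ followed by composition) and the brace operations $x\{y_1,\dots,y_s\}$ given by the signed sum over all ways of inserting $y_1,\dots,y_s$, in this order, into the inputs of $x$. For a fully faithful embedding $\phi:A\to B$, $\phi^*$ is induced by the map $C^*(B,B)\to C^*(A,A)$ that restricts a cochain to the components involving only objects in the image of $\phi$, using ${}_{\phi(b)}B_{\phi(a)}\cong{}_bA_a$.
   Formalization: For a general B∞-algebra the p-power is the p-th power of x in BC; the formula ((x∘x)∘⋯)∘x is claimed only if the product has no components (ΣC)^{⊗r}⊗ΣC→ΣC with r>1 (as for Hochschild cochains), since it can fail otherwise for p≥3. *)

(* Defs.v *)
From HB Require Import structures.
From mathcomp Require Import all_boot all_order all_algebra.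
From mathcomp Require Import generic_quotient ring_quotient.
From mathcomp Require Import finmap boolp.
From mathcomp.multinomials Require Import monalg.
From mathcomp Require Import zify.

Set Implicit Arguments.
Unset Strict Implicit.
Unset Printing Implicit Defensive.

Import GRing.Theory.

Local Open Scope ring_scope.
Local Open Scope quotient_scope.

Section Quotients.
Variable k : comNzRingType.

Inductive lspan (V : lmodType k) (G : V -> Prop) : V -> Prop :=
| lspan0 : lspan G 0
| lspanZD a g x : G g -> lspan G x -> lspan G (a *: g + x).

Section Span.
Variables (V : lmodType k) (G : V -> Prop).

Lemma lspan_gen g : G g -> lspan G g.
Proof. by move=> Gg; rewrite -[g]scale1r -[_ *: _]addr0; apply: lspanZD => //; apply: lspan0. Qed.

Lemma lspanD x y : lspan G x -> lspan G y -> lspan G (x + y).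
Proof.
elim=> [|a g z Gg _ IH] Gy; first by rewrite add0r.
by rewrite -addrA; apply: lspanZD => //; apply: IH.
Qed.

Lemma lspanZ a x : lspan G x -> lspan G (a *: x).
Proof.
elim=> [|b g z Gg _ IH]; first by rewrite scaler0; apply: lspan0.
by rewrite scalerDr scalerA; apply: lspanZD.
Qed.

Definition lspan_pred : {pred V} := fun x => `[< lspan G x >].

Lemma lspan_zmod_closed : zmod_closed lspan_pred.
Proof.
split=> [|x y /asboolP Gx /asboolP Gy]; apply/asboolP; first exact: lspan0.
by apply: lspanD => //; rewrite -scaleN1r; apply: lspanZ.
Qed.

HB.instance Definition _ := GRing.isZmodClosed.Build V lspan_pred lspan_zmod_closed.

Definition lquot := Quotient.quot lspan_pred.

HB.instance Definition _ := GRing.Zmodule.on lquot.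

Definition lpi (x : V) : lquot := \pi x.

Lemma lpi_eqP x y : lpi x = lpi y <-> lspan G (x - y).
Proof.
rewrite /lpi; split=> [/eqP|h].
  by rewrite -Quotient.idealrBE => /asboolP.
by apply/eqP; rewrite -Quotient.idealrBE; apply/asboolP.
Qed.

Lemma lpi_zmod : zmod_morphism lpi.
Proof. by move=> x y; rewrite /lpi raddfB. Qed.

HB.instance Definition _ := GRing.isZmodMorphism.Build V lquot lpi lpi_zmod.

Lemma lpi_surj (q : lquot) : exists x, q = lpi x.
Proof. by exists (repr q); rewrite /lpi reprK. Qed.

Definition lquot_scale (a : k) (q : lquot) : lquot := lpi (a *: repr q).

Lemma lquot_scaleE a x : lquot_scale a (lpi x) = lpi (a *: x).
Proof.
apply/lpi_eqP; rewrite -scalerBr; apply: lspanZ; apply/lpi_eqP.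
by rewrite {1}/lpi reprK.
Qed.

Fact lquot_scaleA a b q : lquot_scale a (lquot_scale b q) = lquot_scale (a * b) q.
Proof. by have [x ->] := lpi_surj q; rewrite !lquot_scaleE scalerA. Qed.
Fact lquot_scale0 q : lquot_scale 0 q = 0.
Proof. by have [x ->] := lpi_surj q; rewrite lquot_scaleE scale0r raddf0. Qed.
Fact lquot_scale1 : left_id 1 lquot_scale.
Proof. by move=> q; have [x ->] := lpi_surj q; rewrite lquot_scaleE scale1r. Qed.
Fact lquot_scaleDr : right_distributive lquot_scale +%R.
Proof.
move=> a q r; have [x ->] := lpi_surj q; have [y ->] := lpi_surj r.
by rewrite -raddfD !lquot_scaleE scalerDr raddfD.
Qed.
Fact lquot_scaleDl q : {morph lquot_scale^~ q : a b / a + b}.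
Proof.
by move=> a b /=; have [x ->] := lpi_surj q; rewrite !lquot_scaleE scalerDl raddfD.
Qed.

HB.instance Definition _ := GRing.Zmodule_isLmodule.Build k lquot
  lquot_scaleA lquot_scale1 lquot_scaleDr lquot_scaleDl.

Lemma lpi_scalable : scalable lpi.
Proof. by move=> a x; rewrite -lquot_scaleE. Qed.
HB.instance Definition _ := GRing.isScalable.Build k V lquot *:%R lpi lpi_scalable.

End Span.

Section Presented.
Variables (I : choiceType) (R : {malg k[I]} -> Prop).

Definition pres := lquot R.
HB.instance Definition _ := GRing.Lmodule.on pres.

Definition pgen (i : I) : pres := lpi R << i >>.

Variables (P : lmodType k) (f : I -> P).

Definition meval (g : {malg k[I]}) : P := \sum_(i <- msupp g) g@_i *: f i.

Lemma mevalEw (d : {fset I}) g : (msupp g `<=` d)%fset ->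
  meval g = \sum_(i <- d) g@_i *: f i.
Proof.
move=> le; rewrite /meval (big_fset_incl _ le) //= => i _ /mcoeff_outdom ->.
by rewrite scale0r.
Qed.

Lemma meval_linear : linear meval.
Proof.
move=> a g h; pose d := (msupp (a *: g + h) `|` msupp g `|` msupp h)%fset.
have l1 : (msupp (a *: g + h) `<=` d)%fset.
  by rewrite /d -fsetUA; apply: fsubsetUl.
have l2 : (msupp g `<=` d)%fset.
  by rewrite /d fsetUAC; apply: fsubsetUr.
have l3 : (msupp h `<=` d)%fset by apply: fsubsetUr.
rewrite (mevalEw l1) (mevalEw l2) (mevalEw l3) scaler_sumr -big_split /=.
by apply: eq_bigr => i _; rewrite mcoeffD mcoeffZ scalerDl scalerA.
Qed.
HB.instance Definition _ :=
  GRing.isLinear.Build k {malg k[I]} P *:%R meval meval_linear.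

Lemma mevalU i : meval << i >> = f i.
Proof. by rewrite (mevalEw (msuppU_le)) big_seq_fset1 mcoeffUU scale1r. Qed.

Definition plift (q : pres) : P := meval (repr q).

Definition plift_compat := forall g, R g -> meval g = 0.

Hypothesis fR : plift_compat.

Lemma plift_pi g : plift (lpi R g) = meval g.
Proof.
have : lspan R (repr (lpi R g) - g) by apply/lpi_eqP; rewrite {1}/lpi reprK.
rewrite /plift => h; apply/eqP; rewrite -subr_eq0 -linearB /=; apply/eqP.
by elim: h => [|a x y Rx _ IH]; rewrite ?linear0 // linearP /= fR // IH scaler0 addr0.
Qed.

Lemma pliftE i : plift (pgen i) = f i.
Proof. by rewrite plift_pi mevalU. Qed.

Lemma plift_linear : linear plift.
Proof.
move=> a x y; have [g ->] := lpi_surj x; have [h ->] := lpi_surj y.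
by rewrite -linearP !plift_pi linearP.
Qed.

End Presented.

Section Tensor.
Variables V W : lmodType k.

Variant tens_rel : {malg k[(V * W)%type]} -> Prop :=
| tens_rell a x y z :
    tens_rel (<< (a *: x + y, z) >> - (a *: << (x, z) >> + << (y, z) >>))
| tens_relr a x y z :
    tens_rel (<< (z, a *: x + y) >> - (a *: << (z, x) >> + << (z, y) >>)).

Definition tens := pres tens_rel.
HB.instance Definition _ := GRing.Lmodule.on tens.

Definition tprod (x : V) (y : W) : tens := pgen tens_rel (x, y).

Lemma tprodPl a x x' y : tprod (a *: x + x') y = a *: tprod x y + tprod x' y.
Proof.
by rewrite /tprod /pgen -linearP; apply/lpi_eqP/lspan_gen; apply: tens_rell.
Qed.

Lemma tprodPr a x y y' : tprod x (a *: y + y') = a *: tprod x y + tprod x y'.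
Proof.
by rewrite /tprod /pgen -linearP; apply/lpi_eqP/lspan_gen; apply: tens_relr.
Qed.

End Tensor.

Section TensorMap.
Variables (V V' W W' : lmodType k) (f : {linear V -> V'}) (g : {linear W -> W'}).

Definition tmap : tens V W -> tens V' W' := plift (fun p => tprod (f p.1) (g p.2)).

Lemma tmap_compat : plift_compat (@tens_rel V W) (fun p => tprod (f p.1) (g p.2)).
Proof.
by move=> _ [a x y z|a x y z]; rewrite linearB linearP /= !mevalU /= linearP
  (tprodPl, tprodPr) subrr.
Qed.

Lemma tmap_linear : linear tmap. Proof. exact: plift_linear tmap_compat. Qed.
HB.instance Definition _ :=
  GRing.isLinear.Build k (tens V W) (tens V' W') *:%R tmap tmap_linear.

Lemma tmapE x y : tmap (tprod x y) = tprod (f x) (g y).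
Proof. exact: (pliftE tmap_compat). Qed.

End TensorMap.

Section Bar.
Variable V : lmodType k.

Variant bar_rel : {malg k[seq V]} -> Prop :=
| BarRel u a x y w :
    bar_rel (<< u ++ (a *: x + y) :: w >>
             - (a *: << u ++ x :: w >> + << u ++ y :: w >>)).

(* The tensor module of V, i.e. the direct sum over n of the n-fold tensor
   powers of V: the free module on all words in V, modulo multilinearity in
   each letter. *)
Definition bar := pres bar_rel.
HB.instance Definition _ := GRing.Lmodule.on bar.

Definition bword (w : seq V) : bar := pgen bar_rel w.

Definition wmultilin (P : lmodType k) (f : seq V -> P) :=
  forall u a x y w,
    f (u ++ (a *: x + y) :: w) = a *: f (u ++ x :: w) + f (u ++ y :: w).

Lemma bword_multilin : wmultilin bword.
Proof.
move=> u a x y w; rewrite /bword /pgen -linearP.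
by apply/lpi_eqP/lspan_gen; apply: BarRel.
Qed.

Lemma bar_compat (P : lmodType k) (f : seq V -> P) :
  wmultilin f -> plift_compat bar_rel f.
Proof.
by move=> fM _ [u a x y w]; rewrite linearB linearP /= !mevalU fM subrr.
Qed.

Definition bar1 : bar -> V := plift (fun w => if w is [:: x] then x else 0).

Lemma bar1_multilin : wmultilin (fun w : seq V => if w is [:: x] then x else 0).
Proof.
by move=> [|b u] a x y [|c w] //=; rewrite ?cats0 ?scaler0 ?addr0 //;
  case: u => [|? ?] /=; rewrite scaler0 addr0.
Qed.

Lemma bar1_linear : linear bar1.
Proof. exact: plift_linear (bar_compat bar1_multilin). Qed.
HB.instance Definition _ := GRing.isLinear.Build k bar V *:%R bar1 bar1_linear.

Lemma bar1E w : bar1 (bword w) = if w is [:: x] then x else 0.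
Proof. exact: (pliftE (bar_compat bar1_multilin)). Qed.

Definition bcounit : bar -> k^o := plift (fun w => (w == [::])%:R : k^o).

Lemma bcounit_multilin : wmultilin (fun w : seq V => (w == [::])%:R : k^o).
Proof. by move=> [|b u] a x y w //=; rewrite scaler0 addr0. Qed.

Lemma bcounit_linear : linear bcounit.
Proof. exact: plift_linear (bar_compat bcounit_multilin). Qed.
HB.instance Definition _ :=
  GRing.isLinear.Build k bar k^o *:%R bcounit bcounit_linear.

Lemma bcounitE w : bcounit (bword w) = (w == [::])%:R.
Proof. exact: (pliftE (bar_compat bcounit_multilin)). Qed.

Definition deconc_word (w : seq V) : tens bar bar :=
  \sum_(0 <= i < (size w).+1) tprod (bword (take i w)) (bword (drop i w)).

Definition bcomul : bar -> tens bar bar := plift deconc_word.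

Lemma deconc_word_multilin : wmultilin deconc_word.
Proof.
move=> u a x y w; rewrite /deconc_word !size_cat /= scaler_sumr -big_split /=.
apply: eq_bigr => i _; rewrite !take_cat !drop_cat.
case: ltnP => iu; first by rewrite bword_multilin tprodPr.
case: (i - size u)%N => [|j] /=.
  by rewrite (bword_multilin [::]) tprodPr.
by rewrite bword_multilin tprodPl.
Qed.

Lemma bcomul_linear : linear bcomul.
Proof. exact: plift_linear (bar_compat deconc_word_multilin). Qed.
HB.instance Definition _ :=
  GRing.isLinear.Build k bar (tens bar bar) *:%R bcomul bcomul_linear.

Lemma bcomulE w : bcomul (bword w) = deconc_word w.
Proof. exact: (pliftE (bar_compat deconc_word_multilin)). Qed.

End Bar.

Section BarMap.
Variables (V W : lmodType k) (f : {linear V -> W}).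

Definition bmap : bar V -> bar W := plift (fun w => bword (map f w)).

Lemma bmap_multilin : wmultilin (fun w => bword (map f w)).
Proof.
by move=> u a x y w; rewrite !map_cat /= linearP bword_multilin.
Qed.

Lemma bmap_linear : linear bmap.
Proof. exact: plift_linear (bar_compat bmap_multilin). Qed.
HB.instance Definition _ :=
  GRing.isLinear.Build k (bar V) (bar W) *:%R bmap bmap_linear.

Lemma bmapE w : bmap (bword w) = bword (map f w).
Proof. exact: (pliftE (bar_compat bmap_multilin)). Qed.

End BarMap.
End Quotients.

Definition ksign (k : comNzRingType) (n : int) : k := (-1) ^+ `|n|%N.

(* A graded k-module, presented through its underlying module together with
   the submodules of homogeneous elements of each degree, of which it is the
   direct sum. *)
Record grmod (k : comNzRingType) := GrMod {
  gcar :> lmodType k;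
  gdeg : int -> gcar -> Prop;
  gdeg0 : forall i, gdeg i 0;
  gdegP : forall i a x y, gdeg i x -> gdeg i y -> gdeg i (a *: x + y);
  gdec : forall x, exists s c,
    [/\ uniq s, forall i, gdeg i (c i) & x = \sum_(i <- s) c i];
  gind : forall (s : seq int) c, uniq s -> (forall i, gdeg i (c i)) ->
    \sum_(i <- s) c i = 0 -> forall i, i \in s -> c i = 0
}.

Section Graded.
Variable k : comNzRingType.
Implicit Type M : grmod k.

Lemma gdegD M i (x y : M) : gdeg i x -> gdeg i y -> gdeg i (x + y).
Proof. by move=> hx hy; rewrite -[x]scale1r; apply: gdegP. Qed.

Lemma gdegZ M i a (x : M) : gdeg i x -> gdeg i (a *: x).
Proof. by move=> hx; rewrite -[_ *: x]addr0; apply: gdegP => //; apply: gdeg0. Qed.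

(* Suspension: in cohomological degrees, (Sigma M)^i = M^(i+1). *)
Section Susp.
Variable M : grmod k.
Definition susp_deg (i : int) (x : M) := gdeg (i + 1) x.

Fact susp_dec (x : M) : exists s c,
  [/\ uniq s, forall i, susp_deg i (c i) & x = \sum_(i <- s) c i].
Proof.
have [s [c [us hc ->]]] := gdec x.
exists [seq i - 1 | i <- s], (fun i => c (i + 1)); split=> [|i|].
- by rewrite map_inj_uniq // => i j /addIr.
- exact: hc.
- by rewrite big_map; apply: eq_bigr => i _; rewrite subrK.
Qed.

Fact susp_ind (s : seq int) (c : int -> M) : uniq s ->
  (forall i, susp_deg i (c i)) -> \sum_(i <- s) c i = 0 ->
  forall i, i \in s -> c i = 0.
Proof.
move=> us hc c0 i si.
have := @gind _ M [seq i + 1 | i <- s] (fun i => c (i - 1)).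
rewrite map_inj_uniq => [|? ? /addIr//].
move=> /(_ us) /(_ _) H; rewrite -[i](addrK 1); apply: H.
- by move=> j; have := hc (j - 1); rewrite /susp_deg subrK.
- by rewrite big_map -[RHS]c0; apply: eq_bigr => j _; rewrite addrK.
- exact: map_f.
Qed.

Definition susp : grmod k := @GrMod k M susp_deg
  (fun i => gdeg0 M (i + 1)) (fun i => @gdegP k M (i + 1)) susp_dec susp_ind.
End Susp.

Fixpoint whom M (ds : seq int) (w : seq M) : Prop :=
  match ds, w with
  | [::], [::] => True
  | d :: ds', x :: w' => gdeg d x /\ whom ds' w'
  | _, _ => False
  end.

Definition sumz (ds : seq int) : int := \sum_(d <- ds) d.

Definition bdeg M (n : int) : bar M -> Prop :=
  lspan (fun b => exists2 ds, sumz ds = n & exists2 w, whom ds w & b = bword w).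


Section Cohomology.
Variables (M : grmod k) (d : {linear M -> M}).
Hypothesis ddeg : forall i x, gdeg i x -> gdeg (i + 1) (d x).

Definition cyc_pred : {pred M} := fun x => d x == 0.

Fact cyc_submod : submod_closed cyc_pred.
Proof.
split=> [|a x y]; rewrite !unfold_in ?linear0 // => /eqP hx /eqP hy.
by rewrite linearP hx hy scaler0 addr0.
Qed.
HB.instance Definition _ := GRing.isSubmodClosed.Build k M cyc_pred cyc_submod.

Record cyc : Type := Cyc { cycv :> M; _ : cycv \in cyc_pred }.
HB.instance Definition _ := [isSub for cycv].
HB.instance Definition _ := [Choice of cyc by <:].
HB.instance Definition _ := [SubChoice_isSubLmodule of cyc by <:].

Lemma cycv_linear : linear cycv. Proof. exact: (linearP val). Qed.
HB.instance Definition _ := GRing.isLinear.Build k cyc M *:%R cycv cycv_linear.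

Definition bnd (z : cyc) : Prop := exists y, cycv z = d y.

Definition cohom := lquot bnd.
HB.instance Definition _ := GRing.Lmodule.on cohom.

(* h is the cohomology class of the cocycle x. *)
Definition is_class (x : M) (h : cohom) : Prop :=
  exists2 z : cyc, cycv z = x & h = lpi bnd z.

Definition cohom_deg (i : int) (h : cohom) : Prop :=
  exists2 x, gdeg i x & is_class x h.

Fact cohom_deg0 i : cohom_deg i 0.
Proof. by exists 0; [exact: gdeg0|exists 0; rewrite ?linear0]. Qed.

Fact cohom_degP i a x y :
  cohom_deg i x -> cohom_deg i y -> cohom_deg i (a *: x + y).
Proof.
move=> [u' hu [u eu ->]] [v' hv [v ev ->]]; exists (a *: u' + v').
  exact: gdegP.
by exists (a *: u + v); rewrite ?linearP -?eu -?ev.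
Qed.

Lemma lspan_bnd z : lspan bnd z -> bnd z.
Proof.
elim=> [|a u v [y hy] _ [x hx]]; first by exists 0; rewrite linear0.
by exists (a *: y + x); rewrite !linearP -hy -hx.
Qed.

Fact cohom_dec h : exists s c,
  [/\ uniq s, forall i, cohom_deg i (c i) & h = \sum_(i <- s) c i].
Proof.
have [z ->] := lpi_surj h.
have [s [c [us hc ez]]] := gdec (cycv z).
have dc i : i \in s -> d (c i) = 0.
  move=> si; pose e i := d (c (i - 1)).
  have -> : d (c i) = e (i + 1) by rewrite /e addrK.
  apply: (@gind _ M [seq i + 1 | i <- s] e); last exact: map_f.
  - by rewrite map_inj_uniq // => ? ? /addIr.
  - by move=> j; rewrite -[j in gdeg j](subrK 1); apply/ddeg/hc.
  have /eqP : d (cycv z) == 0 by case: (z).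
  apply: etrans; rewrite ez [RHS]linear_sum big_map /=; apply: eq_bigr => j _.
  by rewrite /e addrK.
pose c' i := if i \in s then c i else 0.
have hc' i : c' i \in cyc_pred.
  by rewrite /c'; case: ifP => [/dc h0|_]; rewrite unfold_in ?h0 ?linear0.
exists s, (fun i => lpi bnd (Cyc (hc' i))); split=> // [i|].
  exists (c' i); last by exists (Cyc (hc' i)).
  by rewrite /c'; case: ifP => _ //; apply: gdeg0.
rewrite -linear_sum; congr (lpi _ _); apply: val_inj; rewrite /= linear_sum /= ez.
by rewrite big_seq [RHS]big_seq; apply: eq_bigr => i si; rewrite /c' si.
Qed.

Fact cohom_ind (s : seq int) (c : int -> cohom) : uniq s ->
  (forall i, cohom_deg i (c i)) -> \sum_(i <- s) c i = 0 ->
  forall i, i \in s -> c i = 0.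
Proof.
move=> us hc c0 i si.
have /choice [z hz] : forall i, exists z : cyc,
    gdeg i (cycv z) /\ c i = lpi bnd z.
  by move=> j; have [x hj [z ez ->]] := hc j; exists z; rewrite ez.
have [y hy] : bnd (\sum_(j <- s) z j).
  apply: lspan_bnd; rewrite -[\sum_(_ <- _) _]subr0; apply/lpi_eqP.
  rewrite linear0 -c0 linear_sum; apply: eq_bigr => j _.
  by case: (hz j) => _ ->.
have [t [b [ut hb ey]]] := gdec y.
pose y' j := if j \in t then b j else 0.
pose e j := (if j \in s then cycv (z j) else 0) - d (y' (j - 1)).
have e0 : e i = 0.
  apply: (@gind _ M (undup (s ++ [seq j + 1 | j <- t])) e (undup_uniq _)).
  - move=> j; rewrite /e addrC -scaleN1r; apply: gdegP.
      rewrite -[j in gdeg j](subrK 1); apply: ddeg.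
      by rewrite /y'; case: ifP => _ //; apply: gdeg0.
    by case: ifP => _; [case: (hz j)|apply: gdeg0].
  - rewrite sumrB -big_mkcond /= -big_filter.
    have -> : \sum_(j <- undup (s ++ [seq j + 1 | j <- t])) d (y' (j - 1)) =
              \sum_(j <- undup (s ++ [seq j + 1 | j <- t]) |
                      j \in [seq j + 1 | j <- t]) d (b (j - 1)).
      rewrite [RHS]big_mkcond /=; apply: eq_bigr => j _.
      have -> : (j \in [seq i + 1 | i <- t]) = (j - 1 \in t).
        rewrite -{1}[j](subrK 1) (@mem_map _ _ (fun i : int => i + 1)) //.
        by move=> ? ? /addIr.
      by rewrite /y'; case: ifP => _ //; rewrite linear0.
    rewrite -[X in _ - X]big_filter.
    rewrite (perm_big s); last first.
      apply: uniq_perm; rewrite ?filter_uniq ?undup_uniq // => j.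
      by rewrite mem_filter mem_undup mem_cat; case: (j \in s).
    rewrite [X in _ - X](perm_big [seq j + 1 | j <- t]); last first.
      apply: uniq_perm; rewrite ?filter_uniq ?undup_uniq //.
        by rewrite map_inj_uniq // => ? ? /addIr.
      by move=> j; rewrite mem_filter mem_undup mem_cat;
        case: (j \in [seq _ | _ <- t]); rewrite ?orbT.
    rewrite big_map; apply/eqP; rewrite subr_eq0; apply/eqP.
    transitivity (d y).
      by rewrite -hy linear_sum.
    by rewrite ey linear_sum; apply: eq_bigr => j _; rewrite addrK.
  - by rewrite mem_undup mem_cat si.
have [_ ->] := hz i; rewrite -[RHS](linear0 (lpi bnd)); apply/lpi_eqP.
apply: lspan_gen; exists (y' (i - 1)); rewrite subr0.
by move/eqP: e0; rewrite /e si subr_eq0 => /eqP.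
Qed.

Definition gcohom : grmod k :=
  @GrMod k cohom cohom_deg cohom_deg0 cohom_degP cohom_dec cohom_ind.

End Cohomology.
End Graded.

Definition oddz (n : int) : bool := odd `|n|%N.

Section BInfinity.
Variable k : comNzRingType.

(* Koszul-signed identities are stated on words of homogeneous letters, which
   span the bar construction; the degrees ds, es are those in Sigma C. *)
Record binf_on (C : grmod k) := BInfOn {
  bdiff : {linear bar (susp C) -> bar (susp C)};
  bprod : {linear tens (bar (susp C)) (bar (susp C)) -> bar (susp C)};
  bdiff_deg : forall ds (w : seq (susp C)), whom ds w ->
    bdeg (sumz ds + 1) (bdiff (bword w));
  bprod_deg : forall ds es (u v : seq (susp C)), whom ds u -> whom es v ->
    bdeg (sumz ds + sumz es) (bprod (tprod (bword u) (bword v)));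
  bdiff_sq : forall b, bdiff (bdiff b) = 0;
  bprodA : forall a b c,
    bprod (tprod (bprod (tprod a b)) c) = bprod (tprod a (bprod (tprod b c)));
  bprod1l : forall b, bprod (tprod (bword [::]) b) = b;
  bprod1r : forall b, bprod (tprod b (bword [::])) = b;
  bdiff_prod : forall ds (u : seq (susp C)) b, whom ds u ->
    bdiff (bprod (tprod (bword u) b)) =
      bprod (tprod (bdiff (bword u)) b)
      + ksign k (sumz ds) *: bprod (tprod (bword u) (bdiff b));
  bcomul_diff : forall ds (u : seq (susp C)), whom ds u ->
    bcomul (bdiff (bword u)) =
      \sum_(0 <= i < (size u).+1)
        (tprod (bdiff (bword (take i u))) (bword (drop i u))
         + ksign k (sumz (take i ds)) *:
             tprod (bword (take i u)) (bdiff (bword (drop i u))));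
  bcounit_diff : forall b, bcounit (bdiff b) = 0;
  bcomul_prod : forall ds es (u v : seq (susp C)), whom ds u -> whom es v ->
    bcomul (bprod (tprod (bword u) (bword v))) =
      \sum_(0 <= i < (size u).+1) \sum_(0 <= j < (size v).+1)
        ksign k (sumz (drop i ds) * sumz (take j es)) *:
          tprod (bprod (tprod (bword (take i u)) (bword (take j v))))
                (bprod (tprod (bword (drop i u)) (bword (drop j v))));
  bcounit_prod : forall b c,
    bcounit (bprod (tprod b c)) = bcounit b * bcounit c;
  bantipode : exists S : {linear bar (susp C) -> bar (susp C)}, forall b,
    bprod (tmap S idfun (bcomul b)) = (bcounit b : k) *: bword [::] /\
    bprod (tmap idfun S (bcomul b)) = (bcounit b : k) *: bword [::]
}.

Record binf := BInf { bcar :> grmod k; bstr : binf_on bcar }.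

Definition bmul (C : binf) (b c : bar (susp C)) : bar (susp C) :=
  bprod (bstr C) (tprod b c).

Definition bd (C : binf) : {linear bar (susp C) -> bar (susp C)} :=
  bdiff (bstr C).

Definition bpow (C : binf) (b : bar (susp C)) (n : nat) : bar (susp C) :=
  iter n (fun c => bmul c b) (bword [::]).

(* Component (Sigma C)^{(x) r} (x) (Sigma C)^{(x) s} -> Sigma C of the product. *)
Definition bcomp (C : binf) (xs ys : seq (susp C)) : susp C :=
  bar1 (bmul (bword xs) (bword ys)).

Definition brace (C : binf) (x : susp C) (ys : seq (susp C)) : susp C :=
  bcomp [:: x] ys.

Definition circ (C : binf) (x y : susp C) : susp C := brace x [:: y].

(* ((x o x) o ...) o x with n occurrences of x, for n >= 1. *)
Definition circ_pow (C : binf) (x : susp C) (n : nat) : susp C :=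
  iter n.-1 (fun y => circ y x) x.

(* Component (Sigma C)^{(x) n} -> Sigma C of the differential. *)
Definition bdcomp (C : binf) (xs : seq (susp C)) : susp C :=
  bar1 (bd C (bword xs)).

Section Homology.
Variable C : binf.

Definition bd1 (x : C) : C := bdcomp ([:: x] : seq (susp C)).

Fact bd1_linear : linear bd1.
Proof.
move=> a x y; rewrite /bd1 /bdcomp.
by rewrite (@bword_multilin _ (susp C) [::] a x y [::]) !linearP.
Qed.
HB.instance Definition _ := GRing.isLinear.Build k C C *:%R bd1 bd1_linear.

Fact bar1_deg n (b : bar (susp C)) : bdeg n b -> @gdeg k (susp C) n (bar1 b).
Proof.
elim=> [|a b1 b' [ds <- [w hw ->]] _ IH]; first by rewrite linear0; apply: gdeg0.
rewrite linearP; apply: gdegP => //.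
rewrite /= bar1E {IH}.
case: w ds hw => [|x [|y w]] [|d [|e ds]] //= hw; try exact: gdeg0.
  by case: hw => hx _; rewrite /sumz big_seq1.
by case: hw.
Qed.

Fact bd1_deg i (x : C) : gdeg i x -> gdeg (i + 1) (bd1 x).
Proof.
move=> hx; rewrite -[i](subrK 1) in hx *.
have /(bdiff_deg (bstr C))/bar1_deg : whom [:: i - 1] ([:: x] : seq (susp C)).
  by [].
by rewrite /sumz big_seq1.
Qed.

Definition homology : grmod k := gcohom bd1_deg.

(* h is the homology class of the cocycle x, in Sigma H_*(C). *)
Definition hclass (x : susp C) (h : susp homology) : Prop :=
  @is_class k C bd1 x h.

End Homology.

Record binf_map (C D : binf) := BInfMap {
  bfun :> {linear C -> D};
  bfun_deg : forall i x, gdeg i x -> gdeg i (bfun x);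
  bfun_diff : forall b : bar (susp C),
    @bmap k (susp C) (susp D) bfun (bd C b) =
    bd D (@bmap k (susp C) (susp D) bfun b);
  bfun_mul : forall b c : bar (susp C),
    @bmap k (susp C) (susp D) bfun (bmul b c) =
    bmul (@bmap k (susp C) (susp D) bfun b) (@bmap k (susp C) (susp D) bfun c)
}.

End BInfinity.

Section Lie.
Variable k : comNzRingType.

(* The reduced square (resp. the p-power below) is an operation on the
   homogeneous elements of odd (resp. even) degree; its values elsewhere are
   irrelevant. *)
Record grlie (L : grmod k) := GrLie {
  lbr : L -> L -> L;
  lsq : L -> L;
  lbr_linl : forall z, linear (lbr^~ z);
  lbr_linr : forall z, linear (lbr z);
  lbr_deg : forall i j x y, gdeg i x -> gdeg j y -> gdeg (i + j) (lbr x y);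
  lsq_deg : forall i x, oddz i -> gdeg i x -> gdeg (i *+ 2) (lsq x);
  lbr_anti : forall i j x y, gdeg i x -> gdeg j y ->
    lbr x y = - (ksign k (i * j) *: lbr y x);
  lbr_even : forall i x, ~~ oddz i -> gdeg i x -> lbr x x = 0;
  lbr_jacobi : forall i j x y z, gdeg i x -> gdeg j y ->
    lbr x (lbr y z) = lbr (lbr x y) z + ksign k (i * j) *: lbr y (lbr x z);
  lbr_odd : forall i x, oddz i -> gdeg i x -> lbr x (lbr x x) = 0;
  lsqD : forall i x y, oddz i -> gdeg i x -> gdeg i y ->
    lsq (x + y) = lsq x + lsq y + lbr x y;
  lsqZ : forall i a x, oddz i -> gdeg i x -> lsq (a *: x) = a ^+ 2 *: lsq x;
  lsq_ad : forall i x z, oddz i -> gdeg i x ->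
    lbr (lsq x) z = lbr x (lbr x z)
}.

(* For c the sequence of coefficients of a polynomial in t with coefficients in
   L, that of its image under ad(tx + y). *)
Definition ad_txy (L : grmod k) (S : grlie L) (x y : L) (c : nat -> L) (j : nat)
  : L := lbr S y (c j) + (if j is j'.+1 then lbr S x (c j') else 0).

(* Coefficient of t^j in ad(tx + y)^n (x). *)
Definition ad_coef (L : grmod k) (S : grlie L) (x y : L) (n j : nat) : L :=
  iter n (ad_txy S x y) (fun i => if i == 0%N then x else 0) j.

Record rgrlie (p : nat) (L : grmod k) := RGrLie {
  rlie :> grlie L;
  lpow : L -> L;
  lpow_deg : forall i x, ~~ oddz i -> gdeg i x -> gdeg (i *+ p) (lpow x);
  lpowZ : forall i a x, ~~ oddz i -> gdeg i x -> lpow (a *: x) = a ^+ p *: lpow x;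
  lpow_ad : forall i x y, ~~ oddz i -> gdeg i x ->
    lbr rlie (lpow x) y = iter p (lbr rlie x) y;
  lpowD : forall i x y, ~~ oddz i -> gdeg i x -> gdeg i y ->
    exists2 s : nat -> L,
      (forall j, (0 < j < p)%N -> s j *+ j = ad_coef rlie x y p.-1 j.-1) &
      lpow (x + y) = lpow x + lpow y + \sum_(1 <= j < p) s j
}.

Record rlie_hom (p : nat) (L L' : grmod k) (S : rgrlie p L) (S' : rgrlie p L')
    (f : {linear L -> L'}) : Prop := RLieHom {
  rhom_deg : forall i x, gdeg i x -> gdeg i (f x);
  rhom_lbr : forall x y, f (lbr S x y) = lbr S' (f x) (f y);
  rhom_lsq : forall i x, oddz i -> gdeg i x -> f (lsq S x) = lsq S' (f x);
  rhom_lpow : forall i x, ~~ oddz i -> gdeg i x -> f (lpow S x) = lpow S' (f x)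
}.

End Lie.

Section DGCategories.
Variable k : comNzRingType.

(* [dhom a b] is Hom_A(a, b), also written {}_b A_a. *)
Record dgcat := DGCat {
  dob : Type;
  dhom : dob -> dob -> grmod k;
  ddiff : forall a b, {linear dhom a b -> dhom a b};
  did : forall a, dhom a a;
  dcomp : forall a b c, dhom b c -> dhom a b -> dhom a c;
  ddiff_deg : forall a b i (f : dhom a b), gdeg i f -> gdeg (i + 1) (ddiff a b f);
  ddiff_sq : forall a b (f : dhom a b), ddiff a b (ddiff a b f) = 0;
  did_deg : forall a, gdeg 0 (did a);
  dcomp_linl : forall a b c (g : dhom a b),
    linear (fun f : dhom b c => dcomp f g);
  dcomp_linr : forall a b c (f : dhom b c),
    linear (fun g : dhom a b => dcomp f g);
  dcomp_deg : forall a b c i j (f : dhom b c) (g : dhom a b),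
    gdeg i f -> gdeg j g -> gdeg (i + j) (dcomp f g);
  dcompA : forall a b c d (f : dhom c d) (g : dhom b c) (h : dhom a b),
    dcomp f (dcomp g h) = dcomp (dcomp f g) h;
  dcomp1l : forall a b (f : dhom a b), dcomp (did b) f = f;
  dcomp1r : forall a b (f : dhom a b), dcomp f (did a) = f;
  ddiff_comp : forall a b c i (f : dhom b c) (g : dhom a b), gdeg i f ->
    ddiff a c (dcomp f g) =
      dcomp (ddiff b c f) g + ksign k i *: dcomp f (ddiff a b g)
}.

Definition projective_mod (P : lmodType k) : Prop :=
  forall (M N : lmodType k) (g : {linear M -> N}) (h : {linear P -> N}),
    (forall y, exists x, g x = y) ->
    exists h' : {linear P -> M}, forall x, g (h' x) = h x.

Definition dg_projective (A : dgcat) : Prop :=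
  forall a b : dob A, projective_mod (dhom a b).

Record dgfunctor (A B : dgcat) := DGFunctor {
  fob :> dob A -> dob B;
  fmor : forall a b, {linear dhom a b -> dhom (fob a) (fob b)};
  fmor_deg : forall a b i (f : dhom a b), gdeg i f -> gdeg i (fmor a b f);
  fmor_diff : forall a b (f : dhom a b),
    fmor a b (ddiff a b f) = ddiff _ _ (fmor a b f);
  fmor_id : forall a, fmor a a (did a) = did (fob a);
  fmor_comp : forall a b c (f : dhom b c) (g : dhom a b),
    fmor a c (dcomp f g) = dcomp (fmor b c f) (fmor a b g)
}.

Record dgembedding (A B : dgcat) := DGEmbedding {
  emb :> dgfunctor A B;
  emb_ff : forall a b, bijective (fmor emb a b)
}.

End DGCategories.

Section Hochschild.
Variables (k : comNzRingType) (A : dgcat k).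

(* Composable strings f_n, ..., f_1 of morphisms, written in the order of
   composition: the head of [pcons f p] is the last morphism f_n. *)
Inductive dgpath (a : dob A) : dob A -> Type :=
| pnil : dgpath a a
| pcons b c : dhom b c -> dgpath a b -> dgpath a c.

Fixpoint psize a b (p : dgpath a b) : nat :=
  if p is pcons _ _ _ p' then (psize p').+1 else 0.

Fixpoint pcat a b c (u : dgpath b c) : dgpath a b -> dgpath a c :=
  match u in dgpath _ c0 return dgpath a b -> dgpath a c0 with
  | pnil => fun v => v
  | pcons _ _ f u' => fun v => pcons f (pcat u' v)
  end.

(* The morphisms of p are homogeneous, of the degrees listed in es. *)
Fixpoint phom (es : seq int) a b (p : dgpath a b) : Prop :=
  match p, es with
  | pnil, [::] => True
  | pcons _ _ f p', e :: es' => gdeg e f /\ phom es' p'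
  | _, _ => False
  end.

(* All decompositions of p as a concatenation of two strings. *)
Fixpoint psplits a b (p : dgpath a b) : seq {c : dob A & dgpath c b * dgpath a c}%type :=
  match p in dgpath _ b0 return seq {c : dob A & dgpath c b0 * dgpath a c}%type with
  | pnil => [:: existT _ a (pnil a, pnil a)]
  | pcons b1 c1 f p' =>
      existT _ c1 (pnil c1, pcons f p') ::
      [seq existT _ (tag s) (pcons f (tagged s).1, (tagged s).2) | s <- psplits p']
  end.

Definition cochain_fun := forall a b, dgpath a b -> dhom a b.

Definition pmultilin (phi : cochain_fun) : Prop :=
  forall a b c d (u : dgpath c d) x (f g : dhom b c) (v : dgpath a b),
    phi _ _ (pcat u (pcons (x *: f + g) v)) =
    x *: phi _ _ (pcat u (pcons f v)) + phi _ _ (pcat u (pcons g v)).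

(* A cochain of degree i takes n morphisms of degrees es to a morphism of
   degree sum es + (i - n). *)
Definition cochain_deg (i : int) (phi : cochain_fun) : Prop :=
  forall a b (p : dgpath a b) es, phom es p ->
    gdeg (sumz es + (i - (psize p)%:Z)) (phi a b p).

Definition cochain_fin (phi : cochain_fun) : Prop :=
  exists s (c : int -> cochain_fun),
    [/\ uniq s, forall i, pmultilin (c i), forall i, cochain_deg i (c i) &
        forall a b p, phi a b p = \sum_(i <- s) c i a b p].

(* The total module of C^*(A, A): an element is a family of multilinear maps on
   composable strings (one for each string of objects) that is a finite sum of
   homogeneous such families. The families in degree i thus form the product
   over n and over strings of objects of the maps of internal degree i - n. *)
Record cochain := Cochain {
  cfun :> forall a b, dgpath a b -> dhom a b;
  cfun_multi : pmultilin cfun;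
  cfun_fin : cochain_fin cfun
}.

HB.instance Definition _ := gen_eqMixin cochain.
HB.instance Definition _ := gen_choiceMixin cochain.

Lemma cochainP (x y : cochain) : (forall a b p, x a b p = y a b p) -> x = y.
Proof.
move: x y => [f fm ff] [g gm gf] /= e.
have efg : f = g by do 3!apply: functional_extensionality_dep => ?; apply: e.
by subst g; congr Cochain; apply: Prop_irrelevance.
Qed.

Lemma pmultilin0 : pmultilin (fun a b _ => 0).
Proof. by move=> *; rewrite scaler0 addr0. Qed.

Lemma pmultilinP r (x y : cochain_fun) : pmultilin x -> pmultilin y ->
  pmultilin (fun a b p => r *: x a b p + y a b p).
Proof.
move=> hx hy a b c d u t f g v; rewrite hx hy !scalerDr !scalerA addrACA.
by rewrite [r * t]mulrC.
Qed.

Lemma cochain_deg0 i : cochain_deg i (fun a b _ => 0).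
Proof. by move=> *; apply: gdeg0. Qed.

Lemma cochain_degP i r (x y : cochain_fun) : cochain_deg i x -> cochain_deg i y ->
  cochain_deg i (fun a b p => r *: x a b p + y a b p).
Proof. by move=> hx hy a b p es h; apply: gdegP; [apply: hx|apply: hy]. Qed.

Lemma cochain_fin0 : cochain_fin (fun a b _ => 0).
Proof.
exists [::], (fun i a b _ => 0); split=> //; first by move=> i; apply: pmultilin0.
  by move=> i; apply: cochain_deg0.
by move=> *; rewrite big_nil.
Qed.

Lemma cochain_finP r (x y : cochain_fun) : cochain_fin x -> cochain_fin y ->
  cochain_fin (fun a b p => r *: x a b p + y a b p).
Proof.
move=> [s [c [us cm cd cE]]] [s' [c' [us' cm' cd' cE']]].
pose e i : cochain_fun := if i \in s then c i else (fun a b _ => 0).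
pose e' i : cochain_fun := if i \in s' then c' i else (fun a b _ => 0).
have eE (t t' : seq int) (z : int -> cochain_fun) a b (p : dgpath a b) :
    uniq t -> \sum_(i <- t) z i a b p =
    \sum_(i <- undup (t ++ t')) (if i \in t then z i else (fun a b _ => 0)) a b p.
  move=> ut; transitivity (\sum_(i <- undup (t ++ t') | i \in t) z i a b p).
    rewrite -[RHS]big_filter; apply: perm_big.
    apply: uniq_perm; rewrite ?filter_uniq ?undup_uniq // => j.
    by rewrite mem_filter mem_undup mem_cat; case: (j \in t).
  by rewrite big_mkcond; apply: eq_bigr => i _; case: ifP.
exists (undup (s ++ s')), (fun i a b p => r *: e i a b p + e' i a b p); split.
- exact: undup_uniq.
- by move=> i; apply: pmultilinP; rewrite /e /e'; case: ifP => _ //;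
    apply: pmultilin0.
- by move=> i; apply: cochain_degP; rewrite /e /e'; case: ifP => _ //;
    apply: cochain_deg0.
- move=> a b p; rewrite big_split /= -scaler_sumr; congr (_ *: _ + _).
    by rewrite cE; apply: eE.
  rewrite cE' (eE _ s) //; apply: perm_big.
  apply: uniq_perm; rewrite ?undup_uniq // => j.
  by rewrite !mem_undup !mem_cat orbC.
Qed.

Definition cochain0 := Cochain pmultilin0 cochain_fin0.

Definition cochain_comb r (x y : cochain) : cochain :=
  Cochain (pmultilinP r (cfun_multi x) (cfun_multi y))
          (cochain_finP r (cfun_fin x) (cfun_fin y)).

Definition cochain_add x y := cochain_comb 1 x y.
Definition cochain_scale r x := cochain_comb r x cochain0.
Definition cochain_opp x := cochain_scale (-1) x.

Fact cochain_addA : associative cochain_add.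
Proof. by move=> x y z; apply: cochainP => a b p /=; rewrite !scale1r addrA. Qed.
Fact cochain_addC : commutative cochain_add.
Proof. by move=> x y; apply: cochainP => a b p /=; rewrite !scale1r addrC. Qed.
Fact cochain_add0 : left_id cochain0 cochain_add.
Proof. by move=> x; apply: cochainP => a b p /=; rewrite scaler0 add0r. Qed.
Fact cochain_addN : left_inverse cochain0 cochain_opp cochain_add.
Proof.
by move=> x; apply: cochainP => a b p /=; rewrite scale1r scaleN1r addr0 addNr.
Qed.
HB.instance Definition _ := GRing.isZmodule.Build cochain
  cochain_addA cochain_addC cochain_add0 cochain_addN.

Fact cochain_scaleA r t x : cochain_scale r (cochain_scale t x) = cochain_scale (r * t) x.
Proof. by apply: cochainP => a b p /=; rewrite !addr0 scalerA. Qed.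
Fact cochain_scale1 : left_id 1 cochain_scale.
Proof. by move=> x; apply: cochainP => a b p /=; rewrite scale1r addr0. Qed.
Fact cochain_scaleDr : right_distributive cochain_scale +%R.
Proof.
by move=> r x y; apply: cochainP => a b p /=; rewrite !addr0 !scale1r scalerDr.
Qed.
Fact cochain_scaleDl x : {morph cochain_scale^~ x : r t / r + t}.
Proof.
by move=> r t; apply: cochainP => a b p /=; rewrite !addr0 scale1r scalerDl.
Qed.
HB.instance Definition _ := GRing.Zmodule_isLmodule.Build k cochain
  cochain_scaleA cochain_scale1 cochain_scaleDr cochain_scaleDl.

Lemma cfunP r (x y : cochain) a b p :
  (r *: x + y) a b p = r *: x a b p + y a b p.
Proof.
by change (1 *: (r *: x a b p + 0) + y a b p = r *: x a b p + y a b p);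
  rewrite scale1r addr0.
Qed.

Lemma cfun_sum (s : seq int) (c : int -> cochain) a b p :
  (\sum_(i <- s) c i) a b p = \sum_(i <- s) c i a b p.
Proof.
elim: s => [|i s IH]; first by rewrite !big_nil.
rewrite !big_cons -IH; have := cfunP 1 (c i) (\sum_(j <- s) c j) p.
by rewrite !scale1r.
Qed.

Lemma pcat_nil a b (u : dgpath a b) : pcat u (pnil a) = u.
Proof. by elim: u => //= b' c f u ->. Qed.

Lemma pcatA a b c d (u : dgpath c d) (v : dgpath b c) (w : dgpath a b) :
  pcat u (pcat v w) = pcat (pcat u v) w.
Proof. by elim: u v => //= b' c' f u IH v; rewrite IH. Qed.

Lemma phom_cat es es' a b c (u : dgpath b c) (v : dgpath a b) :
  phom es u -> phom es' v -> phom (es ++ es') (pcat u v).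
Proof.
elim: u es v => [|b' c' f u IH] [|e es] v //= [hf hu] hv; split=> //.
exact: IH.
Qed.

Lemma pmultilin_eq0 (phi : cochain_fun) : pmultilin phi ->
  (forall es a b (p : dgpath a b), phom es p -> phi a b p = 0) ->
  forall a b (p : dgpath a b), phi a b p = 0.
Proof.
move=> hm h a b p; have : phi a b (pcat (pnil b) p) = 0; last by [].
suff H c es (u : dgpath b c) : phom es u -> phi a c (pcat u p) = 0.
  by apply: (H b [::]).
elim: p c u es => [|b1 c1 f p IH] c u es hu.
  by rewrite pcat_nil; apply: h hu.
have [s [g [_ hg ->]]] := gdec f.
elim: s => [|i s IHs].
  rewrite big_nil; have := hm _ _ _ _ u (-1) 0 0 p.
  by rewrite scaler0 addr0 scaleN1r addNr.
rewrite big_cons -{1}[g i]scale1r hm IHs addr0 scale1r.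
rewrite -[pcons _ _]/(pcat (pcons (g i) (pnil b1)) p) pcatA.
by apply: (IH _ _ (es ++ [:: i])); apply: phom_cat.
Qed.

Definition hoch_deg (i : int) (x : cochain) : Prop := cochain_deg i x.

Fact hoch_deg0 i : hoch_deg i 0.
Proof. exact: cochain_deg0. Qed.

Fact hoch_degP i r (x y : cochain) :
  hoch_deg i x -> hoch_deg i y -> hoch_deg i (r *: x + y).
Proof.
by move=> hx hy a b p es h; rewrite cfunP; apply: gdegP; [apply: hx|apply: hy].
Qed.

Fact hoch_dec (x : cochain) : exists s c,
  [/\ uniq s, forall i, hoch_deg i (c i) & x = \sum_(i <- s) c i].
Proof.
have [s [c [us cm cd cE]]] := cfun_fin x.
have cf i : cochain_fin (c i).
  by exists [:: i], c; split=> // a b p; rewrite big_seq1.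
exists s, (fun i => Cochain (cm i) (cf i)); split=> //.
by apply: cochainP => a b p; rewrite cfun_sum cE.
Qed.

Fact hoch_ind (s : seq int) (c : int -> cochain) : uniq s ->
  (forall i, hoch_deg i (c i)) -> \sum_(i <- s) c i = 0 ->
  forall i, i \in s -> c i = 0.
Proof.
move=> us hc c0 i si; apply: cochainP.
apply: (pmultilin_eq0 (cfun_multi _)) => es a b p hp.
pose t : int := sumz es - (psize p)%:Z.
pose e j := c (j - t) a b p.
have -> : c i a b p = e (i + t) by rewrite /e addrK.
apply: (@gind _ _ [seq j + t | j <- s] e); last exact: map_f.
- by rewrite map_inj_uniq // => ? ? /addIr.
- move=> j; have := hc (j - t) _ _ _ _ hp.
  by congr gdeg; rewrite /t opprB addrA addrA [_ + _ - _]addrC; lia.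
- rewrite big_map; transitivity ((\sum_(j <- s) c j) a b p); last by rewrite c0.
  by rewrite cfun_sum; apply: eq_bigr => j _; rewrite /e addrK.
Qed.

(* The graded module underlying C^*(A, A). *)
Definition hoch : grmod k :=
  @GrMod k cochain hoch_deg hoch_deg0 hoch_degP hoch_dec hoch_ind.

End Hochschild.

Section HochschildBInfinity.
Variables (k : comNzRingType) (A : dgcat k).

(* Sum over all insertions of y_1, ..., y_s, in this order, into the string p.
   All signs are Koszul signs for the shifted degrees, both of the cochains
   (d = |y| in [ys]) and of the morphisms (a morphism of degree e counts e - 1;
   [es] lists the e): y_j is moved past all morphisms of p to its left. The
   integer l is the total shifted degree of the morphisms to the left of p. *)
Definition sdegs (es : seq int) : int := \sum_(e <- es) (e - 1).

Fixpoint insertions (V : lmodType k) (ys : seq (int * cochain A)) (l : int)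
    (es : seq int) a b (p : dgpath a b) (K : dgpath a b -> V) : V :=
  if ys is (d, y) :: ys' then
    \sum_(s <- psplits p) \sum_(r <- psplits (tagged s).2)
      let q := (tagged s).1 in
      let u := (tagged r).1 in
      let n := psize q in
      let m := (n + psize u)%N in
      ksign k (d * (l + sdegs (take n es))) *:
        insertions ys' (l + sdegs (take m es)) (drop m es) (tagged r).2
          (fun v => K (pcat q (pcons (y _ _ u) v)))
  else K p.

(* The structure of A as a cochain m of degree 2, with components the
   differential and the composition of A, with the sign making the relation
   m o m = 0 hold for the Koszul-signed braces. *)
Definition structure_cochain (m : cochain A) : Prop :=
  [/\ forall a, m _ _ (pnil a) = 0,
      forall a b (f : dhom a b), m _ _ (pcons f (pnil a)) = ddiff a b f,
      forall a b c i (f : dhom b c) (g : dhom a b), gdeg i f ->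
        m _ _ (pcons f (pcons g (pnil a))) = ksign k i *: dcomp f g &
      forall a b (p : dgpath a b), (2 < psize p)%N -> m _ _ p = 0].

(* The B_infinity-structure on C^*(A, A), described by its components: the
   differential is [m, -], which is the Hochschild differential; the cup
   product is m{x, y}, i.e. (up to the Koszul sign) x (x) y followed by
   composition; the products of a single cochain with words are the braces. All
   other components vanish. *)
Definition is_hochschild (S : binf_on (hoch A)) : Prop :=
  let C := BInf S in
  exists2 m : hoch A, structure_cochain m &
  [/\ forall d (x : susp C), gdeg d x ->
        bdcomp [:: x] =
          circ (m : susp C) x - ksign k d *: circ x (m : susp C),
      forall x y : susp C, bdcomp [:: x; y] = brace (m : susp C) [:: x; y],
      forall xs : seq (susp C), (2 < size xs)%N -> bdcomp xs = 0,
      forall (x : susp C) ds (ys : seq (susp C)), whom ds ys ->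
        forall a b (p : dgpath a b) es, phom es p ->
          (brace x ys : cochain A) a b p =
          insertions (zip ds (ys : seq (cochain A))) 0 es p
            (fun q => (x : cochain A) a b q) &
      forall xs ys : seq (susp C), (1 < size xs)%N -> bcomp xs ys = 0].

End HochschildBInfinity.

Section Restriction.
Variables (k : comNzRingType) (A B : dgcat k) (F : dgembedding A B).

Lemma fmor_surj a b (g : dhom (F a) (F b)) : exists f, fmor F a b f = g.
Proof. by have [h _ hK] := emb_ff F a b; exists (h g). Qed.

Definition fmor_inv a b (g : dhom (F a) (F b)) : dhom a b :=
  sval (cid (fmor_surj g)).

Lemma fmor_invK a b (g : dhom (F a) (F b)) : fmor F a b (fmor_inv g) = g.
Proof. by rewrite /fmor_inv; case: cid. Qed.

Lemma fmor_inj a b : injective (fmor F a b).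
Proof. by have [h hK _] := emb_ff F a b; apply: can_inj hK. Qed.

Lemma fmor_inv_linear a b : linear (@fmor_inv a b).
Proof. by move=> x f g; apply: fmor_inj; rewrite linearP !fmor_invK. Qed.

Lemma fmor_inv_deg a b i (g : dhom (F a) (F b)) :
  gdeg i g -> gdeg i (fmor_inv g).
Proof.
move=> hg; have [s [c [us hc ec]]] := gdec (fmor_inv g).
pose e j := fmor F a b (c j) - (if j == i then g else 0).
have eg : g = \sum_(j <- s) fmor F a b (c j) by rewrite -linear_sum -ec fmor_invK.
pose c' j := (if j \in s then fmor F a b (c j) else 0) - (if j == i then g else 0).
have h0 j : j \in undup (i :: s) -> c' j = 0.
  apply: (@gind _ _ (undup (i :: s)) c'); first exact: undup_uniq.
    move=> l; rewrite /c' addrC -scaleN1r; apply: gdegP.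
      by case: eqP => [->|_] //; apply: gdeg0.
    by case: ifP => _; [apply/fmor_deg/hc|apply: gdeg0].
  rewrite sumrB; apply/eqP; rewrite subr_eq0; apply/eqP.
  transitivity g; last first.
    rewrite -big_mkcond -big_filter (perm_big [:: i]) ?big_seq1 //.
    apply: uniq_perm; rewrite ?filter_uniq ?undup_uniq // => l.
    by rewrite mem_filter mem_undup !inE; case: eqP.
  rewrite -big_mkcond -big_filter (perm_big s) //.
  apply: uniq_perm; rewrite ?filter_uniq ?undup_uniq // => l.
  by rewrite mem_filter mem_undup !inE; case: (l \in s); rewrite ?orbT.
rewrite ec big_seq; elim/big_rec: _ => [|j x js hx]; first exact: gdeg0.
apply: gdegD => //; have [<-|ji] := eqVneq j i; first exact: hc.
have := h0 j; rewrite mem_undup inE js orbT => /(_ isT).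
rewrite /c' js (negbTE ji) subr0 -[0](linear0 (fmor F a b)) => /fmor_inj ->.
exact: gdeg0.
Qed.

Fixpoint dgpath_map a b (p : dgpath a b) : dgpath (F a) (F b) :=
  match p in dgpath _ b0 return dgpath (F a) (F b0) with
  | pnil => pnil (F a)
  | pcons _ _ f p' => pcons (fmor F _ _ f) (dgpath_map p')
  end.

Lemma dgpath_map_cat a b c (u : dgpath b c) (v : dgpath a b) :
  dgpath_map (pcat u v) = pcat (dgpath_map u) (dgpath_map v).
Proof. by elim: u v => //= b' c' f u IH v; rewrite IH. Qed.

Lemma dgpath_map_size a b (p : dgpath a b) : psize (dgpath_map p) = psize p.
Proof. by elim: p => //= b' c' f p ->. Qed.

Lemma dgpath_map_hom es a b (p : dgpath a b) : phom es p -> phom es (dgpath_map p).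
Proof.
by elim: p es => [|b' c' f p IH] [|e es] //= [hf hp]; split;
  [apply: fmor_deg|apply: IH].
Qed.

Definition restrict_fun (phi : cochain_fun B) : cochain_fun A :=
  fun a b p => fmor_inv (phi _ _ (dgpath_map p)).

Lemma restrict_multi (phi : cochain_fun B) :
  pmultilin phi -> pmultilin (restrict_fun phi).
Proof.
move=> hm a b c d u x f g v; rewrite /restrict_fun !dgpath_map_cat /= linearP hm.
exact: fmor_inv_linear.
Qed.

Lemma restrict_deg i (phi : cochain_fun B) :
  cochain_deg i phi -> cochain_deg i (restrict_fun phi).
Proof.
move=> h a b p es hp; apply: fmor_inv_deg.
by rewrite -(dgpath_map_size p); apply/h/dgpath_map_hom.
Qed.

Lemma restrict_fin (phi : cochain_fun B) :
  cochain_fin phi -> cochain_fin (restrict_fun phi).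
Proof.
move=> [s [c [us cm cd cE]]]; exists s, (fun i => restrict_fun (c i)); split=> //.
- by move=> i; apply: restrict_multi.
- by move=> i; apply: restrict_deg.
move=> a b p; rewrite /restrict_fun cE; apply: fmor_inj.
by rewrite fmor_invK linear_sum; apply: eq_bigr => i _; rewrite fmor_invK.
Qed.

(* The map C^*(B, B) -> C^*(A, A) induced by the embedding F. *)
Definition restrict (phi : hoch B) : hoch A :=
  Cochain (restrict_multi (cfun_multi phi)) (restrict_fin (cfun_fin phi)).

End Restriction.

Section InducedStructure.
Variable k : comNzRingType.

Definition noetherian (R : comNzRingType) : Prop :=
  forall I : R -> Prop, I 0 -> (forall a x y, I x -> I y -> I (a * x + y)) ->
  exists (n : nat) (g : 'I_n -> R),
    forall x, I x <-> exists c : 'I_n -> R, x = \sum_i c i * g i.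

Definition contains_field (p : nat) (R : comNzRingType) : Prop :=
  exists (F : fieldType) (f : {rmorphism F -> R}), injective f /\ p \in [pchar F].

(* The operations of L on Sigma H_*(C) are those induced from C. In every
   B_infinity-algebra x^{[p]} is the class of the p-th power of x in the algebra
   BC, which lies in Sigma C = (Sigma C)^{(x) 1}. If moreover the product has no
   components (Sigma C)^{(x) r} (x) Sigma C -> Sigma C with r > 1, as is the case
   for Hochschild cochains, this power is ((x o x) o ...) o x.
   That condition cannot be dropped: for p = 3, let C have zero differential and
   a basis x_n = t^n d/dt (n >= 0) with |x_n| = 0, and product opposite to the one
   given by the braces x_n{x_(m_1), ..., x_(m_s)} = 'C(n, s) x_(n + sum m_i - s).
   Then (x_2 o x_2) o x_2 = x_4 with [x_4, x_0] <> 0, while ad(x_2)^3 = 0. *)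
Definition induced_rgrlie (p : nat) (C : binf k) (L : rgrlie p (susp (homology C)))
  : Prop :=
  [/\ forall i j (x y : susp C) hx hy, gdeg i x -> gdeg j y ->
        hclass x hx -> hclass y hy ->
        hclass (circ x y - ksign k (i * j) *: circ y x) (lbr L hx hy),
      forall i (x : susp C) hx, oddz i -> gdeg i x -> hclass x hx ->
        hclass (circ x x) (lsq L hx),
      forall i (x : susp C) hx, ~~ oddz i -> gdeg i x -> hclass x hx ->
        exists2 z : susp C, bpow (bword [:: x]) p = bword [:: z] &
          hclass z (lpow L hx) &
      (forall (xs : seq (susp C)) y, (1 < size xs)%N -> bcomp xs [:: y] = 0) ->
      forall i (x : susp C) hx, ~~ oddz i -> gdeg i x -> hclass x hx ->
        hclass (circ_pow x p) (lpow L hx)].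

(* h is the map in homology induced by f. *)
Definition induced_map (C D : binf k) (f : C -> D)
    (h : susp (homology C) -> susp (homology D)) : Prop :=
  forall x hx, hclass (C := C) x hx -> hclass (C := D) (f x) (h hx).

End InducedStructure.

(* Main.v *)
Require Import Defs.
From HB Require Import structures.
From mathcomp Require Import all_boot all_order all_algebra.
From mathcomp Require Import boolp.
From mathcomp.multinomials Require Import monalg.
From mathcomp Require Import zify ring.

Set Implicit Arguments.
Unset Strict Implicit.
Unset Printing Implicit Defensive.

Import GRing.Theory.

Local Open Scope ring_scope.

(** Let BC be the bar construction of C. Deconcatenation has few primitive
    elements: a primitive element killed by the counit is a word with one letter
    ([primP]), because it can be recovered from its coproduct by reading off the
    last letter ([tlast_com]). Conversely letters are primitive, and the product
    of BC is a map of coalgebras; hence graded commutators of letters, squares of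
    odd letters and, when p = 0 in k, p-th powers of even letters are again
    primitive ([bracket_letter], [square_letter], [pow_letter]). So Sigma C is
    closed under the operations that make every associative algebra in
    characteristic p a restricted graded Lie algebra, and all the identities
    become identities between commutators in BC; the one for (x + y)^p is
    Jacobson's formula [jacobson_formula].

    To pass to homology, the operations must respect classes. For the bracket
    this holds because the differential d is a derivation. By the formulas for
    (x + y)^2 and (x + y)^p it remains to see that, for u = d y, the letter u^2
    (y even) or u^p (y odd) is the boundary of a letter and not merely of an
    element of BC. Of course u^p = d (y u^(p-1)), but y u^(p-1) is not a letter.
    The solution is to add to y u^n the boundary of an explicit combination of
    words, so that only words u^(n+1-j) g_j, ending in certain letters g_j and
    with coefficient the binomial 'C(n + 1, j), remain ([boundary_power_step]).
    For n + 1 = p the binomials kill everything except the letter g_p.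
    The formulas are natural, so a linear map that commutes with the
    differential, with the operation o and with p-th powers induces a map of
    restricted Lie algebras ([hmap_rlie_hom]).

    For the Hochschild complex the B_infinity-structure has to be constructed,
    that is, the braces must be extended to a Hopf algebra structure on the bar
    construction. Both the braces and the product of words are signed sums [ins]
    over the insertions of a word into a path: of cochains into a string of
    morphisms, or of the letters of a word u into a word v. One identity,
    [ins_comp] (inserting v and then u is inserting all insertions of u into v),
    gives first the higher pre-Lie identity of the braces and then the
    associativity of the product, and [ins_split] its compatibility with
    deconcatenation. The differential is the graded commutator with the letter m,
    the structure cochain; all its properties follow from associativity, from m
    being a letter and from m o m = 0, which expresses that A is a dg category
    ([str_sq]). The antipode is a geometric series for the convolution product.

    Finally, restricting cochains along a fully faithful embedding commutes with
    all insertions ([insertions_restrict]), hence with the differential and with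
    o. In the Hochschild algebra a product of several letters with one letter has
    no one-letter component, so x^p is the iterated product ((x o x) o ...) o x
    and restriction commutes with it as well. *)

(** * Commutators in characteristic p *)

Section Commutators.
Variable R : nzRingType.
Implicit Types a b x y : R.

Definition cad a b := a * b - b * a.

(** Left and right multiplication by a commute with each other, so this is
    the binomial formula for the powers of their difference. *)
Lemma iter_cad a b n : iter n (cad a) b =
  \sum_(i < n.+1) (-1) ^+ i *+ 'C(n, i) * (a ^+ (n - i) * b * a ^+ i).
Proof.
elim: n => [|n IH]; first by rewrite big_ord1 !expr0 mulr1 !mul1r.
rewrite iterS IH /cad mulr_sumr mulr_suml.
rewrite big_ord_recl [in X in _ - X]big_ord_recr [RHS]big_ord_recl [in RHS]big_ord_recr.
have E i : (i <= n)%N -> a * ((-1) ^+ i *+ 'C(n, i) * (a ^+ (n - i) * b * a ^+ i)) =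
   (-1) ^+ i *+ 'C(n, i) * (a ^+ (n.+1 - i) * b * a ^+ i).
  have S : a * (-1) ^+ i = (-1) ^+ i * a := commr_sign a i.
  by move=> le; rewrite !mulrnAl mulrnAr !mulrA S subSn // exprS !mulrA.
have F i : (i <= n)%N -> (-1) ^+ i *+ 'C(n, i) * (a ^+ (n - i) * b * a ^+ i) * a =
   - ((-1) ^+ i.+1 *+ 'C(n, i) * (a ^+ (n.+1 - i.+1) * b * a ^+ i.+1)).
  move=> le; rewrite subSS [in RHS]exprS mulN1r mulNrn mulNr opprK.
  by rewrite -!mulrA -exprSr.
rewrite E // F //= !bin0 subn0 opprD opprK -!addrA; congr (_ + _).
rewrite addrA /bump !add1n !binn; congr (_ + _).
rewrite -sumrN -big_split /=; apply: eq_bigr => i _.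
by rewrite add1n E // F 1?ltnW // opprK -mulrDl -mulrnDr binS.
Qed.

Variable p : nat.
Hypotheses (p_pr : prime p) (pR0 : p%:R = 0 :> R).

Lemma bin_prime_eq0 i : (0 < i < p)%N -> 'C(p, i)%:R = 0 :> R.
Proof. by move=> /(prime_dvd_bin p_pr) /dvdnP[q ->]; rewrite natrM pR0 mulr0. Qed.

Lemma sign_prime : (-1) ^+ p = -1 :> R.
Proof.
have [p2|p_odd] := even_prime p_pr; last by rewrite -signr_odd p_odd expr1.
by rewrite p2 sqrrN expr1n; apply/eqP; rewrite -addr_eq0 -mulr2n -p2 pR0.
Qed.

Lemma bin_pred_prime i : (i < p)%N -> 'C(p.-1, i)%:R = (-1) ^+ i :> R.
Proof.
elim: i => [|i IH] lt_ip; first by rewrite bin0.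
have := @bin_prime_eq0 i.+1 lt_ip; rewrite -{1}(prednK (prime_gt0 p_pr)) binS natrD.
by rewrite IH 1?ltnW // => /eqP; rewrite addr_eq0 => /eqP ->; rewrite exprS mulN1r.
Qed.

(** Only the two extreme terms of [iter_cad] have a binomial coefficient that
    is nonzero modulo p. *)
Lemma iter_cad_prime a b : iter p (cad a) b = cad (a ^+ p) b.
Proof.
rewrite iter_cad -(big_mkord xpredT (fun i => (-1) ^+ i *+ 'C(p, i) *
  (a ^+ (p - i) * b * a ^+ i))) big_ltn // big_nat_recr ?prime_gt0 //=.
rewrite big_nat_cond big1 ?add0r => [|i]; last first.
  by rewrite andbT => lt_ip; rewrite -mulr_natr bin_prime_eq0 ?mulr0 ?mul0r.
by rewrite bin0 binn subn0 subnn expr0 !mulr1n !mul1r mulr1 sign_prime mulN1r.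
Qed.

(** Modulo p the binomial coefficients of p - 1 are the signs, which cancel
    those in [iter_cad]. *)
Lemma iter_cad_pred_prime a b :
  iter p.-1 (cad a) b = \sum_(i < p) a ^+ (p.-1 - i) * b * a ^+ i.
Proof.
rewrite iter_cad (prednK (prime_gt0 p_pr)); apply: eq_bigr => i _.
by rewrite -mulr_natr bin_pred_prime // -exprD addnn -mul2n exprM sqrrN expr1n expr1n mul1r.
Qed.

End Commutators.

Section Jacobson.
Variables (R : nzRingType) (p : nat).
Hypotheses (p_pr : prime p) (pR0 : p%:R = 0 :> R).
Implicit Types x y : R.

Definition cad_txy x y (c : nat -> R) (j : nat) : R :=
  cad y (c j) + (if j is j'.+1 then cad x (c j') else 0).

(** The analogue of [ad_coef] in an associative algebra. *)
Definition cad_coef x y (n j : nat) : R :=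
  iter n (cad_txy x y) (fun i => if i == 0%N then x else 0) j.

Let line x y : {poly R} := x%:P * 'X + y%:P.

(** The coefficients of ad(tx + y)^n (x), with t the polynomial variable. *)
Lemma coef_iter_cad x y n j :
  (iter n (cad (line x y)) x%:P)`_j = cad_coef x y n j.
Proof.
elim: n j => [|n IH] j; first by rewrite coefC.
rewrite /cad_coef !iterS {1}/cad_txy -/(cad_coef x y n j) {1}/cad coefB.
rewrite mulrDl mulrDr !coefD coefCM coefMC IH -mulrA.
have -> : 'X * iter n (cad (line x y)) x%:P = iter n (cad (line x y)) x%:P * 'X.
  by rewrite commr_polyX.
rewrite !mulrA !coefMX; case: j => [|j] /=; first by rewrite !add0r addr0.
by rewrite coefCM coefMC !IH opprD addrACA addrC.
Qed.

Lemma size_line_exp x y n : (size (line x y ^+ n) <= n.+1)%N.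
Proof.
elim: n => [|n IH]; first by rewrite expr0 size_poly1.
rewrite exprS; apply: leq_trans (size_polyMleq _ _) _.
have : (size (line x y) <= 2)%N.
  by rewrite size_MXaddC; case: ifP => // _; rewrite ltnS size_polyC leq_b1.
by move=> h; have := leq_add h IH; lia.
Qed.

Lemma lead_line_exp x y n : (line x y ^+ n)`_n = x ^+ n.
Proof.
elim: n => [|n IH]; first by rewrite !expr0 coef1.
rewrite !exprSr mulrDr coefD mulrA coefMX coefMC IH coefMC.
by rewrite [_`_n.+1]nth_default ?mul0r ?addr0 // size_line_exp.
Qed.

Lemma deriv_line_exp x y n :
  (line x y ^+ n)^`() = \sum_(i < n) line x y ^+ (n.-1 - i) * x%:P * line x y ^+ i.
Proof.
elim: n => [|n IH]; first by rewrite expr0 derivC big_ord0.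
rewrite exprS derivM IH derivMXaddC derivC mul0r addr0 big_ord_recr /= subnn mul1r.
rewrite addrC mulr_sumr; congr (_ + _); apply: eq_bigr => i _.
by rewrite !mulrA -exprS; congr (_ ^+ _ * _ * _); have := ltn_ord i; lia.
Qed.

(** The derivative of (tx + y)^p in t is the sum of the products
    (tx + y)^(p-1-i) x (tx + y)^i, which is ad(tx + y)^(p-1) (x) by
    [iter_cad_pred_prime]; this identifies j times the coefficient of t^j in
    (tx + y)^p. The formula follows by setting t = 1. *)
Lemma jacobson_formula x y : exists S : nat -> R,
  (forall j, (0 < j < p)%N -> S j *+ j = cad_coef x y p.-1 j.-1) /\
  (x + y) ^+ p = x ^+ p + y ^+ p + \sum_(1 <= j < p) S j.
Proof.
pose L := line x y.
have pP0 : p%:R = 0 :> {poly R} by rewrite -polyC_natr pR0.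
exists (fun j => (L ^+ p)`_j); split=> [[|j] // /andP[_ lt_jp]|].
  rewrite -coef_deriv deriv_line_exp -(iter_cad_pred_prime p_pr pP0).
  exact: coef_iter_cad.
have -> : (x + y) ^+ p = (L ^+ p).[1].
  have com (q : {poly R}) : comm_poly q 1 by rewrite /comm_poly mulr1 mul1r.
  by rewrite horner_exp_comm // !hornerE.
(* The coefficients of 1 and of t^p give y^p and x^p. *)
rewrite (horner_coef_wide _ (size_line_exp x y p)).
rewrite -(big_mkord xpredT (fun i => (L ^+ p)`_i * 1 ^+ i)).
rewrite big_ltn // big_nat_recr ?prime_gt0 //= expr1n mulr1.
rewrite -horner_coef0 horner_exp_comm; last first.
  by rewrite /comm_poly mulr0 mul0r.
rewrite !hornerE lead_line_exp expr1n mulr1 /= addrC addrA; congr (_ + _ + _).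
by apply: eq_bigr => i _; rewrite expr1n mulr1.
Qed.
End Jacobson.

(** * Linear maps on tensor modules, and parity *)

Section LinearMaps.
Variable k : comNzRingType.

(** Linear maps are mostly built from proofs of linearity, since tensor and
    bar modules are quotients whose elements one cannot compute with. *)
Definition mklin (U V : lmodType k) (f : U -> V) (hf : linear f) : {linear U -> V} :=
  HB.pack f (GRing.isLinear.Build k U V *:%R f hf).

Section LinearRules.
Variables (U V : lmodType k) (f : {linear U -> V}).
Lemma linP : linear f. Proof. exact: linearP. Qed.
Lemma lin0 : f 0 = 0. Proof. exact: linear0. Qed.
Lemma linD x y : f (x + y) = f x + f y. Proof. exact: linearD. Qed.
Lemma linB x y : f (x - y) = f x - f y. Proof. exact: linearB. Qed.
Lemma linN x : f (- x) = - f x. Proof. exact: linearN. Qed.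
Lemma linZ a x : f (a *: x) = a *: f x. Proof. exact: linearZ. Qed.
Lemma linS (I : Type) (s : seq I) (P : pred I) (h : I -> U) :
  f (\sum_(i <- s | P i) h i) = \sum_(i <- s | P i) f (h i).
Proof. exact: linear_sum. Qed.
End LinearRules.

Lemma lin_id (U : lmodType k) : linear (fun x : U => x). Proof. by []. Qed.

Lemma lin_comp (U V W : lmodType k) (f : V -> W) (g : U -> V) :
  linear f -> linear g -> linear (fun x => f (g x)).
Proof. by move=> hf hg a x y; rewrite hg hf. Qed.

Lemma lin_add (U V : lmodType k) (f g : U -> V) :
  linear f -> linear g -> linear (fun x => f x + g x).
Proof. by move=> hf hg a x y; rewrite hf hg scalerDr addrACA. Qed.

Lemma lin_scale (U V : lmodType k) b (f : U -> V) :
  linear f -> linear (fun x => b *: f x).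
Proof. by move=> hf a x y; rewrite hf scalerDr !scalerA mulrC. Qed.

Lemma lin_sub (U V : lmodType k) (f g : U -> V) :
  linear f -> linear g -> linear (fun x => f x - g x).
Proof. by move=> hf hg a x y; rewrite hf hg scalerBr opprD addrACA. Qed.

Lemma lin_mul (U V : lmodType k) (c : U -> k^o) (v : V) :
  linear c -> linear (fun x => (c x : k) *: v).
Proof. by move=> hc a x y; rewrite hc scalerDl scalerA. Qed.

Lemma lspan_ext (U V : lmodType k) (G : U -> Prop) (f g : {linear U -> V}) :
  (forall x, G x -> f x = g x) -> forall x, lspan G x -> f x = g x.
Proof.
move=> fg x; elim=> [|a y z /fg e _ IH]; first by rewrite !linear0.
by rewrite !linearP e IH.
Qed.

Lemma lspan_sum (U : lmodType k) (G : U -> Prop) I (s : seq I) (P : pred I) (f : I -> U) :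
  (forall i, P i -> lspan G (f i)) -> lspan G (\sum_(i <- s | P i) f i).
Proof.
by move=> h; elim/big_ind: _ => // [|x y]; [apply: lspan0 | apply: lspanD].
Qed.

Lemma pres_span (I : choiceType) (R : _ -> Prop) (q : @pres k I R) :
  lspan (fun x => exists i, x = pgen R i) q.
Proof.
have [g ->] := lpi_surj q; rewrite [g]monalgE linear_sum.
apply: lspan_sum => i _.
have -> : << g@_i *g i >> = g@_i *: << i >> :> {malg k[I]}.
  by apply/malgP => j; rewrite mcoeffZ !mcoeffU mulrnAr mulr1.
by rewrite linearZ; apply: lspanZ; apply: lspan_gen; exists i.
Qed.

Lemma bar_span (V : lmodType k) (X : bar V) : lspan (fun x => exists w, x = bword w) X.
Proof. exact: pres_span. Qed.

Lemma bar_ext (V P : lmodType k) (f g : bar V -> P) : linear f -> linear g ->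
  (forall w, f (bword w) = g (bword w)) -> f =1 g.
Proof.
move=> hf hg e X; apply: (@lspan_ext _ _ _ (mklin hf) (mklin hg) _ _ (bar_span X)).
by move=> _ [w ->]; apply: e.
Qed.

Lemma tprod_linl (V W : lmodType k) (w : W) : linear (fun v : V => tprod v w).
Proof. by move=> a x y; apply: tprodPl. Qed.

Lemma tprod_linr (V W : lmodType k) (v : V) : linear (fun w : W => tprod v w).
Proof. by move=> a x y; apply: tprodPr. Qed.

Section Lift.
Variables (V W P : lmodType k) (f : V -> W -> P).
Hypotheses (f_linl : forall w, linear (f^~ w)) (f_linr : forall v, linear (f v)).

Lemma tlift_compat : plift_compat (@tens_rel k V W) (fun q => f q.1 q.2).
Proof.
move=> _ [a x y z|a x y z]; rewrite linearB linearP /= !mevalU /=.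
  by have := f_linl z a x y => /= ->; rewrite subrr.
by rewrite f_linr subrr.
Qed.

Definition tlift : {linear tens V W -> P} := mklin (plift_linear tlift_compat).

Lemma tliftE v w : tlift (tprod v w) = f v w.
Proof. exact: (pliftE tlift_compat). Qed.
End Lift.

Section WordLift.
Variables (V P : lmodType k) (f : seq V -> P) (f_multi : wmultilin f).

Definition blift : {linear bar V -> P} := mklin (plift_linear (bar_compat f_multi)).

Lemma bliftE w : blift (bword w) = f w.
Proof. exact: (pliftE (bar_compat f_multi)). Qed.
End WordLift.
End LinearMaps.

Section Parity.
Variable k : comNzRingType.

Lemma oddzD i j : oddz (i + j) = oddz i (+) oddz j.
Proof. by rewrite /oddz; lia. Qed.

Lemma oddzM i j : oddz (i * j) = oddz i && oddz j.
Proof. by rewrite /oddz abszM oddM. Qed.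

Definition sg (b : bool) : k := (-1) ^+ b.

Lemma ksignE i : ksign k i = sg (oddz i).
Proof. by rewrite /ksign /sg /oddz signr_odd. Qed.

Lemma sgD b c : sg (b (+) c) = sg b * sg c.
Proof. by rewrite /sg signr_addb. Qed.

Lemma sgK b : sg b * sg b = 1.
Proof. by rewrite -sgD addbb. Qed.

Variable M : grmod k.
Implicit Types (x y : M) (s t : seq int) (c e : int -> M) (b : bool).

Lemma gdegN i x : gdeg i x -> gdeg i (- x).
Proof. by rewrite -scaleN1r; apply: gdegZ. Qed.

(** Two decompositions into homogeneous components have different index sets;
    extended by zero they become comparable. *)
Definition cut s c i := if i \in s then c i else 0.

Lemma cut_deg s c i : (forall i, gdeg i (c i)) -> gdeg i (cut s c i).
Proof. by move=> h; rewrite /cut; case: ifP => _; [apply: h | apply: gdeg0]. Qed.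

Lemma sum_cut s t c : uniq s -> uniq t -> {subset s <= t} ->
  \sum_(i <- s) c i = \sum_(i <- t) cut s c i.
Proof.
move=> us ut st; rewrite -big_mkcond /= -[RHS]big_filter; apply: perm_big.
apply: uniq_perm; rewrite ?filter_uniq // => i; rewrite mem_filter.
by case: (boolP (i \in s)) => // /st ->.
Qed.

(** The homogeneous components of an element do not depend on the
    decomposition. *)
Lemma cut_uniq s t c e : uniq s -> uniq t ->
  (forall i, gdeg i (c i)) -> (forall i, gdeg i (e i)) ->
  \sum_(i <- s) c i = \sum_(i <- t) e i -> cut s c =1 cut t e.
Proof.
move=> us ut hc he; pose r := undup (s ++ t).
have sr : {subset s <= r} by move=> i si; rewrite mem_undup mem_cat si.
have tr : {subset t <= r} by move=> i si; rewrite mem_undup mem_cat si orbT.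
rewrite (sum_cut c us (undup_uniq _) sr) (sum_cut e ut (undup_uniq _) tr) => /eqP.
rewrite -subr_eq0 -sumrB => /eqP E i; apply/eqP; rewrite -subr_eq0; apply/eqP.
have [ri|nri] := boolP (i \in r); last first.
  move: nri; rewrite mem_undup mem_cat negb_or /cut => /andP[/negbTE -> /negbTE ->].
  by rewrite subr0.
apply: (@gind _ M r (fun i => cut s c i - cut t e i)) => //; first exact: undup_uniq.
by move=> j; apply: gdegD; [|apply: gdegN]; apply: cut_deg.
Qed.

Definition hsupp x : seq int := sval (cid (gdec x)).
Definition hcomp x : int -> M := cut (hsupp x) (sval (cid (svalP (cid (gdec x))))).

Lemma hcompP x : [/\ uniq (hsupp x), forall i, gdeg i (hcomp x i) &
  x = \sum_(i <- hsupp x) hcomp x i].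
Proof.
rewrite /hcomp /hsupp; case: cid => s /= hs; case: cid => c /= [us hc e].
by split=> // [i|]; [apply: cut_deg | rewrite {1}e; apply: sum_cut].
Qed.

Lemma hcomp_deg x i : gdeg i (hcomp x i). Proof. by case: (hcompP x). Qed.

Lemma hcompE s c : uniq s -> (forall i, gdeg i (c i)) ->
  hcomp (\sum_(i <- s) c i) =1 cut s c.
Proof.
move=> us hc i; have [ux hx ex] := hcompP (\sum_(i <- s) c i).
rewrite (cut_uniq us ux hc hx ex).
by rewrite /cut; case: ifP => // h; rewrite /hcomp /cut h.
Qed.

Lemma hcomp_outside x i : i \notin hsupp x -> hcomp x i = 0.
Proof. by rewrite /hcomp /cut => /negbTE ->. Qed.

Lemma hcomp_sum s x : uniq s -> {subset hsupp x <= s} -> x = \sum_(i <- s) hcomp x i.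
Proof.
have [ux hx ex] := hcompP x; move=> us sx; rewrite {1}ex (sum_cut _ ux us sx).
by apply: eq_bigr => i _; rewrite /cut; case: ifPn => // /hcomp_outside.
Qed.

Lemma hcomp_linear i : linear (hcomp^~ i).
Proof.
move=> a x y; pose s := undup (hsupp x ++ hsupp y).
have us : uniq s := undup_uniq _.
have sx : {subset hsupp x <= s} by move=> j h; rewrite mem_undup mem_cat h.
have sy : {subset hsupp y <= s} by move=> j h; rewrite mem_undup mem_cat h orbT.
have E : a *: x + y = \sum_(j <- s) (a *: hcomp x j + hcomp y j).
  by rewrite big_split /= -scaler_sumr -!hcomp_sum.
rewrite {1}E (@hcompE s (fun j => a *: hcomp x j + hcomp y j)) // /cut; last first.
  by move=> j; apply: gdegP; apply: hcomp_deg.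
case: ifPn => //; rewrite mem_undup mem_cat negb_or => /andP[/hcomp_outside ->].
by move=> /hcomp_outside ->; rewrite scaler0 addr0.
Qed.

Lemma hcomp_hom i j x : gdeg i x -> hcomp x j = if j == i then x else 0.
Proof.
move=> hx; pose c l := if l == i then x else 0.
have hc l : gdeg l (c l) by rewrite /c; case: eqP => [->|_] //; apply: gdeg0.
have -> : hcomp x j = hcomp (\sum_(l <- [:: i]) c l) j by rewrite big_seq1 /c eqxx.
by rewrite hcompE // /cut inE /c; case: eqP.
Qed.

Lemma hom_ind (P : M -> Prop) : P 0 -> (forall x y, P x -> P y -> P (x + y)) ->
  (forall i x, gdeg i x -> P x) -> forall x, P x.
Proof.
move=> P0 PD Ph x; have [_ hx ->] := hcompP x.
by elim/big_ind: _ => // i _; apply: Ph (hx i).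
Qed.

(** Koszul signs depend on degrees only modulo 2. The projections to the even
    and to the odd part are linear, so signs can be handled for arbitrary elements
    and not only for homogeneous ones. *)
Definition par b x : M := \sum_(i <- hsupp x | oddz i == b) hcomp x i.

Lemma parE b s x : uniq s -> {subset hsupp x <= s} ->
  par b x = \sum_(i <- s | oddz i == b) hcomp x i.
Proof.
move=> us sx; rewrite /par big_mkcond [RHS]big_mkcond.
have [ux _ _] := hcompP x.
rewrite (sum_cut _ ux us sx); apply: eq_bigr => i _; rewrite /cut.
by case: ifPn => // /hcomp_outside ->; rewrite if_same.
Qed.

Fact par_linear b : linear (par b).
Proof.
move=> a x y; pose s := undup (hsupp (a *: x + y) ++ hsupp x ++ hsupp y).
have us : uniq s := undup_uniq _.
rewrite !(@parE b s) // => [|i h|i h|i h]; last 3 first.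
- by rewrite mem_undup !mem_cat h !orbT.
- by rewrite mem_undup !mem_cat h !orbT.
- by rewrite mem_undup !mem_cat h.
rewrite scaler_sumr -big_split /=; apply: eq_bigr => i _; exact: hcomp_linear.
Qed.
HB.instance Definition _ b := GRing.isLinear.Build k M M *:%R (par b) (par_linear b).

Lemma par_hom i b x : gdeg i x -> par b x = if oddz i == b then x else 0.
Proof.
move=> hx; have [ux _ _] := hcompP x; pose s := undup (i :: hsupp x).
have us : uniq s := undup_uniq _.
have si : i \in s by rewrite mem_undup inE eqxx.
rewrite (@parE b s) // => [|j h]; last by rewrite mem_undup inE h orbT.
rewrite big_mkcond (bigD1_seq i) //= (hcomp_hom i hx) eqxx big1 ?addr0 // => j.
by move=> /negbTE ji; rewrite (hcomp_hom j hx) ji if_same.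
Qed.

Lemma par_sum x : par false x + par true x = x.
Proof.
elim/hom_ind: x => [|x y|i x hx]; first by rewrite !linear0 addr0.
  by move=> ex ey; rewrite !linearD addrACA ex ey.
by rewrite !(par_hom _ hx); case: (oddz i); rewrite ?addr0 ?add0r.
Qed.

Lemma par_idem b (c : bool) x : par b (par c x) = if b == c then par c x else 0.
Proof.
elim/hom_ind: x => [|x y|i x hx]; first by rewrite !linear0 if_same.
  by move=> ex ey; rewrite !linearD /= ex ey; case: ifP => _; rewrite ?addr0.
rewrite (par_hom c hx); case: (eqVneq (oddz i) c) => [<-|_].
  by rewrite (par_hom b hx) eq_sym.
by rewrite linear0 if_same.
Qed.

Definition gpar b x := par b x = x.

Lemma gpar_par b x : gpar b (par b x).
Proof. by rewrite /gpar par_idem eqxx. Qed.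

Lemma parD b x y : par b (x + y) = par b x + par b y.
Proof. exact: (linD (par b)). Qed.

Lemma gparD b x y : gpar b x -> gpar b y -> gpar b (x + y).
Proof. by move=> hx hy; rewrite /gpar -{2}hx -{2}hy; exact: (linD (par b) x y). Qed.

Lemma gparZ b a x : gpar b x -> gpar b (a *: x).
Proof. by move=> hx; rewrite /gpar -{2}hx; exact: (linZ (par b) a x). Qed.

Lemma gpar_hom i x : gdeg i x -> gpar (oddz i) x.
Proof. by move=> hx; rewrite /gpar (par_hom _ hx) eqxx. Qed.

Lemma gparP b (c : bool) x : gpar c x -> par b x = if b == c then x else 0.
Proof. by rewrite /gpar => <-; rewrite par_idem. Qed.

Lemma gpar_ind b (P : M -> Prop) : P 0 -> (forall x y, P x -> P y -> P (x + y)) ->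
  (forall i x, oddz i = b -> gdeg i x -> P x) -> forall x, gpar b x -> P x.
Proof.
move=> P0 PD Ph x <-; rewrite /par; elim/big_ind: _ => // i /eqP ib.
exact: Ph ib (hcomp_deg x i).
Qed.

Definition sgn x : M := par false x - par true x.

Fact sgn_linear : linear sgn.
Proof.
by move=> a x y; rewrite /sgn !linearP scalerDr addrACA.
Qed.
HB.instance Definition _ := GRing.isLinear.Build k M M *:%R sgn sgn_linear.

Lemma sgn_gpar b x : gpar b x -> sgn x = sg b *: x.
Proof.
by move=> hx; rewrite /sgn !(gparP _ hx) /sg; case: b {hx};
  rewrite ?sub0r ?subr0 ?scaleN1r ?scale1r.
Qed.

Lemma sgn_hom i x : gdeg i x -> sgn x = ksign k i *: x.
Proof. by move/gpar_hom/sgn_gpar => ->; rewrite ksignE. Qed.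

Lemma sgnK x : sgn (sgn x) = x.
Proof.
elim/hom_ind: x => [|x y|i x hx]; first by rewrite !linear0.
  move=> ex ey; rewrite -[in RHS]ex -[in RHS]ey.
  exact: etrans (congr1 sgn (linearD sgn x y)) (linearD sgn _ _).
by rewrite (sgn_hom hx) linearZ /= (sgn_hom hx) scalerA ksignE sgK scale1r.
Qed.
End Parity.

Lemma par_shift (k : comNzRingType) (M N : grmod k) (f : {linear M -> N}) n b x :
  (forall i x, gdeg i x -> gdeg (i + n) (f x)) -> par b (f x) = f (par (b (+) oddz n) x).
Proof.
move=> hf; elim/hom_ind: x => [|x y|i x hx]; first by rewrite !linear0.
  by move=> ex ey; rewrite !linearD /= ex ey.
rewrite (par_hom _ hx) (par_hom _ (hf _ _ hx)) oddzD.
by case: b (oddz i) (oddz n) => [] [] []; rewrite ?linear0.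
Qed.

(** * From letters of an associative algebra to homology *)

Section CohomologyClasses.
Variables (k : comNzRingType) (M : grmod k) (d : {linear M -> M}).
Implicit Types (x y : M) (h : cohom d).

(** A total function, with value 0 outside the cocycles, so that it can be
    applied before the cocycle condition has been checked. *)
Definition cls x : cohom d :=
  if pselect (x \in cyc_pred d) is left hx then lpi (@bnd k M d) (Cyc hx) else 0.

Lemma cyc_predE x : d x = 0 -> x \in cyc_pred d.
Proof. by move=> e; rewrite unfold_in e. Qed.

Lemma cls_class x : d x = 0 -> is_class x (cls x).
Proof.
by move=> /cyc_predE hx; rewrite /cls; case: pselect => // hx'; exists (Cyc hx').
Qed.

Lemma is_classP x h : is_class x h -> d x = 0 /\ h = cls x.
Proof.
case=> z <- ->; have dz : d (cycv z) = 0 by case: z => z /= /eqP.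
split=> //; rewrite /cls; case: pselect => [hx|hn]; last by case: hn; apply: cyc_predE.
by congr (lpi _ _); apply: val_inj.
Qed.

Lemma cls_surj h : exists x, d x = 0 /\ h = cls x.
Proof.
have [z e] := lpi_surj h; have [dz e'] := @is_classP (cycv z) h (ex_intro2 _ _ z erefl e).
by exists (cycv z).
Qed.

Lemma cls_linear a x y : d x = 0 -> d y = 0 -> cls (a *: x + y) = a *: cls x + cls y.
Proof.
move=> dx dy; have [u eu ex] := cls_class dx; have [v ev ey] := cls_class dy.
rewrite ex ey -linearP; apply/esym; apply: (proj2 (@is_classP _ _ _)).
by exists (a *: u + v) => //; rewrite (linearP (@cycv k M d)) /= eu ev.
Qed.

Lemma cls0 : cls 0 = 0.
Proof. by have := @cls_linear (-1) 0 0 (linear0 _) (linear0 _); rewrite scaler0 addr0 scaleN1r addNr. Qed.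

Lemma clsD x y : d x = 0 -> d y = 0 -> cls (x + y) = cls x + cls y.
Proof. by move=> dx dy; rewrite -[x in LHS]scale1r cls_linear // scale1r. Qed.

Lemma clsZ a x : d x = 0 -> cls (a *: x) = a *: cls x.
Proof. by move=> dx; rewrite -[_ *: x]addr0 cls_linear ?linear0 // cls0 addr0. Qed.

Lemma cls_sum I (s : seq I) (F : I -> M) : (forall i, d (F i) = 0) ->
  cls (\sum_(i <- s) F i) = \sum_(i <- s) cls (F i).
Proof.
move=> dF; elim: s => [|i s IH]; first by rewrite !big_nil cls0.
by rewrite !big_cons clsD ?IH // linear_sum big1.
Qed.

Lemma cls_bnd x : cls (d x) = 0.
Proof.
rewrite /cls; case: pselect => // hx; rewrite -[RHS](linear0 (lpi (@bnd k M d))).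
by apply/lpi_eqP/lspan_gen; exists x; rewrite subr0.
Qed.

Lemma cls_eq x y : d x = 0 -> d y = 0 -> cls x = cls y -> exists w, x = y + d w.
Proof.
move=> dx dy; have [u eu ex] := cls_class dx; have [v ev ey] := cls_class dy.
rewrite ex ey => /lpi_eqP/lspan_bnd [w ew]; exists w.
by rewrite -ew -eu -ev linearB addrC subrK.
Qed.

End CohomologyClasses.

(** Here B plays the role of the bar construction and L that of the inclusion
    of the letters; tau is the sign automorphism, D the differential, and [wd n]
    says that an element has degree n. As L is injective, an operation on V is
    determined by its image in the associative algebra B, and its properties are
    verified there. *)
Section RestrictedLie.
Variables (k : comNzRingType) (p : nat).
Hypotheses (p_pr : prime p) (pk0 : p%:R = 0 :> k).
Variables (M : grmod k) (d : {linear M -> M}).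
Hypothesis d_deg : forall i (x : M), gdeg i x -> gdeg (i + 1) (d x).
Local Notation V := (susp M).
Hypothesis d_sq : forall x, d (d x) = 0.
Variables (B : algType k) (L : {linear V -> B}) (tau D : {linear B -> B}).
Variable wd : int -> B -> Prop.
Hypotheses (L_inj : injective L)
  (tauM : forall X Y, tau (X * Y) = tau X * tau Y)
  (tau_L : forall x, tau (L x) = L (sgn x))
  (tauK : forall X, tau (tau X) = X)
  (D_mul : forall X Y, D (X * Y) = D X * Y + tau X * D Y)
  (D_tau : forall X, D (tau X) = - tau (D X))
  (D_L : forall x : V, D (L x) = L (d x))
  (bracket_L : forall b c (x y : V), gpar b x -> gpar c y ->
     exists z, L x * L y - sg k (b && c) *: (L y * L x) = L z)
  (square_L : forall x : V, gpar true x -> exists z, L x * L x = L z)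
  (pow_L : forall x : V, gpar false x -> exists z, L x ^+ p = L z)
  (bnd_square : forall y : V, gpar false y -> exists z, L (d y) * L (d y) = L (d z))
  (bnd_pow : forall y : V, gpar true y -> exists z, L (d y) ^+ p = L (d z))
  (wdZD : forall n a X Y, wd n X -> wd n Y -> wd n (a *: X + Y))
  (wdM : forall n m X Y, wd n X -> wd m Y -> wd (n + m) (X * Y))
  (wd_pow : forall n m X, wd n X -> wd (n *+ m) (X ^+ m))
  (wd_L : forall i x, gdeg i x -> wd i (L x))
  (wd_LP : forall i x, wd i (L x) -> gdeg i x).
Implicit Types (x y z w : V) (X Y : B) (b c : bool).

Let H := susp (gcohom d_deg).
Implicit Types h : H.

Definition taub b : {linear B -> B} := if b then tau else idfun.

Lemma taubM b X Y : taub b (X * Y) = taub b X * taub b Y.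
Proof. by case: b => /=. Qed.
Lemma taub_L b c x : gpar c x -> taub b (L x) = sg k (b && c) *: L x.
Proof.
move=> hx; case: b; rewrite /= ?scale1r //.
by rewrite tau_L (sgn_gpar hx) linearZ.
Qed.
Lemma taub_taub b c X : taub b (taub c X) = taub (b (+) c) X.
Proof. by case: b; case: c => //=; rewrite tauK. Qed.
Lemma D_taub b X : D (taub b X) = sg k b *: taub b (D X).
Proof. by case: b; rewrite /= ?scale1r // D_tau scaleN1r. Qed.

(** The graded commutator of L x with X, written with the parity parts of x
    instead of a degree; this makes it linear in both arguments. *)
Definition sbr x X : B :=
  L x * X - (X * L (par false x) + tau X * L (par true x)).

Lemma sbr_gpar b x X : gpar b x -> sbr x X = L x * X - taub b X * L x.
Proof.
by move=> hx; rewrite /sbr !(gparP _ hx); case: b {hx}; rewrite /= linear0 mulr0 ?addr0 ?add0r.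
Qed.

Lemma sbr_linr x : linear (sbr x).
Proof.
move=> a X Y; rewrite /sbr mulrDr linearP !mulrDl -!scalerAl -!scalerAr addrACA -scalerDr.
by rewrite opprD scalerBr addrACA.
Qed.
HB.instance Definition _ x := GRing.isLinear.Build k B B *:%R (sbr x) (sbr_linr x).

Lemma sbr_linl X : linear (sbr^~ X).
Proof.
move=> a x y; rewrite /sbr !linearP !(mulrDl, mulrDr) -!scalerAl -!scalerAr.
by rewrite addrACA -scalerDr opprD scalerBr addrACA.
Qed.

(** Both arguments are split into even and odd parts, where the signs are
    constant. *)
Lemma sbr_L x y : exists z, sbr x (L y) = L z.
Proof.
have H0 b c x' y' : gpar b x' -> gpar c y' -> exists z, sbr x' (L y') = L z.
  move=> hx hy; have [z ez] := bracket_L hx hy; exists z.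
  by rewrite (sbr_gpar _ hx) (taub_L b hy) -scalerAl ez.
have H1 b x' : gpar b x' -> exists z, sbr x' (L y) = L z.
  move=> hx; have [z ez] := H0 _ _ _ _ hx (gpar_par false y).
  have [t et] := H0 _ _ _ _ hx (gpar_par true y).
  by exists (z + t); rewrite -{1}[y]par_sum !linearD /= ez et.
have [z ez] := H1 _ _ (gpar_par false x); have [t et] := H1 _ _ (gpar_par true x).
exists (z + t); rewrite -{1}[x]par_sum linearD -ez -et.
exact: (linearD (mklin (sbr_linl (L y)))).
Qed.

(** A preimage under L, which is unique when it exists. *)
Definition Linv X : V := if pselect (exists z, X = L z) is left e then sval (cid e) else 0.
Lemma LinvK X : (exists z, X = L z) -> L (Linv X) = X.
Proof. by move=> e; rewrite /Linv; case: pselect => // e'; case: cid => z /= ->. Qed.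

Definition br x y : V := Linv (sbr x (L y)).
Lemma L_br x y : L (br x y) = sbr x (L y).
Proof. exact/LinvK/sbr_L. Qed.

Lemma br_linl y : linear (br^~ y).
Proof. by move=> a x x'; apply: L_inj; rewrite linearP !L_br; apply: sbr_linl. Qed.
Lemma br_linr x : linear (br x).
Proof. by move=> a y y'; apply: L_inj; rewrite linearP !L_br linearP linearP. Qed.

Lemma br0l y : br 0 y = 0. Proof. exact: (linear0 (mklin (br_linl y))). Qed.
Lemma br0r x : br x 0 = 0. Proof. exact: (linear0 (mklin (br_linr x))). Qed.

Lemma brBl x x' y : br (x - x') y = br x y - br x' y.
Proof. exact: (linearB (mklin (br_linl y))). Qed.
Lemma brBr x y y' : br x (y - y') = br x y - br x y'.
Proof. exact: (linearB (mklin (br_linr x))). Qed.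

Lemma br_deg i j x y : gdeg i x -> gdeg j y -> gdeg (i + j) (br x y).
Proof.
move=> hx hy; apply: wd_LP; rewrite L_br (sbr_gpar _ (gpar_hom hx)).
rewrite (taub_L _ (gpar_hom hy)) -scalerAl [X in wd _ X]addrC -scaleNr; apply: wdZD.
  by rewrite addrC; apply: wdM; apply: wd_L.
by apply: wdM; apply: wd_L.
Qed.

Definition dV : {linear V -> V} := d.
Lemma gpar_d b x : gpar b x -> gpar (~~ b) (dV x).
Proof.
move=> hx; have := @par_shift k V V dV 1 (~~ b) x (fun i => @d_deg (i + 1)).
by rewrite /gpar => ->; rewrite addbT negbK hx.
Qed.

Lemma par_lin_ext (P : lmodType k) (f g : V -> P) : linear f -> linear g ->
  (forall b x, gpar b x -> f x = g x) -> forall x, f x = g x.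
Proof.
move=> hf hg H0 x; rewrite -[x]par_sum [LHS](linD (mklin hf)) [RHS](linD (mklin hg)).
by congr (_ + _); apply: H0 (gpar_par _ _).
Qed.

Lemma sgn_d x : sgn (dV x) = - dV (sgn x).
Proof.
have hl : linear (fun x => sgn (dV x)) := lin_comp (@sgn_linear _ V) (linP dV).
have hr : linear (fun x => - dV (sgn x)).
  by move=> a y z; rewrite sgn_linear linearP opprD scalerN.
move: x; apply: par_lin_ext hl hr _ => b x hx.
rewrite (sgn_gpar (gpar_d hx)) (sgn_gpar hx) linearZ -scaleNr; congr (_ *: _).
by case: b {hx}; rewrite /sg /= ?expr1 ?expr0 ?opprK.
Qed.

(** The Leibniz rule for the commutator follows from the one for products,
    with the sign automorphism applied to the element that D passes. *)
Lemma D_sbr x X : D (sbr x X) = sbr (dV x) X + sbr (sgn x) (D X).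
Proof.
have hl : linear (fun x => D (sbr x X)) := lin_comp (linP D) (sbr_linl X).
have hr : linear (fun x => sbr (dV x) X + sbr (sgn x) (D X)).
  apply: lin_add; first exact: lin_comp (sbr_linl X) (linP dV).
  exact: lin_comp (sbr_linl (D X)) (@sgn_linear _ V).
move: x; apply: par_lin_ext hl hr _ => b y hy.
rewrite (sbr_gpar _ hy) (sbr_gpar _ (gpar_d hy)) (sgn_gpar hy).
have hy' : gpar b (sg k b *: y) by rewrite /gpar linearZ /= hy.
rewrite (sbr_gpar _ (gparZ _ hy)) linearB !D_mul D_taub !D_L tau_L (sgn_gpar hy).
have -> : tau (taub b X) = taub (~~ b) X by rewrite -[tau _]/(taub true _) taub_taub.
by rewrite linearZ -!scalerAl -!scalerAr [X in _ - X]addrC opprD addrACA.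
Qed.

Lemma d_br x y : dV (br x y) = br (dV x) y + br (sgn x) (dV y).
Proof. by apply: L_inj; rewrite -D_L L_br D_sbr linearD !L_br D_L. Qed.

Definition sqr x : V := Linv (L x * L x).
Definition pw x : V := Linv (L x ^+ p).

Lemma L_sqr x : gpar true x -> L (sqr x) = L x * L x.
Proof. by move=> hx; apply: LinvK; apply: square_L. Qed.
Lemma L_pw x : gpar false x -> L (pw x) = L x ^+ p.
Proof. by move=> hx; apply: LinvK; apply: pow_L. Qed.

Lemma D_pow x n : gpar false x -> dV x = 0 -> D (L x ^+ n.+1) = 0.
Proof.
move=> hx dx; have D1 : D (L x) = 0 by rewrite D_L -/(dV x) dx linear0.
elim: n => [|n IH]; first by rewrite expr1.
by rewrite exprS D_mul IH D1 mul0r mulr0 addr0.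
Qed.

Lemma d_pw x : gpar false x -> dV x = 0 -> dV (pw x) = 0.
Proof.
move=> hx dx; apply: L_inj; rewrite linear0 -D_L (L_pw hx).
by rewrite -(prednK (prime_gt0 p_pr)) D_pow.
Qed.

Lemma d_sqr x : gpar true x -> dV x = 0 -> dV (sqr x) = 0.
Proof.
move=> hx dx; apply: L_inj; rewrite linear0 -D_L (L_sqr hx) D_mul D_L -/(dV x) dx.
by rewrite linear0 mul0r mulr0 addr0.
Qed.

Lemma d_br0 x y : dV x = 0 -> dV y = 0 -> dV (br x y) = 0.
Proof.
move=> dx dy; rewrite d_br dx dy br0l.
by rewrite br0r addr0.
Qed.

Definition bound x := exists w, x = dV w.

Lemma bound0 : bound 0. Proof. by exists 0; rewrite linear0. Qed.
Lemma boundD x y : bound x -> bound y -> bound (x + y).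
Proof. by move=> [v ->] [w ->]; exists (v + w); rewrite linearD. Qed.
Lemma boundZ a x : bound x -> bound (a *: x).
Proof. by move=> [v ->]; exists (a *: v); rewrite linearZ. Qed.

Lemma bound_brl x y : bound x -> dV y = 0 -> bound (br x y).
Proof.
move=> [w ->] dy; exists (br w y).
by rewrite d_br dy br0r addr0.
Qed.

(** The rule [d_br] moves the sign automorphism onto x; starting from sgn x
    instead of x compensates for it. *)
Lemma bound_brr x y : dV x = 0 -> bound y -> bound (br x y).
Proof.
move=> dx [w ->]; exists (br (sgn x) w); rewrite d_br sgnK.
by rewrite -[dV (sgn x)]opprK -sgn_d dx linear0 oppr0 br0l add0r.
Qed.

Lemma br_self b x : gpar b x -> L (br x x) = L x * L x - sg k b *: (L x * L x).
Proof. by move=> hx; rewrite L_br (sbr_gpar _ hx) (taub_L _ hx) andbb -scalerAl. Qed.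

Lemma sqrD x y : gpar true x -> gpar true y -> sqr (x + y) = sqr x + sqr y + br x y.
Proof.
move=> hx hy; apply: L_inj; rewrite !linearD (L_sqr (gparD hx hy)) !L_sqr // L_br.
rewrite (sbr_gpar _ hx) (taub_L _ hy) /sg /= expr1 scaleN1r mulNr opprK linearD.
by rewrite mulrDl !mulrDr -!addrA; congr (_ + _); rewrite addrA addrC.
Qed.

(** By [sqrD] the difference of the squares is a bracket with a boundary plus
    the square of a boundary. *)
Lemma sqr_homologous x y w : gpar true x -> gpar true y -> dV y = 0 -> x = y + dV w ->
  bound (sqr x - sqr y).
Proof.
move=> hx hy dy e; pose w0 := par false w.
have hw0 : gpar false w0 := gpar_par _ _.
have ex : x = y + dV w0.
  rewrite -hx e parD hy; congr (_ + _).
  by rewrite (@par_shift k V V dV 1 _ _ (fun i => @d_deg (i + 1))).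
have hdw : gpar true (dV w0) := gpar_d hw0.
rewrite ex sqrD // addrAC [sqr y + _]addrC addrK.
apply: boundD; last by apply: bound_brr => //; exists w0.
have [z ez] := bnd_square hw0; exists z; apply: L_inj.
by rewrite L_sqr.
Qed.

Let pB0 : p%:R = 0 :> B.
Proof. by rewrite -scaler_nat pk0 scale0r. Qed.

(** Bezout: j is prime to p, which vanishes in k. *)
Lemma natk_inv j : (0 < j < p)%N -> exists c : k, c * j%:R = 1.
Proof.
move=> /andP[j_gt0 lt_jp]; have cop : coprime j p.
  by rewrite coprime_sym prime_coprime // gtnNdvd.
case: (egcdnP p j_gt0) => u v e _; exists u%:R.
by rewrite -natrM e (eqP cop) natrD natrM pk0 mulr0 add0r.
Qed.

(** The terms s_j of Jacobson's formula are determined by j s_j, because j is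
    invertible modulo p. *)
Definition ninv j : k :=
  if pselect (exists c : k, c * j%:R = 1) is left e then sval (cid e) else 0.
Lemma ninvK j (P : lmodType k) (x y : P) : (0 < j < p)%N -> y *+ j = x -> y = ninv j *: x.
Proof.
move=> /natk_inv e <-; rewrite -scaler_nat scalerA /ninv; case: pselect => // e'.
by case: cid => c /= ->; rewrite scale1r.
Qed.
Lemma ninvMn j (P : lmodType k) (x : P) : (0 < j < p)%N -> (ninv j *: x) *+ j = x.
Proof.
move=> /natk_inv e; rewrite -scaler_nat scalerA /ninv; case: pselect => // e'.
by case: cid => c /=; rewrite mulrC => ->; rewrite scale1r.
Qed.

Definition br_txy x y (c : nat -> V) (j : nat) : V :=
  br y (c j) + (if j is j'.+1 then br x (c j') else 0).
Definition br_coef x y (n j : nat) : V :=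
  iter n (br_txy x y) (fun i => if i == 0%N then x else 0) j.

Lemma L_br_even x y : gpar false x -> L (br x y) = cad (L x) (L y).
Proof. by move=> hx; rewrite L_br (sbr_gpar _ hx). Qed.

Lemma L_br_coef x y n j : gpar false x -> gpar false y ->
  L (br_coef x y n j) = cad_coef (L x) (L y) n j.
Proof.
move=> hx hy; elim: n j => [|n IH] j.
  by rewrite /br_coef /cad_coef /=; case: eqP => // _; rewrite linear0.
rewrite /br_coef /cad_coef !iterS {1}/br_txy {1}/cad_txy -/(br_coef x y n _).
rewrite linearD L_br_even // IH; congr (_ + _).
by case: j => [|j]; rewrite ?linear0 // L_br_even // -/(br_coef x y n _) IH.
Qed.

Lemma pwD x y : gpar false x -> gpar false y ->
  pw (x + y) = pw x + pw y + \sum_(1 <= j < p) ninv j *: br_coef x y p.-1 j.-1.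
Proof.
move=> hx hy; have [S [hS e]] := jacobson_formula p_pr pB0 (L x) (L y).
apply: L_inj; rewrite !linearD (L_pw (gparD hx hy)) !L_pw // linearD e; congr (_ + _).
rewrite linear_sum; apply: eq_big_nat => j hj; rewrite linearZ L_br_coef //.
exact: ninvK (hS j hj).
Qed.

Lemma bound_cycle x : bound x -> dV x = 0.
Proof. by move=> [w ->]; apply: d_sq. Qed.

Lemma br_coef_bound x y n j : bound x -> dV y = 0 -> bound (br_coef x y n j).
Proof.
move=> bx dy; elim: n j => [|n IH] j.
  by rewrite /br_coef /=; case: eqP => // _; apply: bound0.
rewrite /br_coef iterS {1}/br_txy -/(br_coef x y n _).
apply: boundD; first exact: bound_brr.
case: j => [|j]; first exact: bound0.
by rewrite -/(br_coef x y n _); apply: bound_brl => //; apply: bound_cycle.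
Qed.

(** In Jacobson's formula for y + dw every mixed term is an iterated bracket
    containing dw, hence a boundary; the only other term is the power of a
    boundary. *)
Lemma pw_homologous x y w : gpar false x -> gpar false y -> dV y = 0 -> x = y + dV w ->
  bound (pw x - pw y).
Proof.
move=> hx hy dy e; pose w1 := par true w.
have hw1 : gpar true w1 := gpar_par _ _.
have ex : x = dV w1 + y.
  rewrite -hx e parD hy addrC; congr (_ + _).
  by rewrite (@par_shift k V V dV 1 _ _ (fun i => @d_deg (i + 1))).
have hdw : gpar false (dV w1) := gpar_d hw1.
rewrite ex pwD // addrAC addrK; apply: boundD.
  have [z ez] := bnd_pow hw1; exists z; apply: L_inj.
  by rewrite L_pw.
elim/big_ind: _ => [|a b|j _]; [exact: bound0|exact: boundD|].
by apply/boundZ/br_coef_bound => //; exists w1.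
Qed.

Definition hcl x : H := cls d x.
Lemma hcl_linear a x y : dV x = 0 -> dV y = 0 -> hcl (a *: x + y) = a *: hcl x + hcl y.
Proof. exact (@cls_linear k M d a x y). Qed.
Lemma hcl0 : hcl 0 = 0. Proof. exact: cls0. Qed.
Lemma hclD x y : dV x = 0 -> dV y = 0 -> hcl (x + y) = hcl x + hcl y.
Proof. exact (@clsD k M d x y). Qed.
Lemma hclZ a x : dV x = 0 -> hcl (a *: x) = a *: hcl x.
Proof. exact (@clsZ k M d a x). Qed.
Lemma hcl_sum I (s : seq I) (F : I -> V) : (forall i, dV (F i) = 0) ->
  hcl (\sum_(i <- s) F i) = \sum_(i <- s) hcl (F i).
Proof. exact (@cls_sum k M d I s F). Qed.
Lemma hcl_bnd x : hcl (dV x) = 0. Proof. exact: cls_bnd. Qed.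
Lemma hcl_eq x y : dV x = 0 -> dV y = 0 -> hcl x = hcl y -> exists w, x = y + dV w.
Proof. exact (@cls_eq k M d x y). Qed.
Lemma rep_ex h : exists x, dV x = 0 /\ h = hcl x.
Proof. exact: (@cls_surj k M d h). Qed.
Definition rep h : V := sval (cid (rep_ex h)).
Lemma d_rep h : dV (rep h) = 0. Proof. by rewrite /rep; case: cid => x []. Qed.
Lemma cls_rep h : hcl (rep h) = h. Proof. by rewrite /rep; case: cid => x []. Qed.

(** The square and the power are defined on elements of one parity only, so
    a representative of that parity is chosen. *)
Definition prep b h : V :=
  if pselect (exists x, [/\ gpar b x, dV x = 0 & h = hcl x]) is left e
  then sval (cid e) else 0.
Lemma prepP b x : gpar b x -> dV x = 0 ->
  [/\ gpar b (prep b (hcl x)), dV (prep b (hcl x)) = 0 &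
      hcl (prep b (hcl x)) = hcl x].
Proof.
move=> hx dx; rewrite /prep; case: pselect => [e|[]]; last by exists x.
by case: cid => y /= [].
Qed.

Definition hbr h h' : H := hcl (br (rep h) (rep h')).
Definition hsq h : H := hcl (sqr (prep true h)).
Definition hpw h : H := hcl (pw (prep false h)).

Lemma cls_homologous x y : dV y = 0 -> bound (x - y) -> hcl x = hcl y.
Proof.
move=> dy [w e]; have -> : x = y + dV w by rewrite -e addrC subrK.
by rewrite hclD ?hcl_bnd ?addr0 //; apply: d_sq.
Qed.

Lemma hbr_cls x y : dV x = 0 -> dV y = 0 -> hbr (hcl x) (hcl y) = hcl (br x y).
Proof.
move=> dx dy; rewrite /hbr; set x' := rep _; set y' := rep _.
have dx' : dV x' = 0 by apply: d_rep.
have dy' : dV y' = 0 by apply: d_rep.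
have [v ex] := hcl_eq dx' dx (cls_rep _); have [w ey] := hcl_eq dy' dy (cls_rep _).
apply: cls_homologous; first exact: d_br0.
(* Change the two representatives one at a time. *)
have -> : br x' y' - br x y = br (x' - x) y' + br x (y' - y).
  rewrite brBl brBr.
  by rewrite addrA subrK.
apply: boundD; first apply: bound_brl => //; last apply: bound_brr => //.
  by exists v; rewrite ex addrAC subrr add0r.
by exists w; rewrite ey addrAC subrr add0r.
Qed.

Lemma hsq_cls x : gpar true x -> dV x = 0 -> hsq (hcl x) = hcl (sqr x).
Proof.
move=> hx dx; have [hy dy e] := prepP hx dx; rewrite /hsq.
have [w ew] := hcl_eq dy dx e; apply: cls_homologous; first exact: d_sqr.
exact: sqr_homologous hy hx dx ew.
Qed.

Lemma hpw_cls x : gpar false x -> dV x = 0 -> hpw (hcl x) = hcl (pw x).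
Proof.
move=> hx dx; have [hy dy e] := prepP hx dx; rewrite /hpw.
have [w ew] := hcl_eq dy dx e; apply: cls_homologous; first exact: d_pw.
exact: pw_homologous hy hx dx ew.
Qed.

Lemma hdegP i h : gdeg i h <-> exists x, [/\ gdeg i x, dV x = 0 & h = hcl x].
Proof.
split=> [[x hx /is_classP[dx ->]]|[x [hx dx ->]]]; first by exists x.
by exists x => //; apply: cls_class.
Qed.

Lemma hbr_linl h : linear (hbr^~ h).
Proof.
move=> a h1 h2; rewrite -(cls_rep h1) -(cls_rep h2) -(cls_rep h).
have dl : dV (a *: rep h1 + rep h2) = 0 by rewrite linearP !d_rep scaler0 addr0.
rewrite -hcl_linear ?d_rep // !hbr_cls ?d_rep // br_linl hcl_linear //.
  by apply: d_br0; apply: d_rep.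
by apply: d_br0; apply: d_rep.
Qed.

Lemma hbr_linr h : linear (hbr h).
Proof.
move=> a h1 h2; rewrite -(cls_rep h1) -(cls_rep h2) -(cls_rep h).
have dl : dV (a *: rep h1 + rep h2) = 0 by rewrite linearP !d_rep scaler0 addr0.
rewrite -hcl_linear ?d_rep // !hbr_cls ?d_rep // br_linr hcl_linear //.
  by apply: d_br0; apply: d_rep.
by apply: d_br0; apply: d_rep.
Qed.

Lemma sqr_deg i x : oddz i -> gdeg i x -> gdeg (i *+ 2) (sqr x).
Proof.
move=> oi hx; apply: wd_LP; rewrite L_sqr; last by have := gpar_hom hx; rewrite oi.
by rewrite mulr2n; apply: wdM; apply: wd_L.
Qed.

Lemma pw_deg i x : ~~ oddz i -> gdeg i x -> gdeg (i *+ p) (pw x).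
Proof.
move=> /negbTE oi hx; apply: wd_LP; rewrite L_pw; last by have := gpar_hom hx; rewrite oi.
by apply/wd_pow/wd_L.
Qed.

Lemma br_anti i j x y : gdeg i x -> gdeg j y -> br x y = - (ksign k (i * j) *: br y x).
Proof.
move=> /gpar_hom hx /gpar_hom hy; apply: L_inj; rewrite linearN linearZ_LR !L_br.
rewrite (sbr_gpar _ hx) (sbr_gpar _ hy) (taub_L _ hx) (taub_L _ hy) ksignE oddzM.
rewrite -!scalerAl [oddz j && _]andbC.
by rewrite scalerBr scalerA sgK scale1r opprB.
Qed.

Lemma br_even i x : ~~ oddz i -> gdeg i x -> br x x = 0.
Proof.
move=> /negbTE oi /gpar_hom hx; apply: L_inj.
by rewrite (br_self hx) oi /sg expr0 scale1r subrr linear0.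
Qed.

Lemma zmod_jacobi (A : zmodType) (a b c e f g : A) :
  a - b - (c - e) = (a - f) - (g - e) + ((f - c) - (b - g)).
Proof.
by rewrite !opprB [RHS]addrACA !subrKA [LHS]addrACA [RHS]addrACA [- b - c]addrC.
Qed.

(** The products of three letters cancel by associativity once the signs
    of the two sides have been matched. *)
Lemma br_jacobi i j x y z : gdeg i x -> gdeg j y ->
  br x (br y z) = br (br x y) z + ksign k (i * j) *: br y (br x z).
Proof.
move=> gx gy; have hx := gpar_hom gx; have hy := gpar_hom gy.
have hxy := gpar_hom (br_deg gx gy); rewrite oddzD in hxy.
apply: L_inj; rewrite (linD L) (linZ L) !L_br ksignE oddzM.
rewrite (sbr_gpar _ hxy) L_br !(sbr_gpar _ hx) !(sbr_gpar _ hy) !linearB !taubM.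
rewrite (taub_L _ hx) (taub_L _ hy) !taub_taub [oddz j && _]andbC [oddz j (+) _]addbC.
set s := sg k _; have ss : s * s = 1 := sgK _ _.
rewrite !(mulrBr, mulrBl) -!scalerAl -!scalerAr -!scalerAl /=.
rewrite !scalerBr !scalerA ss !scale1r.
rewrite !mulrA.
exact: zmod_jacobi.
Qed.

Lemma br_odd i x : oddz i -> gdeg i x -> br x (br x x) = 0.
Proof.
move=> oi /gpar_hom hx; rewrite oi in hx; apply: L_inj; rewrite linear0 L_br (br_self hx).
rewrite /sg expr1 scaleN1r opprK (sbr_gpar _ hx) linearD taubM (taub_L _ hx).
by rewrite /sg expr1 scaleN1r mulrNN mulrDr mulrDl !mulrA subrr.
Qed.

Lemma br_sqr i x z : oddz i -> gdeg i x -> br (sqr x) z = br x (br x z).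
Proof.
move=> oi gx; have hx := gpar_hom gx; rewrite oi in hx.
have hs := gpar_hom (sqr_deg oi gx); rewrite mulr2n oddzD addbb in hs.
apply: L_inj; rewrite !L_br (sbr_gpar _ hs) !(sbr_gpar _ hx) (L_sqr hx) linearB !taubM.
rewrite (taub_L _ hx) taub_taub addbb /sg expr1 scaleN1r /=.
by rewrite mulrBr mulrBl mulrN !mulNr opprB opprK !mulrA addrACA addNr addr0.
Qed.

Lemma oddzMn i n : ~~ oddz i -> ~~ oddz (i *+ n).
Proof. by elim: n => [|n IH] //; rewrite mulrS oddzD => oi; rewrite (negbTE oi) IH. Qed.

Lemma br_pw i x z : ~~ oddz i -> gdeg i x -> br (pw x) z = iter p (br x) z.
Proof.
move=> oi gx; have hx := gpar_hom gx; rewrite (negbTE oi) in hx.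
have hs := gpar_hom (pw_deg oi gx); rewrite (negbTE (oddzMn p oi)) in hs.
apply: L_inj; rewrite (L_br_even _ hs) (L_pw hx) -(iter_cad_prime p_pr pB0).
by elim: {1 2}p => [|n IH] //=; rewrite (L_br_even _ hx) IH.
Qed.

Lemma hbr_deg i j h h' : gdeg i h -> gdeg j h' -> gdeg (i + j) (hbr h h').
Proof.
move=> /hdegP[x [hx dx ->]] /hdegP[y [hy dy ->]]; rewrite hbr_cls //.
by apply/hdegP; exists (br x y); split=> //; [apply: br_deg|apply: d_br0].
Qed.

Lemma hsq_deg i h : oddz i -> gdeg i h -> gdeg (i *+ 2) (hsq h).
Proof.
move=> oi /hdegP[x [gx dx ->]]; have hx := gpar_hom gx; rewrite oi in hx.
by rewrite hsq_cls //; apply/hdegP; exists (sqr x); split=> //; [apply: sqr_deg|apply: d_sqr].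
Qed.

Lemma hpw_deg i h : ~~ oddz i -> gdeg i h -> gdeg (i *+ p) (hpw h).
Proof.
move=> oi /hdegP[x [gx dx ->]]; have hx := gpar_hom gx; rewrite (negbTE oi) in hx.
by rewrite hpw_cls //; apply/hdegP; exists (pw x); split=> //; [apply: pw_deg|apply: d_pw].
Qed.

Lemma hbr_anti i j h h' : gdeg i h -> gdeg j h' -> hbr h h' = - (ksign k (i * j) *: hbr h' h).
Proof.
move=> /hdegP[x [hx dx ->]] /hdegP[y [hy dy ->]]; rewrite !hbr_cls //.
rewrite (br_anti hx hy) -scaleNr hclZ; last exact: d_br0.
by rewrite scaleNr.
Qed.

Lemma hbr_even i h : ~~ oddz i -> gdeg i h -> hbr h h = 0.
Proof.
by move=> oi /hdegP[x [hx dx ->]]; rewrite hbr_cls // (br_even oi hx) hcl0.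
Qed.

Lemma hbr_jacobi i j h1 h2 h3 : gdeg i h1 -> gdeg j h2 ->
  hbr h1 (hbr h2 h3) = hbr (hbr h1 h2) h3 + ksign k (i * j) *: hbr h2 (hbr h1 h3).
Proof.
move=> /hdegP[x [hx dx ->]] /hdegP[y [hy dy ->]]; rewrite -(cls_rep h3).
have dz := d_rep h3; move: (rep h3) dz => z dz; have d0 := d_br0.
rewrite !hbr_cls ?d0 // (br_jacobi _ hx hy) hclD ?hclZ ?d0 //.
by rewrite (linZ dV) d0 ?scaler0 ?d0.
Qed.

Lemma hbr_odd i h : oddz i -> gdeg i h -> hbr h (hbr h h) = 0.
Proof.
move=> oi /hdegP[x [hx dx ->]]; have d0 := d_br0.
by rewrite !hbr_cls ?d0 // (br_odd oi hx) hcl0.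
Qed.

Lemma hsqD i h h' : oddz i -> gdeg i h -> gdeg i h' -> hsq (h + h') = hsq h + hsq h' + hbr h h'.
Proof.
move=> oi /hdegP[x [gx dx ->]] /hdegP[y [gy dy ->]].
have hx := gpar_hom gx; have hy := gpar_hom gy; rewrite oi in hx hy.
have dxy : dV (x + y) = 0 by rewrite linearD dx dy addr0.
rewrite -hclD // !hsq_cls ?hbr_cls ?sqrD //; last exact: gparD.
have ds := d_sqr hx dx; have ds' := d_sqr hy dy; have db := d_br0 dx dy.
by rewrite !hclD // linearD ds ds' addr0.
Qed.

Lemma hsqZ i a h : oddz i -> gdeg i h -> hsq (a *: h) = a ^+ 2 *: hsq h.
Proof.
move=> oi /hdegP[x [gx dx ->]]; have hx := gpar_hom gx; rewrite oi in hx.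
have dax : dV (a *: x) = 0 by rewrite linearZ /= dx scaler0.
have hax := gparZ a hx; rewrite -hclZ // !hsq_cls // -hclZ; last exact: d_sqr.
congr hcl; apply: L_inj; rewrite linearZ !L_sqr // linearZ -scalerAl -scalerAr scalerA.
by [].
Qed.

Lemma hsq_ad i h h' : oddz i -> gdeg i h -> hbr (hsq h) h' = hbr h (hbr h h').
Proof.
move=> oi /hdegP[x [gx dx ->]]; have hx := gpar_hom gx; rewrite oi in hx.
rewrite -(cls_rep h'); have dz := d_rep h'; have d0 := d_br0.
by rewrite hsq_cls // !hbr_cls ?d0 ?(br_sqr _ oi gx) //; apply: d_sqr.
Qed.

Definition homology_grlie : grlie H :=
  GrLie hbr_linl hbr_linr hbr_deg hsq_deg hbr_anti hbr_even hbr_jacobi hbr_odd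
    hsqD hsqZ hsq_ad.

Lemma hpwZ i a h : ~~ oddz i -> gdeg i h -> hpw (a *: h) = a ^+ p *: hpw h.
Proof.
move=> oi /hdegP[x [gx dx ->]]; have hx := gpar_hom gx; rewrite (negbTE oi) in hx.
have dax : dV (a *: x) = 0 by rewrite (linZ dV) dx scaler0.
have hax := gparZ a hx; rewrite -hclZ // !hpw_cls // -hclZ; last exact: d_pw.
by congr hcl; apply: L_inj; rewrite (linZ L) !L_pw // (linZ L) exprZn.
Qed.

Lemma hpw_ad i h h' : ~~ oddz i -> gdeg i h -> hbr (hpw h) h' = iter p (hbr h) h'.
Proof.
move=> oi /hdegP[x [gx dx ->]]; have hx := gpar_hom gx; rewrite (negbTE oi) in hx.
rewrite -(cls_rep h'); have dz := d_rep h'; move: (rep h') dz => z dz.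
rewrite hpw_cls // hbr_cls ?(br_pw _ oi gx) //; last exact: d_pw.
suff H0 n : dV (iter n (br x) z) = 0 /\ hcl (iter n (br x) z) = iter n (hbr (hcl x)) (hcl z).
  by case: (H0 p).
elim: n => [|n [IH e]] //=; split; first exact: d_br0.
by rewrite -hbr_cls // e.
Qed.

Lemma d_br_coef x y n j : dV x = 0 -> dV y = 0 -> dV (br_coef x y n j) = 0.
Proof.
move=> dx dy; elim: n j => [|n IH] j; first by rewrite /br_coef /=; case: eqP; rewrite ?linear0.
rewrite /br_coef iterS {1}/br_txy -/(br_coef x y n _) (linD dV) d_br0 ?add0r //.
by case: j => [|j]; rewrite ?linear0 // -/(br_coef x y n _) d_br0.
Qed.

(** Both recursions use only brackets, which commute with passing to
    classes. *)
Lemma ad_coef_cls x y n j : dV x = 0 -> dV y = 0 ->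
  ad_coef homology_grlie (hcl x) (hcl y) n j = hcl (br_coef x y n j).
Proof.
move=> dx dy; have dc := d_br_coef; elim: n j => [|n IH] j.
  by rewrite /br_coef /ad_coef /=; case: eqP => // _; rewrite hcl0.
rewrite /br_coef /ad_coef !iterS {1}/br_txy {1}/ad_txy -/(br_coef x y n _).
rewrite -/(ad_coef homology_grlie (hcl x) (hcl y) n j) IH /= hbr_cls ?dc //.
case: j => [|j]; first by rewrite !addr0.
rewrite -/(ad_coef homology_grlie (hcl x) (hcl y) n j) -/(br_coef x y n _) IH.
by rewrite hbr_cls ?dc // -hclD // d_br0 ?dc.
Qed.

Lemma hpwD i h h' : ~~ oddz i -> gdeg i h -> gdeg i h' ->
  exists2 s : nat -> H,
    (forall j, (0 < j < p)%N -> s j *+ j = ad_coef homology_grlie h h' p.-1 j.-1) &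
    hpw (h + h') = hpw h + hpw h' + \sum_(1 <= j < p) s j.
Proof.
move=> oi /hdegP[x [gx dx ->]] /hdegP[y [gy dy ->]].
have hx := gpar_hom gx; have hy := gpar_hom gy; rewrite (negbTE oi) in hx hy.
exists (fun j => ninv j *: ad_coef homology_grlie (hcl x) (hcl y) p.-1 j.-1).
  by move=> j hj; apply: ninvMn.
have dxy : dV (x + y) = 0 by rewrite (linD dV) dx dy addr0.
have dp := d_pw; have ds j : dV (ninv j *: br_coef x y p.-1 j.-1) = 0.
  by rewrite (linZ dV) d_br_coef ?scaler0.
rewrite -hclD // !hpw_cls ?pwD //; last exact: gparD.
rewrite !hclD ?hcl_sum ?dp //; last 2 first.
- by rewrite (linD dV) !dp ?addr0.
- by rewrite (linS dV) big1.
congr (_ + _); apply: eq_bigr => j _.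
by rewrite ad_coef_cls // -hclZ // d_br_coef.
Qed.

Definition homology_rgrlie : rgrlie p H :=
  @RGrLie k p H homology_grlie hpw hpw_deg hpwZ hpw_ad hpwD.

Theorem primitives_rgrlie : exists R : rgrlie p (susp (gcohom d_deg)),
  [/\ forall i j x y z, gdeg i x -> gdeg j y -> d x = 0 -> d y = 0 ->
        L x * L y - ksign k (i * j) *: (L y * L x) = L z ->
        is_class (d := d) z (lbr R (cls d x) (cls d y)),
      forall i x z, oddz i -> gdeg i x -> d x = 0 -> L x * L x = L z ->
        is_class (d := d) z (lsq R (cls d x)) &
      forall i x z, ~~ oddz i -> gdeg i x -> d x = 0 -> L x ^+ p = L z ->
        is_class (d := d) z (lpow R (cls d x))].
Proof.
exists homology_rgrlie; split=> [i j x y z gx gy dx dy e|i x z oi gx dx e|i x z oi gx dx e].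
- have -> : z = br x y.
    apply: L_inj; rewrite L_br (sbr_gpar _ (gpar_hom gx)) (taub_L _ (gpar_hom gy)).
    by rewrite -scalerAl -oddzM -ksignE e.
  rewrite /= (hbr_cls dx dy); apply: cls_class; exact: d_br0.
- have hx := gpar_hom gx; rewrite oi in hx.
  have -> : z = sqr x by apply: L_inj; rewrite L_sqr.
  rewrite /= (hsq_cls hx dx); apply: cls_class; exact: d_sqr.
- have hx := gpar_hom gx; rewrite (negbTE oi) in hx.
  have -> : z = pw x by apply: L_inj; rewrite L_pw.
  rewrite /= (hpw_cls hx dx); apply: cls_class; exact: d_pw.
Qed.
End RestrictedLie.

(** * Primitive elements of the bar construction *)

Section Binomials.
Variable A : zmodType.

Lemma bin_pascal (f : nat -> nat -> A) n :
  \sum_(i < n.+1) (f (n - i).+1 i + f (n - i)%N i.+1) *+ 'C(n, i) =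
  \sum_(i < n.+2) f (n.+1 - i)%N i *+ 'C(n.+1, i).
Proof.
rewrite (eq_bigr (fun i : 'I_n.+1 => f (n.+1 - i)%N i *+ 'C(n, i)
   + f (n.+1 - i.+1)%N i.+1 *+ 'C(n, i))); last first.
  by move=> i _; have le_in : (i <= n)%N := ltn_ord i; rewrite mulrnDl subSS subSn.
rewrite big_split /= big_ord_recl [X in _ + X]big_ord_recr.
rewrite [RHS]big_ord_recl [X in _ = _ + X]big_ord_recr /= !bin0 !binn.
rewrite -!addrA; congr (_ + _); rewrite addrA; congr (_ + _).
rewrite -big_split /=; apply: eq_bigr => i _.
by rewrite /bump add1n binS mulrnDr.
Qed.

Lemma bin_triangle (G : nat -> nat -> A) n :
  \sum_(j < n.+1) \sum_(l < (n - j).+1) G j l =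
  \sum_(m < n.+1) \sum_(j < m.+1) G j (m - j)%N.
Proof.
elim: n => [|n IH]; first by rewrite !big_ord1.
rewrite [RHS]big_ord_recr -IH /= big_ord_recr /= subnn big_ord1.
rewrite (big_ord_recr n.+1) /= subnn addrA; congr (_ + _).
rewrite -big_split /=; apply: eq_bigr => j _.
have jn : (j <= n)%N by rewrite -ltnS.
by rewrite subSn // big_ord_recr.
Qed.

(** Both sides count the chains of subsets of sizes j, m and n. *)
Lemma bin_trinomial n m j : (j <= m <= n)%N ->
  ('C(n, j) * 'C(n - j, m - j) = 'C(n, m) * 'C(m, j))%N.
Proof.
move=> /andP[jm mn]; have jn := leq_trans jm mn.
have le2 : (m - j <= n - j)%N by lia.
have e1 := bin_fact jn; have e2 := bin_fact le2; have e3 := bin_fact mn.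
have e4 := bin_fact jm; have E : (n - j - (m - j) = n - m)%N by lia.
rewrite E in e2; apply/eqP.
rewrite -(eqn_pmul2r (fact_gt0 j)) -(eqn_pmul2r (fact_gt0 (m - j))).
rewrite -(eqn_pmul2r (fact_gt0 (n - m))); apply/eqP.
transitivity n`!.
  by rewrite -e1 -e2; ring.
by rewrite -e3 -e4; ring.
Qed.
End Binomials.

Section Words.
Variables (k : comNzRingType).

Lemma sumz_nil : sumz [::] = 0. Proof. by rewrite /sumz big_nil. Qed.
Lemma sumz_cons d ds : sumz (d :: ds) = d + sumz ds.
Proof. by rewrite /sumz big_cons. Qed.
Lemma sumz_cat ds es : sumz (ds ++ es) = sumz ds + sumz es.
Proof. by rewrite /sumz big_cat. Qed.

Section Multilinear.
Variables (V P : lmodType k) (f : seq V -> P).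
Hypothesis f_multi : wmultilin f.

Lemma wmulti0 (u w : seq V) : f (u ++ 0 :: w) = 0.
Proof.
have := f_multi u (-1) 0 0 w.
by rewrite scaler0 addr0 scaleN1r addNr.
Qed.

Lemma wmultiD (u : seq V) x y w : f (u ++ (x + y) :: w) = f (u ++ x :: w) + f (u ++ y :: w).
Proof. by rewrite -{1}[x]scale1r f_multi scale1r. Qed.

Lemma wmulti_scale (w : seq V) (c : seq k) : size c = size w ->
  f [seq p.1 *: p.2 | p <- zip c w] = (\prod_(a <- c) a) *: f w.
Proof.
suff H (u : seq V) : size c = size w -> f (u ++ [seq p.1 *: p.2 | p <- zip c w]) =
    (\prod_(a <- c) a) *: f (u ++ w) by apply: (H [::]).
elim: w c u => [|x w IH] [|a c] u //=; first by rewrite big_nil scale1r.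
move=> [/IH E]; have := f_multi u a x 0 [seq p.1 *: p.2 | p <- zip c w].
rewrite addr0 wmulti0 addr0 => ->.
by have := E (rcons u x); rewrite !cat_rcons => ->; rewrite big_cons scalerA.
Qed.
End Multilinear.

Variable M : grmod k.

Lemma whom_cat ds es (u v : seq M) : whom ds u -> whom es v -> whom (ds ++ es) (u ++ v).
Proof. by elim: u ds => [|x u IH] [|d ds] //= [hx hu] hv; split=> //; apply: IH. Qed.

Lemma whom_size ds (u : seq M) : whom ds u -> size ds = size u.
Proof. by elim: u ds => [|x u IH] [|d ds] //= [_ /IH ->]. Qed.

Lemma whom_take i ds (u : seq M) : whom ds u -> whom (take i ds) (take i u).
Proof. by elim: u ds i => [|x u IH] [|d ds] [|i] //= [hx /IH h]; split. Qed.

Lemma whom_drop i ds (u : seq M) : whom ds u -> whom (drop i ds) (drop i u).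
Proof. by elim: u ds i => [|x u IH] [|d ds] [|i] //= [hx /IH h]. Qed.

Lemma multi_sgn_hom (P : lmodType k) (f : seq M -> P) ds (w : seq M) :
  wmultilin f -> whom ds w -> f (map (@sgn k M) w) = ksign k (sumz ds) *: f w.
Proof.
move=> f_multi hw.
have -> : map (@sgn k M) w = [seq p.1 *: p.2 | p <- zip (map (ksign k) ds) w].
  elim: w ds hw => [|x w IH] [|d ds] //= [hx hw].
  by rewrite (sgn_hom hx) (IH _ hw).
rewrite wmulti_scale ?size_map ?(whom_size hw) //; congr (_ *: _).
rewrite big_map; elim: ds {hw} => [|d ds IH]; first by rewrite big_nil sumz_nil.
by rewrite big_cons IH sumz_cons !ksignE oddzD sgD.
Qed.
End Words.

Definition wdeg (k : comNzRingType) (V : grmod k) (B : lmodType k) (word : seq V -> B)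
  (n : int) : B -> Prop :=
  lspan (fun X => exists2 ds, sumz ds = n & exists2 w, whom ds w & X = word w).

(** The bar construction is known through its universal properties only: B is
    spanned by words, multilinear functions of words extend to B, and T represents
    bilinear maps. This interface keeps the quotient that defines it out of the
    computations. *)
Section BarModel.
Variables (k : comNzRingType) (M : grmod k) (B : algType k) (T : lmodType k).
Local Notation V := (susp M).
Variables (word : seq V -> B) (tp : B -> B -> T) (com : {linear B -> T}).
Variables (b1 : {linear B -> V}) (eps : {linear B -> k^o}) (d : {linear B -> B}).
Hypotheses (word_multi : wmultilin word)
  (word_ext : forall (P : lmodType k) (f g : {linear B -> P}),
     (forall ds w, whom ds w -> f (word w) = g (word w)) -> forall X, f X = g X)
  (word_lift : forall (P : lmodType k) (f : seq V -> P), wmultilin f ->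
     {h : {linear B -> P} | forall w, h (word w) = f w})
  (tp_linl : forall Y, linear (tp^~ Y)) (tp_linr : forall X, linear (tp X))
  (tp_lift : forall (P : lmodType k) (f : B -> B -> P),
     (forall Y, linear (f^~ Y)) -> (forall X, linear (f X)) ->
     {h : {linear T -> P} | forall X Y, h (tp X Y) = f X Y})
  (comE : forall w, com (word w) =
     \sum_(0 <= i < (size w).+1) tp (word (take i w)) (word (drop i w)))
  (b1E : forall w, b1 (word w) = if w is [:: x] then x else 0)
  (epsE : forall w, eps (word w) = (w == [::])%:R)
  (word_nil : word [::] = 1)
  (eps_mul : forall X Y, eps (X * Y) = eps X * eps Y)
  (com_mul : forall ds es (u v : seq V), whom ds u -> whom es v ->
    com (word u * word v) =
      \sum_(0 <= i < (size u).+1) \sum_(0 <= j < (size v).+1)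
        ksign k (sumz (drop i ds) * sumz (take j es)) *:
          tp (word (take i u) * word (take j v)) (word (drop i u) * word (drop j v)))
  (eps_d : forall X, eps (d X) = 0)
  (d_sq : forall X, d (d X) = 0)
  (d_mul : forall ds (u : seq V) X, whom ds u ->
    d (word u * X) = d (word u) * X + ksign k (sumz ds) *: (word u * d X))
  (com_d : forall ds (u : seq V), whom ds u ->
    com (d (word u)) = \sum_(0 <= i < (size u).+1)
        (tp (d (word (take i u))) (word (drop i u))
         + ksign k (sumz (take i ds)) *: tp (word (take i u)) (d (word (drop i u)))))
  (deg_mul : forall ds es (u v : seq V), whom ds u -> whom es v ->
     wdeg word (sumz ds + sumz es) (word u * word v))
  (d_deg : forall ds (u : seq V), whom ds u -> wdeg word (sumz ds + 1) (d (word u))).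
Implicit Types (X Y : B) (w : seq V) (g x y : V) (b c : bool).

Lemma tp0l Y : tp 0 Y = 0. Proof. exact: (linear0 (mklin (tp_linl Y))). Qed.
Lemma tp0r X : tp X 0 = 0. Proof. exact: (linear0 (mklin (tp_linr X))). Qed.
Lemma tpDl X X' Y : tp (X + X') Y = tp X Y + tp X' Y.
Proof. exact: (linearD (mklin (tp_linl Y))). Qed.
Lemma tpDr X Y Y' : tp X (Y + Y') = tp X Y + tp X Y'.
Proof. exact: (linearD (mklin (tp_linr X))). Qed.
Lemma tpNl X Y : tp (- X) Y = - tp X Y.
Proof. exact: (linearN (mklin (tp_linl Y))). Qed.
Lemma tpNr X Y : tp X (- Y) = - tp X Y.
Proof. exact: (linearN (mklin (tp_linr X))). Qed.
Lemma tpZl a X Y : tp (a *: X) Y = a *: tp X Y.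
Proof. exact: (linearZ_LR (mklin (tp_linl Y))). Qed.
Lemma tpZr a X Y : tp X (a *: Y) = a *: tp X Y.
Proof. exact: (linearZ_LR (mklin (tp_linr X))). Qed.

Lemma tpMnl X Y n : tp (X *+ n) Y = tp X Y *+ n.
Proof. exact: (linearMn (mklin (tp_linl Y))). Qed.
Lemma tp_suml I (s : seq I) (P : pred I) (F : I -> B) Y :
  tp (\sum_(i <- s | P i) F i) Y = \sum_(i <- s | P i) tp (F i) Y.
Proof. exact: (linear_sum (mklin (tp_linl Y))). Qed.

Lemma tmap_linl (f h : {linear B -> B}) Y : linear (fun X => tp (f X) (h Y)).
Proof. by move=> a X Z; rewrite linearP tp_linl. Qed.
Lemma tmap_linr (f h : {linear B -> B}) X : linear (fun Y => tp (f X) (h Y)).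
Proof. by move=> a Y Z; rewrite linearP tp_linr. Qed.
Definition tpmap (f h : {linear B -> B}) : {linear T -> T} :=
  sval (tp_lift (tmap_linl f h) (tmap_linr f h)).
Lemma tpmapE f h X Y : tpmap f h (tp X Y) = tp (f X) (h Y).
Proof. by rewrite /tpmap; case: tp_lift. Qed.

Fact lett_linear : linear (fun x => word [:: x]).
Proof. by move=> a x y; apply: (word_multi [::]). Qed.
Definition lett : {linear V -> B} := mklin lett_linear.
Lemma lettE x : lett x = word [:: x]. Proof. by []. Qed.
Lemma b1_lett x : b1 (lett x) = x. Proof. exact: b1E. Qed.
Lemma b1_1 : b1 1 = 0. Proof. by rewrite -word_nil b1E. Qed.

Fact rcons_multi g : wmultilin (fun w => word (rcons w g)).
Proof. by move=> u a x y w /=; rewrite !rcons_cat !rcons_cons; apply: word_multi. Qed.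
Definition app g : {linear B -> B} := sval (word_lift (rcons_multi g)).
Lemma appE g w : app g (word w) = word (rcons w g).
Proof. by rewrite /app; case: word_lift. Qed.

Lemma app_linear X : linear (app^~ X).
Proof.
move=> a g h; have hl : linear (fun X => a *: app g X + app h X).
  exact: lin_add (lin_scale _ (linP _)) (linP _).
apply: (word_ext (f := app _) (g := mklin hl)) => _ w _ /=.
by rewrite !appE -!cats1 word_multi.
Qed.
Lemma app0 X : app 0 X = 0. Proof. exact: (linear0 (mklin (app_linear X))). Qed.
Lemma appMn g X n : app (g *+ n) X = app g X *+ n.
Proof. exact: (linearMn (mklin (app_linear X))). Qed.
Lemma appD g h X : app (g + h) X = app g X + app h X.
Proof. exact: (linearD (mklin (app_linear X))). Qed.
Lemma app_sum I (s : seq I) (P : pred I) (F : I -> V) X :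
  app (\sum_(i <- s | P i) F i) X = \sum_(i <- s | P i) app (F i) X.
Proof. exact: (linear_sum (mklin (app_linear X))). Qed.
Lemma app1 g : app g 1 = lett g. Proof. by rewrite -word_nil appE. Qed.

Fact tlast_linl Y : linear (fun X => app (b1 Y) X).
Proof. exact: linearP. Qed.
Fact tlast_linr X : linear (fun Y => app (b1 Y) X).
Proof. exact: lin_comp (app_linear X) (linP b1). Qed.
(** The map X (x) Y |-> X followed by the one-letter component of Y. *)
Definition tlast : {linear T -> B} := sval (tp_lift tlast_linl tlast_linr).
Lemma tlastE X Y : tlast (tp X Y) = app (b1 Y) X.
Proof. by rewrite /tlast; case: tp_lift. Qed.
Lemma tlast1 X : tlast (tp X 1) = 0.
Proof. by rewrite tlastE b1_1 app0. Qed.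

Lemma tlast_word u w :
  tlast (tp (word u) (word w)) = if w is [:: g] then word (rcons u g) else 0.
Proof. by rewrite tlastE b1E; case: w => [|g [|? ?]]; rewrite ?app0 ?appE. Qed.

Lemma drop_eq_nil i w : (i < size w)%N -> drop i w <> [::].
Proof. by move=> lt_iw E; move: lt_iw; rewrite -subn_gt0 -size_drop E. Qed.

(** Deconcatenating a nonempty word and gluing back its last letter gives the
    word again. *)
Lemma tlast_com X : tlast (com X) = X - (eps X : k) *: 1.
Proof.
have hl := lin_comp (linP tlast) (linP com).
have hr := lin_sub (@lin_id _ _) (lin_mul (1 : B) (linP eps)).
apply: (word_ext (f := mklin hl) (g := mklin hr)) => _ w _ /=.
rewrite comE linear_sum epsE (eq_bigr _ (fun i _ => tlast_word _ _)).
case/lastP: w => [|w g]; first by rewrite big_nat1 scale1r word_nil subrr.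
have -> : (rcons w g == [::]) = false by case: w.
rewrite scale0r subr0 size_rcons !big_nat_recr //=.
rewrite (@drop_oversize _ (size w).+1) ?size_rcons // addr0.
rewrite -cats1 drop_size_cat // take_size_cat // cats1.
rewrite [X in X + _]big_nat_cond big1 ?add0r // => i; rewrite andbT => /andP[_ lt_iw].
rewrite drop_rcons 1?ltnW //; case E: (drop i w) => [|x [|? ?]] //=.
by case: (drop_eq_nil lt_iw).
Qed.

Lemma tlast_map_app (f h : {linear B -> B}) g X :
  (forall Y, b1 (h Y) = (eps Y : k) *: g) -> tlast (tpmap f h (com X)) = app g (f X).
Proof.
move=> hb; have hl := lin_comp (linP tlast) (lin_comp (linP (tpmap f h)) (linP com)).
have hr := lin_comp (linP (app g)) (linP f).
apply: (word_ext (f := mklin hl) (g := mklin hr)) => _ w _ /=.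
rewrite comE !linear_sum big_nat_recr //= big_nat_cond big1 => [|i]; last first.
  rewrite andbT => /andP[_ /drop_eq_nil/eqP/negbTE nz].
  by rewrite tpmapE tlastE hb epsE nz scale0r app0.
by rewrite drop_size take_size tpmapE tlastE hb epsE scale1r add0r.
Qed.

Lemma com_app g X : com (app g X) = tp (app g X) 1 + tpmap idfun (app g) (com X).
Proof.
have hl := lin_comp (linP com) (linP (app g)).
have hr := lin_add (lin_comp (tp_linl 1) (linP (app g)))
  (lin_comp (linP (tpmap idfun (app g))) (linP com)).
apply: (word_ext (f := mklin hl) (g := mklin hr)) => _ w _ /=.
rewrite appE !comE size_rcons big_nat_recr //=.
rewrite take_oversize ?drop_oversize ?size_rcons // addrC -word_nil; congr (_ + _).
rewrite linear_sum; apply: eq_big_nat => i /andP[_ lt_iw].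
by rewrite /= tpmapE /= appE drop_rcons // -cats1 takel_cat.
Qed.

Lemma b1_app g X : b1 (app g X) = (eps X : k) *: g.
Proof.
have hl := lin_comp (linP b1) (linP (app g)).
have hr := lin_mul g (linP eps).
apply: (word_ext (f := mklin hl) (g := mklin hr)) => _ w _ /=.
by rewrite appE b1E epsE; case: w => [|x [|y w]] /=; rewrite ?scale1r ?scale0r.
Qed.

(** The unit of the coalgebra is the empty word, which is 1 in B. *)
Definition prim X := com X = tp X 1 + tp 1 X.

(** By [tlast_com], X is recovered from its coproduct; for primitive X only
    the term 1 (x) X contributes, and gives the one-letter part of X. *)
Lemma primP X : prim X -> eps X = 0 -> X = lett (b1 X).
Proof.
move=> pX e0; have := tlast_com X; rewrite e0 scale0r subr0 pX linearD /= tlast1.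
by rewrite add0r tlastE app1.
Qed.

Lemma com_lett g : com (lett g) = tp (lett g) 1 + tp 1 (lett g).
Proof. by rewrite comE !big_nat_recr //= big_geq // add0r addrC -word_nil. Qed.

Lemma eps_lett g : eps (lett g) = 0. Proof. by rewrite epsE. Qed.

Fact bsgn_multi : wmultilin (fun w => word (map (@sgn k V) w)).
Proof. by move=> u a x y w; rewrite !map_cat /= linearP word_multi. Qed.
Definition bsgn : {linear B -> B} := sval (word_lift bsgn_multi).
Lemma bsgnE w : bsgn (word w) = word (map (@sgn k V) w).
Proof. by rewrite /bsgn; case: word_lift. Qed.
Lemma bsgn_hom ds w : whom ds w -> bsgn (word w) = ksign k (sumz ds) *: word w.
Proof. by move=> hw; rewrite bsgnE; apply: multi_sgn_hom. Qed.
Lemma bsgn1 : bsgn 1 = 1. Proof. by rewrite -word_nil bsgnE. Qed.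
Lemma bsgn_lett g : bsgn (lett g) = lett (sgn g). Proof. exact: bsgnE. Qed.

Definition bsgnb b : {linear B -> B} := if b then bsgn else idfun.

Lemma bsgnb_hom b ds w : whom ds w -> bsgnb b (word w) = sg k (b && oddz (sumz ds)) *: word w.
Proof.
by move=> hw; case: b; rewrite /= ?scale1r // (bsgn_hom hw) ksignE.
Qed.

Definition mull x : {linear B -> B} := mklin (fun a X Y =>
  etrans (mulrDr (lett x) (a *: X) Y) (congr1 (+%R^~ _) (esym (scalerAr a (lett x) X)))).

Lemma com_lettM_word b x ds w : gpar b x -> whom ds w ->
  com (lett x * word w) = \sum_(0 <= j < (size w).+1)
    (tp (lett x * word (take j w)) (word (drop j w))
     + tp (bsgnb b (word (take j w))) (lett x * word (drop j w))).
Proof.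
move=> hx hw; move: x hx; apply: gpar_ind => [|x y IHx IHy|i x <- hx].
- rewrite linear0 mul0r linear0 big1 // => j _.
  by rewrite !mul0r tp0l tp0r addr0.
- rewrite linearD mulrDl linearD IHx IHy -big_split /=; apply: eq_bigr => j _.
  by rewrite !mulrDl tpDl tpDr addrACA.
- have hx1 : whom [:: i] [:: x] by [].
  rewrite lettE (com_mul hx1 hw) (big_nat_recr 1) //= big_nat1 addrC -big_split /=.
  apply: eq_big_nat => j _; congr (_ + _).
    by rewrite sumz_nil mul0r word_nil mul1r scale1r.
  rewrite word_nil mul1r (bsgnb_hom _ (whom_take j hw)) tpZl sumz_cons sumz_nil addr0.
  by rewrite ksignE oddzM.
Qed.

(** A letter is primitive and the product is compatible with the coproduct, so
    multiplying by a letter acts on the coproduct as a coderivation; the sign map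
    accounts for moving the letter past the first factor. *)
Lemma com_lettM b x X : gpar b x ->
  com (lett x * X) = tpmap (mull x) idfun (com X) + tpmap (bsgnb b) (mull x) (com X).
Proof.
move=> hx; have hl := lin_comp (linP com) (linP (mull x)).
have hr := lin_add (lin_comp (linP (tpmap (mull x) idfun)) (linP com))
  (lin_comp (linP (tpmap (bsgnb b) (mull x))) (linP com)).
apply: (word_ext (f := mklin hl) (g := mklin hr)) => ds w hw /=.
rewrite (com_lettM_word hx hw) comE !linear_sum -big_split /=; apply: eq_bigr => j _.
by rewrite !tpmapE.
Qed.

Lemma d1 : d 1 = 0.
Proof.
have := @d_mul [::] [::] 1 I; rewrite word_nil sumz_nil !mulr1 mul1r scale1r.
by move/eqP; rewrite -subr_eq0 opprD addrA subrr sub0r oppr_eq0 => /eqP.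
Qed.

Lemma d_lettM b x X : gpar b x ->
  d (lett x * X) = d (lett x) * X + sg k b *: (lett x * d X).
Proof.
move: x; apply: gpar_ind => [|y z IHy IHz|i y <- hy].
- by rewrite !(linear0, mul0r, addr0).
- by rewrite linearD mulrDl [d (_ + _)]linearD IHy IHz linearD !mulrDl scalerDr addrACA.
- have hy1 : whom [:: i] [:: y] by [].
  by rewrite lettE (d_mul X hy1) sumz_cons sumz_nil addr0 ksignE.
Qed.

Lemma com_d_all X : com (d X) = tpmap d idfun (com X) + tpmap bsgn d (com X).
Proof.
have hl := lin_comp (linP com) (linP d).
have hr := lin_add (lin_comp (linP (tpmap d idfun)) (linP com))
  (lin_comp (linP (tpmap bsgn d)) (linP com)).
apply: (word_ext (f := mklin hl) (g := mklin hr)) => ds w hw /=.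
rewrite (com_d hw) comE !linear_sum -big_split /=; apply: eq_bigr => j _.
by rewrite !tpmapE (bsgn_hom (whom_take j hw)) tpZl.
Qed.

(** The differential is a coderivation, so it preserves primitive elements. *)
Lemma d_lett x : d (lett x) = lett (b1 (d (lett x))).
Proof.
apply: primP; last exact: eps_d.
by rewrite /prim com_d_all com_lett !linearD !tpmapE /= d1 bsgn1 tp0l tp0r addr0 add0r.
Qed.

Lemma bsgn_wdeg n X : wdeg word n X -> bsgn X = ksign k n *: X.
Proof.
elim=> [|a Y Z [ds <- [w hw ->]] _ IH]; first by rewrite linear0 scaler0.
by rewrite linearP IH (bsgn_hom hw) scalerDr !scalerA mulrC.
Qed.

Lemma wdeg_mul n m X Y : wdeg word n X -> wdeg word m Y -> wdeg word (n + m) (X * Y).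
Proof.
move=> hX; elim=> [|a Y1 Y2 [ds <- [w hw ->]] _ IH]; first by rewrite mulr0; apply: lspan0.
rewrite mulrDr; apply: lspanD => //; rewrite -scalerAr; apply: lspanZ => {IH Y2}.
elim: hX => [|c X1 X2 [es <- [u hu ->]] _ IH]; first by rewrite mul0r; apply: lspan0.
by rewrite mulrDl; apply: lspanD => //; rewrite -scalerAl; apply: lspanZ; apply: deg_mul.
Qed.

Lemma bsgnM X Y : bsgn (X * Y) = bsgn X * bsgn Y.
Proof.
have hl Z : linear (fun X => bsgn (X * Z)).
  by move=> a X1 X2; rewrite mulrDl -scalerAl linearP.
have hr Z : linear (fun X => bsgn X * bsgn Z).
  by move=> a X1 X2; rewrite linearP mulrDl -scalerAl.
have hl' Z : linear (fun X => bsgn (Z * X)).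
  by move=> a X1 X2; rewrite mulrDr -scalerAr linearP.
have hr' Z : linear (fun X => bsgn Z * bsgn X).
  by move=> a X1 X2; rewrite linearP mulrDr -scalerAr.
apply: (word_ext (f := mklin (hl Y)) (g := mklin (hr Y))) => ds u hu /=.
apply: (word_ext (f := mklin (hl' _)) (g := mklin (hr' _))) => es v hv /=.
rewrite (bsgn_wdeg (deg_mul hu hv)) (bsgn_hom hu) (bsgn_hom hv) !ksignE oddzD sgD.
by rewrite -scalerAl -scalerAr scalerA.
Qed.

Lemma wdeg_lett i x : gdeg i x -> wdeg word i (lett x).
Proof.
move=> hx; apply: lspan_gen; exists [:: i]; last by exists [:: x].
by rewrite sumz_cons sumz_nil addr0.
Qed.

Lemma wdeg_lettP n x : wdeg word n (lett x) -> gdeg n x.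
Proof.
rewrite -{2}[x]b1_lett; elim=> [|a Y Z [ds <- [w hw ->]] _ IH].
  by rewrite linear0; apply: gdeg0.
rewrite linearP; apply: gdegP IH; rewrite /= b1E.
case: w ds hw => [|y [|? ?]] [|i [|? ?]] //=; try by move=> *; apply: gdeg0.
  by case=> hy _; rewrite sumz_cons sumz_nil addr0.
by case.
Qed.

Lemma bsgnb_lett b c x : gpar c x -> bsgnb b (lett x) = sg k (b && c) *: lett x.
Proof.
move=> hx; case: b; rewrite /= ?scale1r //.
by rewrite bsgn_lett (sgn_gpar hx) linearZ.
Qed.
Lemma bsgnb1 b : bsgnb b 1 = 1. Proof. by case: b; rewrite //= bsgn1. Qed.

(** The mixed terms are symmetric in x and y up to the sign of their
    exchange. *)
Lemma com_lett2 b c x y : gpar b x -> gpar c y ->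
  com (lett x * lett y) = tp (lett x * lett y) 1 + tp 1 (lett x * lett y)
    + (tp (lett x) (lett y) + sg k (b && c) *: tp (lett y) (lett x)).
Proof.
move=> hx hy; rewrite (com_lettM _ hx) com_lett !linearD /= !tpmapE /=.
rewrite !mulr1 bsgnb1 (bsgnb_lett b hy) tpZl -!addrA; congr (_ + _).
by rewrite addrA addrC addrA.
Qed.

Lemma bracket_letter b c x y : gpar b x -> gpar c y ->
  exists z, lett x * lett y - sg k (b && c) *: (lett y * lett x) = lett z.
Proof.
move=> hx hy; exists (b1 (lett x * lett y - sg k (b && c) *: (lett y * lett x))).
apply: primP; last by rewrite linearB linearZ /= !eps_mul !eps_lett !(mul0r, mulr0, subr0, scaler0).
rewrite /prim linearB [com (_ *: _)]linearZ /= (com_lett2 hx hy) (com_lett2 hy hx).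
rewrite tpDl tpDr tpNl tpNr tpZl tpZr.
rewrite andbC !scalerDr scalerA sgK scale1r !opprD.
rewrite addrACA [X in X + _ = _]addrACA [X in _ + X](_ : _ = 0) ?addr0 //.
by rewrite -opprD [X in _ - X]addrC subrr.
Qed.

Definition dlett x : V := b1 (d (lett x)).

Fact dlett_linear : linear dlett.
Proof. exact: lin_comp (linP b1) (lin_comp (linP d) (linP lett)). Qed.

Lemma dlett_deg i x : gdeg i x -> gdeg (i + 1) (dlett x).
Proof.
move=> hx; apply: wdeg_lettP; rewrite -d_lett.
by have := @d_deg [:: i] [:: x] (conj hx I); rewrite sumz_cons sumz_nil addr0.
Qed.

Lemma gpar_dlett b x : gpar b x -> gpar (~~ b) (dlett x).
Proof.
move=> hx; have := @par_shift k V V (mklin dlett_linear) 1 (~~ b) x dlett_deg.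
by rewrite /gpar /= => ->; rewrite addbT negbK hx.
Qed.

Lemma dd_lett x : d (lett (dlett x)) = 0.
Proof. by rewrite -d_lett d_sq. Qed.

Lemma square_letter x : gpar true x -> exists z, lett x * lett x = lett z.
Proof.
move=> hx; exists (b1 (lett x * lett x)); apply: primP.
  by rewrite /prim (com_lett2 hx hx) /sg /= expr1 scaleN1r subrr addr0.
by rewrite eps_mul eps_lett mul0r.
Qed.

(** With u = d y, the element y u is not a letter, but subtracting the
    boundary of the word y|y cancels its part that is not primitive. The result
    has the same boundary u u as y u. *)
Lemma boundary_square y : gpar false y ->
  exists z, lett (dlett y) * lett (dlett y) = lett (dlett z).
Proof.
move=> hy; have hu := gpar_dlett hy; set u := dlett y in hu *.
have ey : d (lett y) = lett u by exact: d_lett.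
pose A := app y (lett y); pose X := lett y * lett u - d A.
have com_A : com A = tp A 1 + (tp (lett y) (lett y) + tp 1 A).
  by rewrite /A com_app com_lett linearD !tpmapE /= app1.
have X_prim : X = lett (b1 X).
  apply: primP; last by rewrite /X linearB eps_d eps_mul eps_lett mul0r subr0.
  have ty : bsgn (lett y) = lett y by rewrite bsgn_lett (sgn_gpar hy) scale1r.
  have com_dA : com (d A) = tp (d A) 1 + tp 1 (d A)
      + (tp (lett y) (lett u) + tp (lett u) (lett y)).
    rewrite com_d_all com_A !linearD !tpmapE ey ty d1 bsgn1 tp0l tp0r addr0 add0r.
    by rewrite [X in _ + X = _]addrC addrACA; congr (_ + _); exact: addrC.
  rewrite /prim /X linearB com_dA (com_lett2 hy hu) /sg expr0 scale1r.
  by rewrite !(tpDl, tpDr) tpNl tpNr opprD addrACA subrr addr0 opprD addrACA.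
exists (b1 X); rewrite -[lett (dlett (b1 X))]d_lett -X_prim /X linearB d_sq subr0 (d_lettM _ hy) ey.
by rewrite dd_lett mulr0 scaler0 addr0.
Qed.

Section EvenPowers.
Variables (u : V) (u_even : gpar false u).
Local Notation W n := (lett u ^+ n).

(** An even letter is primitive, so its powers satisfy the binomial
    formula. *)
Lemma com_pow n : com (W n) = \sum_(i < n.+1) tp (W (n - i)%N) (W i) *+ 'C(n, i).
Proof.
elim: n => [|n IH]; first by rewrite big_ord1 !expr0 -word_nil comE big_nat1.
rewrite exprS (com_lettM _ u_even) IH !linear_sum -big_split /= -(bin_pascal (fun i j : nat => tp (W i) (W j))).
by apply: eq_bigr => i _; rewrite !linearMn !tpmapE /= mulrnDl !exprS.
Qed.

Lemma bsgn_pow n : bsgn (W n) = W n.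
Proof.
elim: n => [|n IH]; first by rewrite expr0 bsgn1.
by rewrite !exprS bsgnM IH bsgn_lett (sgn_gpar u_even) scale1r.
Qed.

Lemma eps_pow n : eps (W n.+1) = 0.
Proof. by rewrite exprS eps_mul eps_lett mul0r. Qed.

Variable p : nat.
Hypotheses (p_pr : prime p) (pk0 : p%:R = 0 :> k).

Lemma mulrn_bin_prime (P : lmodType k) (x : P) i : (0 < i < p)%N -> x *+ 'C(p, i) = 0.
Proof. by move=> /(bin_prime_eq0 p_pr pk0) e; rewrite -scaler_nat e scale0r. Qed.

Lemma bin_prime_sum (P : lmodType k) (f : nat -> P) :
  \sum_(i < p.+1) f i *+ 'C(p, i) = f 0%N + f p.
Proof.
rewrite -(big_mkord xpredT (fun i => f i *+ 'C(p, i))) big_ltn // big_nat_recr ?prime_gt0 //=.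
rewrite big_nat_cond big1 ?add0r ?bin0 ?binn // => i.
by rewrite andbT => h; apply: mulrn_bin_prime.
Qed.

(** The binomial coefficients of p other than the two extreme ones vanish, so the p-th power of an even
    letter is primitive. *)
Lemma pow_letter : exists z, W p = lett z.
Proof.
exists (b1 (W p)); apply: primP; last by rewrite -(prednK (prime_gt0 p_pr)) eps_pow.
rewrite /prim com_pow (bin_prime_sum (fun i => tp (W (p - i)%N) (W i))).
by rewrite subn0 subnn expr0.
Qed.
End EvenPowers.

Section BoundaryPowers.
Variables (y : V) (y_odd : gpar true y).
Let u := dlett y.
Let u_even : gpar false u := gpar_dlett y_odd.
Local Notation W n := (lett u ^+ n).
Local Notation Y n := (lett y * lett u ^+ n).

Lemma com_Y n : com (Y n) =
  \sum_(i < n.+1) (tp (Y (n - i)%N) (W i) + tp (W (n - i)%N) (Y i)) *+ 'C(n, i).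
Proof.
rewrite (com_lettM _ y_odd) (com_pow u_even) !linear_sum -big_split /=.
by apply: eq_bigr => i _; rewrite !linearMn !tpmapE mulrnDl /= (bsgn_pow u_even).
Qed.

Lemma bsgn_Y n : bsgn (Y n) = - Y n.
Proof.
by rewrite bsgnM (bsgn_pow u_even) bsgn_lett (sgn_gpar y_odd) scaleN1r linearN mulNr.
Qed.

Lemma d_W n : d (W n) = 0.
Proof.
elim: n => [|n IH]; first by rewrite expr0 d1.
by rewrite exprS (d_lettM _ u_even) IH dd_lett mul0r mulr0 scaler0 addr0.
Qed.

Lemma d_Y n : d (Y n) = W n.+1.
Proof. by rewrite (d_lettM _ y_odd) d_W mulr0 scaler0 addr0 d_lett exprS. Qed.

(* The boundary of A n corrects Y n, and Z (n + 1) will be the result; the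
   index j runs over the last letters. *)
Let A (g : nat -> V) n := \sum_(j < n.+1) app (g j) (Y (n - j)%N) *+ 'C(n, j).
Let Z (g : nat -> V) n := \sum_(j < n.+1) app (g j) (W (n - j)%N) *+ 'C(n, j).

Lemma eq_A (g h : nat -> V) n : (forall j, (j <= n)%N -> g j = h j) -> A g n = A h n.
Proof.
by move=> e; apply: eq_bigr => j _; rewrite e // -ltnS.
Qed.

(** The letters g_1, g_2, ... are defined by a recursion in which g_(m+1)
    depends on all the preceding ones; [gseq n] contains the first n of them. Each
    is chosen so that the one-letter component of both sides of
    [boundary_power_step] agrees. *)
Fixpoint gseq n : nat -> V :=
  if n is m.+1 then
    fun j => if j == m.+1 then b1 (Y m + d (A (gseq m) m)) else gseq m j
  else fun _ => 0.

Lemma gseq_le n j : (j <= n)%N -> gseq n j = gseq j j.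
Proof.
elim: n => [|n IH]; first by rewrite leqn0 => /eqP ->.
rewrite leq_eqVlt => /predU1P[-> //|lt_jn]; rewrite /= ltn_eqF //; exact: IH.
Qed.

Let g j := gseq j j.

Lemma g0 : g 0 = 0. Proof. by []. Qed.

Lemma gS m : g m.+1 = b1 (Y m + d (A g m)).
Proof.
by rewrite /g /= eqxx; congr (b1 (_ + d _)); apply: eq_A => j; apply: gseq_le.
Qed.

Lemma com_A n : com (A g n) = tp (A g n) 1 + \sum_(j < n.+1) \sum_(l < (n - j).+1)
  (tp (Y (n - j - l)%N) (app (g j) (W l)) + tp (W (n - j - l)%N) (app (g j) (Y l)))
    *+ ('C(n, j) * 'C(n - j, l)).
Proof.
rewrite {2}/A tp_suml linear_sum -big_split /=.
apply: eq_bigr => j _; rewrite linearMn com_app com_Y mulrnDl /=; congr (_ + _).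
  by rewrite tpMnl.
rewrite linear_sum -sumrMnl; apply: eq_bigr => l _.
by rewrite linearMn linearD !tpmapE mulnC mulrnA.
Qed.

Lemma tlast_dA n : tlast (tpmap d idfun (com (A g n))) =
  \sum_(j < n.+1) app (g j) (W (n - j).+1) *+ 'C(n, j).
Proof.
rewrite /A !linear_sum; apply: eq_bigr => j _; rewrite !linearMn com_app !linearD.
rewrite tpmapE tlast1 add0r; congr (_ *+ _).
have -> : tpmap d idfun (tpmap idfun (app (g j)) (com (Y (n - j)%N))) =
          tpmap d (app (g j)) (com (Y (n - j)%N)).
  by rewrite com_Y !linear_sum; apply: eq_bigr => l _; rewrite !linearMn !linearD !tpmapE.
by rewrite (tlast_map_app _ _ (@b1_app _)) d_Y.
Qed.

Lemma tlast_tdA n : tlast (tpmap bsgn d (com (A g n))) =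
  \sum_(m < n.+1) (app (b1 (d (A g m))) (W (n - m)%N)
                    - app (b1 (d (Z g m))) (Y (n - m)%N)) *+ 'C(n, m).
Proof.
pose H j l : B := (app (b1 (d (app (g j) (Y l)))) (W (n - j - l)%N)
   - app (b1 (d (app (g j) (W l)))) (Y (n - j - l)%N)) *+ ('C(n, j) * 'C(n - j, l)).
transitivity (\sum_(j < n.+1) \sum_(l < (n - j).+1) H j l).
  rewrite com_A !linearD tpmapE d1 tp0r linear0 add0r !linear_sum.
  apply: eq_bigr => j _; rewrite !linear_sum; apply: eq_bigr => l _.
  rewrite !linearMn !linearD !tpmapE !tlastE bsgn_Y (bsgn_pow u_even) linearN addrC.
  by [].
rewrite (bin_triangle H); apply: eq_bigr => m _.
rewrite /A /Z !linear_sum /= !app_sum -sumrB -sumrMnl; apply: eq_bigr => j _.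
have jm : (j <= m <= n)%N by have := ltn_ord j; have := ltn_ord m; lia.
have e : (n - j - (m - j) = n - m)%N by lia.
rewrite /H (bin_trinomial jm) e !linearMn !appMn /=.
by rewrite -mulrnBl -mulrnA mulnC.
Qed.

(** Both sides are killed by the counit, so by [tlast_com] they are determined
    by the last letters in their coproducts. These consist of the contributions of
    Y n, of d applied to the left factors and of d applied to the right factors;
    the last are known by induction ([tlast_tdA]), and Pascal's rule collects them
    into the binomial coefficients of n + 1. *)
Lemma boundary_power_step n : Y n + d (A g n) = Z g n.+1.
Proof.
elim/ltn_ind: n => n IH.
(* By induction Z g m is Y (m - 1) plus a boundary, so its boundary is W m;
   for m = 0 both sides vanish. *)
have bZ m : (m <= n)%N -> b1 (d (Z g m)) = b1 (W m).
  case: m => [|m] mn; last by rewrite -IH // linearD d_sq addr0 d_Y.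
  by rewrite /Z big_ord1 g0 app0 mul0rn expr0 b1_1 !linear0.
have e0 : eps (Y n + d (A g n)) = 0.
  by rewrite linearD eps_d eps_mul eps_lett mul0r addr0.
have := tlast_com (Y n + d (A g n)); rewrite e0 scale0r subr0 => <-.
rewrite linearD com_d_all !linearD tlast_dA tlast_tdA com_Y linear_sum.
rewrite -!big_split /= /Z -(bin_pascal (fun i j => app (g j) (W i))).
apply: eq_bigr => j _; rewrite linearMn linearD !tlastE bZ -1?ltnS //.
rewrite -!lettE -!mulrnDl gS linearD appD; congr (_ *+ _).
by rewrite addrC -addrA [X in _ + X]addrA subrK [X in _ + X]addrC.
Qed.

Variable p : nat.
Hypotheses (p_pr : prime p) (pk0 : p%:R = 0 :> k).

(** For n + 1 = p the sum in [boundary_power_step] reduces to the letter g_p;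
    its boundary is that of y u^(p-1), which is u^p. *)
Lemma boundary_power : exists z, lett (dlett y) ^+ p = lett (dlett z).
Proof.
exists (g p); rewrite -[lett (dlett (g p))]d_lett.
have := boundary_power_step p.-1; rewrite (prednK (prime_gt0 p_pr)) /Z.
rewrite (bin_prime_sum p_pr pk0 (fun j => app (g j) (W (p - j)%N))).
rewrite g0 app0 add0r subnn expr0 app1 => <-.
by rewrite linearD d_sq addr0 d_Y (prednK (prime_gt0 p_pr)).
Qed.
End BoundaryPowers.

Lemma bsgnK X : bsgn (bsgn X) = X.
Proof.
have hl := lin_comp (linP bsgn) (linP bsgn).
apply: (word_ext (f := mklin hl) (g := idfun)) => ds w hw /=.
by rewrite (bsgn_hom hw) linearZ /= (bsgn_hom hw) scalerA ksignE sgK scale1r.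
Qed.

Lemma d_mul_all X Y : d (X * Y) = d X * Y + bsgn X * d Y.
Proof.
have hl : linear (fun X => d (X * Y)).
  by move=> a X1 X2; rewrite mulrDl -scalerAl linearP.
have hr : linear (fun X => d X * Y + bsgn X * d Y).
  move=> a X1 X2; rewrite !linearP !mulrDl -!scalerAl addrACA -scalerDr.
  by [].
apply: (word_ext (f := mklin hl) (g := mklin hr)) => ds w hw /=.
by rewrite (d_mul Y hw) (bsgn_hom hw) scalerAl.
Qed.

Lemma d_bsgn X : d (bsgn X) = - bsgn (d X).
Proof.
have hl := lin_comp (linP d) (linP bsgn).
have hr : linear (fun X => - bsgn (d X)).
  by move=> a X1 X2; rewrite !linearP.
apply: (word_ext (f := mklin hl) (g := mklin hr)) => ds w hw /=.
rewrite (bsgn_hom hw) (linZ d) (bsgn_wdeg (d_deg hw)) -scaleNr !ksignE oddzD addbT.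
by congr (_ *: _); rewrite /sg; case: oddz; rewrite ?expr1 ?expr0 ?opprK.
Qed.

Lemma wdeg_exp n m X : wdeg word n X -> wdeg word (n *+ m) (X ^+ m).
Proof.
move=> hX; elim: m => [|m IH]; last by rewrite exprS mulrS; apply: wdeg_mul.
by rewrite expr0 mulr0n -word_nil -sumz_nil; apply: lspan_gen; exists [::] => //; exists [::].
Qed.

Variable dM : {linear M -> M}.
Hypotheses (dM_deg : forall i (x : M), gdeg i x -> gdeg (i + 1) (dM x))
  (dM_E : forall x : V, dM x = dlett x).

(** The letters of B satisfy the hypotheses of [primitives_rgrlie]; the values
    of the operations are read off as one-letter components. *)
Theorem bar_rgrlie p : prime p -> p%:R = 0 :> k ->
  exists R : rgrlie p (susp (gcohom dM_deg)),
  [/\ forall i j x y, gdeg i x -> gdeg j y -> dM x = 0 -> dM y = 0 ->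
        is_class (d := dM)
          (b1 (word [:: x] * word [:: y] - ksign k (i * j) *: (word [:: y] * word [:: x])))
          (lbr R (cls dM x) (cls dM y)),
      forall i x, oddz i -> gdeg i x -> dM x = 0 ->
        is_class (d := dM) (b1 (word [:: x] * word [:: x])) (lsq R (cls dM x)) &
      forall i x, ~~ oddz i -> gdeg i x -> dM x = 0 ->
        word [:: x] ^+ p = word [:: b1 (word [:: x] ^+ p)] /\
        is_class (d := dM) (b1 (word [:: x] ^+ p)) (lpow R (cls dM x))].
Proof.
move=> p_pr pk0.
suff [R [Rbr Rsq Rpw]] : exists R : rgrlie p (susp (gcohom dM_deg)),
  [/\ forall i j x y z, gdeg i x -> gdeg j y -> dM x = 0 -> dM y = 0 ->
        lett x * lett y - ksign k (i * j) *: (lett y * lett x) = lett z ->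
        is_class (d := dM) z (lbr R (cls dM x) (cls dM y)),
      forall i x z, oddz i -> gdeg i x -> dM x = 0 -> lett x * lett x = lett z ->
        is_class (d := dM) z (lsq R (cls dM x)) &
      forall i x z, ~~ oddz i -> gdeg i x -> dM x = 0 -> lett x ^+ p = lett z ->
        is_class (d := dM) z (lpow R (cls dM x))].
  exists R; split=> [i j x y gx gy dx dy|i x oi gx dx|i x oi gx dx].
  - have [z ez] := bracket_letter (gpar_hom gx) (gpar_hom gy).
    rewrite -oddzM -ksignE in ez; rewrite -!lettE ez b1_lett; exact: Rbr gx gy dx dy ez.
  - have hx := gpar_hom gx; rewrite oi in hx; have [z ez] := square_letter hx.
    rewrite -!lettE ez b1_lett; exact: Rsq oi gx dx ez.
  - have hx := gpar_hom gx; rewrite (negbTE oi) in hx.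
    have [z ez] := pow_letter hx p_pr pk0.
    rewrite -!lettE ez b1_lett; split=> //; exact: Rpw oi gx dx ez.
apply: (@primitives_rgrlie k p p_pr pk0 M dM dM_deg _ B lett bsgn d (wdeg word)).
- by move=> x; rewrite !dM_E {1}/dlett dd_lett linear0.
- by move=> x y e; rewrite -[x]b1_lett e b1_lett.
- exact: bsgnM.
- exact: bsgn_lett.
- exact: bsgnK.
- exact: d_mul_all.
- exact: d_bsgn.
- by move=> x; rewrite dM_E -d_lett.
- exact: bracket_letter.
- exact: square_letter.
- by move=> x hx; apply: pow_letter.
- by move=> y hy; have [z e] := boundary_square hy; exists z; rewrite !dM_E.
- by move=> y hy; have [z e] := boundary_power hy p_pr pk0; exists z; rewrite !dM_E.
- by move=> n a X Y hX hY; apply: lspanD => //; apply: lspanZ.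
- exact: wdeg_mul.
- exact: wdeg_exp.
- exact: wdeg_lett.
- exact: wdeg_lettP.
Qed.
End BarModel.

(** * The restricted Lie algebra of a B-infinity-algebra *)

Section HomogeneousWords.
Variables (k : comNzRingType) (M : grmod k).

(** Every letter is a sum of homogeneous ones, so a multilinear function of
    words takes values in the additive closure of its values on homogeneous
    words. *)
Lemma word_hspan (P : lmodType k) (f : seq M -> P) (S : P -> Prop) :
  wmultilin f -> S 0 -> (forall x y, S x -> S y -> S (x + y)) ->
  (forall ds (w : seq M), whom ds w -> S (f w)) -> forall w, S (f w).
Proof.
move=> f_multi S0 SD Sh w.
suff H u ds : whom ds u -> S (f (u ++ w)) by exact: (H [::] [::] I).
elim: w u ds => [|x w IH] u ds hu; first by rewrite cats0; apply: Sh hu.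
elim/hom_ind: x => [|x y hx hy|i x hx].
- by rewrite wmulti0.
- by rewrite wmultiD //; apply: SD.
- by rewrite -cat_rcons -cats1; apply: (IH _ (ds ++ [:: i])); apply: whom_cat.
Qed.

Lemma bar_hext (P : lmodType k) (f g : {linear bar M -> P}) :
  (forall ds w, whom ds w -> f (bword w) = g (bword w)) -> forall X, f X = g X.
Proof.
move=> e X; apply: (lspan_ext _ (bar_span X)) => _ [w ->].
pose h w := f (bword w) - g (bword w).
have hm : wmultilin h.
  by move=> u a x y v; rewrite /h bword_multilin (linP f) (linP g) scalerBr opprD addrACA.
apply/eqP; rewrite -subr_eq0; apply/eqP; move: w; apply: (@word_hspan _ h (fun x => x = 0) hm).
- by [].
- by move=> x y -> ->; rewrite addr0.
- by move=> ds w /e; rewrite /h => ->; rewrite subrr.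
Qed.
End HomogeneousWords.

Section BarAlgebra.
Variables (k : comNzRingType) (C : binf k).

Definition balg := bar (susp C).
HB.instance Definition _ := GRing.Lmodule.on balg.
Implicit Types X Y Z : balg.
Implicit Types x y : susp C.

Let one : balg := bword [::].
Let mul X Y : balg := bmul X Y.

Fact balg_mulA : associative mul.
Proof. intros X Y Z; exact (esym (bprodA (bstr C) X Y Z)). Qed.
Fact balg_mul1 : left_id one mul.
Proof. intro X; exact (bprod1l (bstr C) X). Qed.
Fact balg_mulr1 : right_id one mul.
Proof. intro X; exact (bprod1r (bstr C) X). Qed.
Fact balg_mull_linear Z : linear (mul^~ Z).
Proof. exact (lin_comp (linP (bprod (bstr C))) (@tprod_linl k _ _ Z)). Qed.
Fact balg_mulr_linear Z : linear (mul Z).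
Proof. exact (lin_comp (linP (bprod (bstr C))) (@tprod_linr k _ _ Z)). Qed.
Fact balg_mulDl : left_distributive mul +%R.
Proof. intros X Y Z; exact (linD (mklin (balg_mull_linear Z)) X Y). Qed.
Fact balg_mulDr : right_distributive mul +%R.
Proof. intros X Y Z; exact (linD (mklin (balg_mulr_linear X)) Y Z). Qed.
Fact balg_one_neq0 : one != 0.
Proof.
apply/eqP => e; have := bcounitE ([::] : seq (susp C)).
have E : @bcounit k (susp C) 0 = 0 := lin0 (@bcounit k (susp C)).
rewrite -/one e E => /esym/eqP; rewrite oner_eq0; apply: notF.
Qed.
HB.instance Definition _ := GRing.Zmodule_isNzRing.Build balg
  balg_mulA balg_mul1 balg_mulr1 balg_mulDl balg_mulDr balg_one_neq0.

Fact balg_scalerAl a X Y : a *: (X * Y) = a *: X * Y.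
Proof. exact (esym (linZ (mklin (balg_mull_linear Y)) a X)). Qed.
Fact balg_scalerAr a X Y : a *: (X * Y) = X * (a *: Y).
Proof. exact (esym (linZ (mklin (balg_mulr_linear X)) a Y)). Qed.
HB.instance Definition _ := GRing.Lmodule_isLalgebra.Build k balg balg_scalerAl.
HB.instance Definition _ := GRing.Lalgebra_isAlgebra.Build k balg balg_scalerAr.

End BarAlgebra.

Section BinfRestrictedLie.
Variables (k : comNzRingType) (C : binf k).
Local Notation V := (susp C).
Let B : algType k := balg C.
Let T : lmodType k := tens (bar V) (bar V).
Let word : seq V -> B := @bword k V.
Let tp : B -> B -> T := @tprod k (bar V) (bar V).
Let com : {linear B -> T} := @mklin k B T (@bcomul k V) (linP (@bcomul k V)).
Let b1 : {linear B -> V} := @mklin k B V (@bar1 k V) (linP (@bar1 k V)).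
Let eps : {linear B -> k^o} := @mklin k B k^o (@bcounit k V) (linP (@bcounit k V)).
Let d : {linear B -> B} := @mklin k B B (bd C) (linP (bd C)).
Let dM : {linear C -> C} := @bd1 k C.

Lemma word_ext_balg (P : lmodType k) (f g : {linear B -> P}) :
  (forall ds w, whom ds w -> f (word w) = g (word w)) -> forall X, f X = g X.
Proof.
exact (fun e => @bar_hext k V P (@mklin k (bar V) P f (linP f)) (@mklin k (bar V) P g (linP g)) e).
Qed.

Lemma word_lift_balg (P : lmodType k) (f : seq V -> P) : wmultilin f ->
  {h : {linear B -> P} | forall w, h (word w) = f w}.
Proof.
intro fm; exists (@mklin k B P (blift fm) (linP (blift fm))).
exact (bliftE fm).
Qed.

Lemma tp_lift_balg (P : lmodType k) (f : B -> B -> P) :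
  (forall Y, linear (f^~ Y)) -> (forall X, linear (f X)) ->
  {h : {linear T -> P} | forall X Y, h (tp X Y) = f X Y}.
Proof.
intros hl hr; exists (@tlift k (bar V) (bar V) P f hl hr).
exact (@tliftE k (bar V) (bar V) P f hl hr).
Qed.

Lemma com_balg w : com (word w) =
  \sum_(0 <= i < (size w).+1) tp (word (take i w)) (word (drop i w)).
Proof. exact (@bcomulE k V w). Qed.

Lemma eps_d_balg X : eps (d X) = 0.
Proof. exact (bcounit_diff (bstr C) X). Qed.

Lemma deg_mul_balg ds es (u v : seq V) : whom ds u -> whom es v ->
  wdeg word (sumz ds + sumz es) (word u * word v).
Proof. exact (@bprod_deg k C (bstr C) ds es u v). Qed.

Lemma d_deg_balg ds (u : seq V) : whom ds u -> wdeg word (sumz ds + 1) (d (word u)).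
Proof. exact (@bdiff_deg k C (bstr C) ds u). Qed.

Let binf_rgrlie_raw p : prime p -> p%:R = 0 :> k ->
  exists R : rgrlie p (susp (homology C)),
  [/\ forall i j (x y : V), gdeg i x -> gdeg j y -> dM x = 0 -> dM y = 0 ->
        is_class (d := dM)
          (b1 (word [:: x] * word [:: y] - ksign k (i * j) *: (word [:: y] * word [:: x])))
          (lbr R (cls dM x) (cls dM y)),
      forall i (x : V), oddz i -> gdeg i x -> dM x = 0 ->
        is_class (d := dM) (b1 (word [:: x] * word [:: x])) (lsq R (cls dM x)) &
      forall i (x : V), ~~ oddz i -> gdeg i x -> dM x = 0 ->
        word [:: x] ^+ p = word [:: b1 (word [:: x] ^+ p)] /\
        is_class (d := dM) (b1 (word [:: x] ^+ p)) (lpow R (cls dM x))].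
Proof.
refine (@bar_rgrlie k C B T word tp com b1 eps d
  (@bword_multilin k V) word_ext_balg word_lift_balg
  (@tprod_linl k (bar V) (bar V)) (@tprod_linr k (bar V) (bar V)) tp_lift_balg
  com_balg (@bar1E k V) (@bcounitE k V) erefl
  (bcounit_prod (bstr C)) (@bcomul_prod k C (bstr C)) eps_d_balg
  (bdiff_sq (bstr C)) (@bdiff_prod k C (bstr C)) (@bcomul_diff k C (bstr C))
  deg_mul_balg d_deg_balg dM (@bd1_deg k C) _ p).
by [].
Qed.

Lemma b1_bracket (a : k) (x y : V) :
  b1 (word [:: x] * word [:: y] - a *: (word [:: y] * word [:: x])) =
  circ x y - a *: circ y x.
Proof.
exact (etrans (linB b1 _ _) (congr1 (fun t => b1 (word [:: x] * word [:: y]) - t)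
  (linZ b1 a (word [:: y] * word [:: x])))).
Qed.

Lemma bpow_balg (X : B) n : bpow X n = X ^+ n.
Proof.
elim: n => [|n IH]; first by rewrite expr0.
rewrite exprSr -IH; exact: erefl.
Qed.

Lemma hclassP (x : V) h : hclass x h -> dM x = 0 /\ h = cls dM x.
Proof. exact (@is_classP k C dM x h). Qed.

(** Only meaningful when the power is a word with one letter. *)
Definition ppow p (x : V) : V := bar1 (bpow (bword [:: x]) p).

Theorem binf_rgrlie p : prime p -> p%:R = 0 :> k ->
  exists R : rgrlie p (susp (homology C)),
  [/\ forall i j (x y : V) hx hy, gdeg i x -> gdeg j y -> hclass x hx -> hclass y hy ->
        hclass (circ x y - ksign k (i * j) *: circ y x) (lbr R hx hy),
      forall i (x : V) hx, oddz i -> gdeg i x -> hclass x hx ->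
        hclass (circ x x) (lsq R hx) &
      forall i (x : V) hx, ~~ oddz i -> gdeg i x -> hclass x hx ->
        bpow (bword [:: x]) p = bword [:: ppow p x] /\ hclass (ppow p x) (lpow R hx)].
Proof.
move=> p_pr pk0; have [R [Rbr Rsq Rpw]] := binf_rgrlie_raw p_pr pk0.
exists R; split.
- move=> i j x y hx hy gx gy /hclassP[dx ->] /hclassP[dy ->].
  rewrite -b1_bracket; exact: Rbr gx gy dx dy.
- move=> i x hx oi gx /hclassP[dx ->]; exact: Rsq oi gx dx.
- move=> i x hx oi gx /hclassP[dx ->]; rewrite /ppow.
  rewrite (bpow_balg (word [:: x]) p); exact: Rpw oi gx dx.
Qed.
End BinfRestrictedLie.

(** * Naturality *)

Section OperationsOnChains.
Variables (k : comNzRingType) (C : binf k).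
Implicit Types x y : susp C.

Let bar1_mul_linear y : linear (fun X : balg C => bar1 (X * bword [:: y])).
Proof. exact (lin_comp (linP (@bar1 k (susp C))) (balg_mull_linear (bword [:: y]))). Qed.

Lemma circ_linl y : linear (fun x => circ x y).
Proof. exact (lin_comp (bar1_mul_linear y) (@lett_linear k C (balg C) _ (@bword_multilin k (susp C)))). Qed.

Lemma circ_linr x : linear (circ x).
Proof.
exact (lin_comp (lin_comp (linP (@bar1 k (susp C))) (balg_mulr_linear (bword [:: x])))
  (@lett_linear k C (balg C) _ (@bword_multilin k (susp C)))).
Qed.

Lemma circ0l y : circ 0 y = 0. Proof. exact (lin0 (mklin (circ_linl y))). Qed.

Hypothesis bcomp_last : forall (xs : seq (susp C)) y, (1 < size xs)%N -> bcomp xs [:: y] = 0.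

(** Longer words have no one-letter component after multiplication by y, so
    only the one-letter part of X and its constant term contribute. *)
Lemma bar1_mul_letter (X : balg C) y :
  bar1 (X * bword [:: y]) = circ (bar1 X) y + (bcounit X : k) *: y.
Proof.
have hr : linear (fun X : balg C => circ (bar1 X) y + (bcounit X : k) *: y).
  exact (lin_add (lin_comp (circ_linl y) (linP (@bar1 k (susp C))))
     (lin_mul y (linP (@bcounit k (susp C))))).
refine (@bar_ext k (susp C) _ _ _ (bar1_mul_linear y) hr _ X) => w.
case: w => [|x w].
  refine (etrans (congr1 (@bar1 k (susp C)) (bprod1l (bstr C) (bword [:: y]))) _).
  by rewrite !bar1E bcounitE circ0l scale1r add0r.
rewrite bar1E bcounitE scale0r addr0; case: w => [|x' w]; first exact erefl.
rewrite circ0l; exact (@bcomp_last (x :: x' :: w) y isT).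
Qed.

Lemma bcounit_pow x n : bcounit (bpow (bword [:: x]) n.+1 : balg C) = 0 :> k.
Proof.
have e := bcounit_prod (bstr C) (bpow (bword [:: x]) n) (bword [:: x]).
refine (etrans e _); rewrite bcounitE; exact: mulr0.
Qed.

Lemma ppow_circ_pow x n : ppow n.+1 x = circ_pow x n.+1.
Proof.
rewrite /ppow /circ_pow /=; elim: n => [|n IH].
  refine (etrans (congr1 (@bar1 k (susp C)) (bprod1l (bstr C) (bword [:: x]))) _).
  by rewrite bar1E.
refine (etrans (bar1_mul_letter (bpow (bword [:: x]) n.+1) x) _).
by rewrite bcounit_pow scale0r addr0 IH.
Qed.
End OperationsOnChains.

(** A description by cocycle representatives that determines the operations
    on homogeneous classes; [induced_rgrlie] is a consequence of it. *)
Definition induced_by_chains p (k : comNzRingType) (C : binf k)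
    (R : rgrlie p (susp (homology C))) : Prop :=
  [/\ forall i j (x y : susp C) hx hy, gdeg i x -> gdeg j y -> hclass x hx -> hclass y hy ->
        hclass (circ x y - ksign k (i * j) *: circ y x) (lbr R hx hy),
      forall i (x : susp C) hx, oddz i -> gdeg i x -> hclass x hx ->
        hclass (circ x x) (lsq R hx) &
      forall i (x : susp C) hx, ~~ oddz i -> gdeg i x -> hclass x hx ->
        bpow (bword [:: x]) p = bword [:: ppow p x] /\ hclass (ppow p x) (lpow R hx)].

Lemma induced_rgrlieP p (k : comNzRingType) (C : binf k) (R : rgrlie p (susp (homology C))) :
  prime p -> induced_by_chains R -> induced_rgrlie R.
Proof.
move=> p_pr [Rbr Rsq Rpw]; split=> //.
- move=> i x hx oi gx cx; have [e h] := Rpw i x hx oi gx cx; exists (ppow p x); assumption.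
- move=> e i x hx oi gx cx; have [_ h] := Rpw i x hx oi gx cx.
  have := ppow_circ_pow e x p.-1; rewrite (prednK (prime_gt0 p_pr)) => <-; assumption.
Qed.

Section Naturality.
Variables (p : nat) (k : comNzRingType) (C D : binf k) (f : {linear C -> D}).
Variables (R : rgrlie p (susp (homology C))) (S : rgrlie p (susp (homology D))).
Hypotheses (R_ind : induced_by_chains R) (S_ind : induced_by_chains S).
Hypotheses (f_deg : forall i x, gdeg i x -> gdeg i (f x))
  (f_d : forall x, f (bd1 x) = bd1 (f x))
  (f_circ : forall x y : susp C, f (circ x y) = circ (f x : susp D) (f y : susp D))
  (f_pow : forall i (x : susp C), gdeg i x -> ~~ oddz i -> f (ppow p x) = ppow p (f x : susp D)).
Local Notation HC := (susp (homology C)).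
Local Notation HD := (susp (homology D)).
Let dC : {linear C -> C} := @bd1 k C.
Let dD : {linear D -> D} := @bd1 k D.

Let hrep (h : HC) : C := sval (cid (@cls_surj k C dC h)).
Let d_hrep h : dC (hrep h) = 0. Proof. by rewrite /hrep; case: cid => x []. Qed.
Let cls_hrep h : cls dC (hrep h) = h. Proof. by rewrite /hrep; case: cid => x []. Qed.

(** The choice of a representative is irrelevant because f maps boundaries to
    boundaries. *)
Definition hmap (h : HC) : HD := cls dD (f (hrep h)).

Let f_cycle x : dC x = 0 -> dD (f x) = 0.
Proof. by move=> e; rewrite -[dD _]/(bd1 (f x)) -f_d -[bd1 x]/(dC x) e linear0. Qed.

Lemma hmap_cls x : dC x = 0 -> hmap (cls dC x) = cls dD (f x).
Proof.
move=> dx; have [w e] := cls_eq (d_hrep (cls dC x)) dx (cls_hrep (cls dC x)).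
have ddw : dC (dC w) = 0.
  have := d_hrep (cls dC x); rewrite e (linD dC) dx add0r; exact.
have fe : f (dC w) = dD (f w) by exact (f_d w).
have fdw : dD (dD (f w)) = 0 by rewrite -fe; apply: f_cycle.
rewrite /hmap e (linD f) fe.
refine (etrans (clsD (f_cycle dx) fdw) _).
rewrite cls_bnd; exact: addr0.
Qed.

Lemma hmap_linear : linear hmap.
Proof.
move=> a h1 h2; have d1 := d_hrep h1; have d2 := d_hrep h2.
have dl : dC (a *: hrep h1 + hrep h2) = 0 by rewrite (linP dC) d1 d2 scaler0 addr0.
rewrite -{1}(cls_hrep h1) -{1}(cls_hrep h2).
rewrite -[X in hmap X](cls_linear a d1 d2) (hmap_cls dl) (linP f).
exact (cls_linear a (f_cycle d1) (f_cycle d2)).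
Qed.

Lemma hmap_class (x : susp C) (h : HC) : hclass x h -> hclass (f x : susp D) (hmap h).
Proof.
move=> /hclassP[dx ->]; have := hmap_cls dx => /= ->.
exact (cls_class (f_cycle dx)).
Qed.

Lemma class_unique (E : binf k) (x : susp E) (h h' : susp (homology E)) :
  hclass x h -> hclass x h' -> h = h'.
Proof. by move=> /hclassP[_ ->] /hclassP[_ ->]. Qed.

Lemma hmap_deg i (h : HC) : gdeg i h -> gdeg i (hmap h).
Proof.
move=> [x gx cx]; exists (f x); first exact: f_deg gx.
exact: (hmap_class cx).
Qed.

Lemma hmap_lbr_hom i j (h h' : HC) : gdeg i h -> gdeg j h' ->
  hmap (lbr R h h') = lbr S (hmap h) (hmap h').
Proof.
move=> [x gx cx] [y gy cy]; have [Rbr _ _] := R_ind; have [Sbr _ _] := S_ind.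
have c1 := hmap_class (Rbr i j x y h h' gx gy cx cy).
have c2 := Sbr i j _ _ _ _ (f_deg gx) (f_deg gy) (hmap_class cx) (hmap_class cy).
have e : f (circ x y - ksign k (i * j) *: circ y x) =
    circ (f x : susp D) (f y : susp D) - ksign k (i * j) *: circ (f y : susp D) (f x : susp D).
  refine (etrans (linB f _ _) (congr2 (fun u v : D => u - v) (f_circ x y) _)).
  exact (etrans (linZ f _ _) (congr1 (fun u : D => _ *: u) (f_circ y x))).
exact (class_unique (eq_ind _ (fun t => @hclass k D t _) c1 _ e) c2).
Qed.

(** The operations on classes are computed on representatives by o, the
    differential and p-th powers, which f preserves. *)
Theorem hmap_rlie_hom : exists2 h : {linear HC -> HD},
  forall (x : susp C) hx, hclass x hx -> hclass (f x : susp D) (h hx) & rlie_hom R S h.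
Proof.
exists (mklin hmap_linear); first exact: hmap_class.
split=> /=.
- exact: hmap_deg.
- move=> x y; move: x; apply: (@hom_ind k HC (fun x => hmap (lbr R x y) = lbr S (hmap x) (hmap y))) => [|x x' ex ex'|i x gx].
  + have e0 := lin0 (mklin (@lbr_linl _ _ R y)); rewrite /= in e0.
    have e1 := lin0 (mklin (@lbr_linl _ _ S (hmap y))); rewrite /= in e1.
    have e2 := lin0 (mklin hmap_linear); rewrite /= in e2.
    by rewrite e0 e2 e1.
  + have e0 := linD (mklin (@lbr_linl _ _ R y)) x x'; rewrite /= in e0.
    have e1 := linD (mklin (@lbr_linl _ _ S (hmap y))) (hmap x) (hmap x'); rewrite /= in e1.
    have e2 := linD (mklin hmap_linear); rewrite /= in e2.
    by rewrite e0 !e2 e1 ex ex'.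
  move: y; apply: (@hom_ind k HC (fun y => hmap (lbr R x y) = lbr S (hmap x) (hmap y))) => [|y y' ey ey'|j y gy].
  + have e0 := lin0 (mklin (@lbr_linr _ _ R x)); rewrite /= in e0.
    have e1 := lin0 (mklin (@lbr_linr _ _ S (hmap x))); rewrite /= in e1.
    have e2 := lin0 (mklin hmap_linear); rewrite /= in e2.
    by rewrite e0 e2 e1.
  + have e0 := linD (mklin (@lbr_linr _ _ R x)) y y'; rewrite /= in e0.
    have e1 := linD (mklin (@lbr_linr _ _ S (hmap x))) (hmap y) (hmap y'); rewrite /= in e1.
    have e2 := linD (mklin hmap_linear); rewrite /= in e2.
    by rewrite e0 !e2 e1 ey ey'.
  exact: hmap_lbr_hom gx gy.
- move=> i h oi [x gx cx]; have [_ Rsq _] := R_ind; have [_ Ssq _] := S_ind.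
  have c1 := hmap_class (Rsq i x h oi gx cx).
  have c2 := Ssq i _ _ oi (f_deg gx) (hmap_class cx).
  exact (class_unique (eq_ind _ (fun t => @hclass k D t _) c1 _ (f_circ x x)) c2).
- move=> i h oi [x gx cx]; have [_ _ Rpw] := R_ind; have [_ _ Spw] := S_ind.
  have c1 := hmap_class (proj2 (Rpw i x h oi gx cx)).
  have c2 := proj2 (Spw i _ _ oi (f_deg gx) (hmap_class cx)).
  exact (class_unique (eq_ind _ (fun t => @hclass k D t _) c1 _ (f_pow gx oi)) c2).
Qed.
End Naturality.

Section BinfMaps.
Variables (k : comNzRingType) (C D : binf k) (f : binf_map C D).
Let F : {linear susp C -> susp D} := bfun f.
Let bF : bar (susp C) -> bar (susp D) := bmap F.

Lemma bar1_bmap X : bar1 (bF X) = F (bar1 X).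
Proof.
refine (@bar_ext k (susp C) _ (fun X => bar1 (bF X)) (fun X => F (bar1 X)) _ _ _ X).
- exact (lin_comp (linP (@bar1 k (susp D))) (linP (bmap F))).
- exact (lin_comp (linP F) (linP (@bar1 k (susp C)))).
move=> w; rewrite bar1E /bF bmapE bar1E.
by case: w => [|x [|y w]] /=; rewrite ?linear0.
Qed.

Lemma binf_map_bd1 x : f (bd1 x) = bd1 (f x).
Proof.
refine (etrans (esym (bar1_bmap (bd C (bword [:: x : susp C])))) _).
refine (congr1 (@bar1 k (susp D)) (etrans (bfun_diff f (bword [:: x : susp C])) _)).
exact (congr1 (bd D) (bmapE F [:: x : susp C])).
Qed.

Lemma binf_map_circ (x y : susp C) : f (circ x y) = circ (f x : susp D) (f y : susp D).
Proof.
refine (etrans (esym (bar1_bmap (bmul (bword [:: x]) (bword [:: y])))) _).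
refine (congr1 (@bar1 k (susp D)) (etrans (bfun_mul f (bword [:: x]) (bword [:: y])) _)).
exact (congr2 (@bmul k D) (bmapE F [:: x]) (bmapE F [:: y])).
Qed.

Lemma binf_map_pow X n : bF (bpow X n) = bpow (bF X) n.
Proof.
elim: n => [|n IH]; first exact (bmapE F [::]).
exact (etrans (bfun_mul f (bpow X n) X) (congr1 (fun Y => @bmul k D Y (bF X)) IH)).
Qed.

Lemma binf_map_ppow n (x : susp C) : f (ppow n x) = ppow n (f x : susp D).
Proof.
refine (etrans (esym (bar1_bmap (bpow (bword [:: x]) n))) _).
refine (congr1 (@bar1 k (susp D)) (etrans (binf_map_pow (bword [:: x]) n) _)).
exact (congr1 (fun X => @bpow k D X n) (bmapE F [:: x])).
Qed.
End BinfMaps.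

(** * Insertions of words into paths *)

Section Paths.
Variables (O : Type) (H : O -> O -> Type).

(** Words and strings of morphisms are both treated as paths in a quiver whose
    arrows from a to b form a module; for words there is only one object. *)
Inductive qpath (a : O) : O -> Type :=
| qnil : qpath a a
| qcons b c : H b c -> qpath a b -> qpath a c.

Fixpoint qcat a b c (u : qpath b c) : qpath a b -> qpath a c :=
  match u in qpath _ c0 return qpath a b -> qpath a c0 with
  | qnil => fun v => v
  | qcons _ _ f u' => fun v => qcons f (qcat u' v)
  end.

Fixpoint qsize a b (p : qpath a b) : nat :=
  if p is qcons _ _ _ p' then (qsize p').+1 else 0.

Lemma qsize_cat a b c (u : qpath b c) (v : qpath a b) :
  qsize (qcat u v) = (qsize u + qsize v)%N.
Proof. by elim: u v => //= b' c' f u IH v; rewrite IH. Qed.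

Lemma qcatA a b c d (u : qpath c d) (v : qpath b c) (w : qpath a b) :
  qcat u (qcat v w) = qcat (qcat u v) w.
Proof. by elim: u v => //= b' c' f u IH v; rewrite IH. Qed.

Lemma qcat_nil a b (u : qpath a b) : qcat u (qnil a) = u.
Proof. by elim: u => //= b' c' f u ->. Qed.

Section Splits.
Variable V : nmodType.

Fixpoint gsum a b (p : qpath a b) {struct p} :
    (forall c, qpath c b -> qpath a c -> V) -> V :=
  match p in qpath _ b0 return (forall c, qpath c b0 -> qpath a c -> V) -> V with
  | qnil => fun G => G a (qnil a) (qnil a)
  | qcons b1 c1 f p' => fun G => G c1 (qnil c1) (qcons f p')
                                 + gsum p' (fun c q r => G c (qcons f q) r)
  end.

Lemma gsum_ext a b (p : qpath a b) (G G' : forall c, qpath c b -> qpath a c -> V) :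
  (forall c (q : qpath c b) (r : qpath a c), p = qcat q r -> G c q r = G' c q r) ->
  gsum p G = gsum p G'.
Proof.
elim: p G G' => [|b1 c1 f p IH] G G' e /=; first exact: e.
by rewrite e //; congr (_ + _); apply: IH => c q r E; apply: e; rewrite /= E.
Qed.

Lemma gsumD a b (p : qpath a b) (G G' : forall c, qpath c b -> qpath a c -> V) :
  gsum p (fun c q r => G c q r + G' c q r) = gsum p G + gsum p G'.
Proof.
elim: p G G' => [|b1 c1 f p IH] G G' //=.
by rewrite IH addrACA.
Qed.

Lemma gsum0 a b (p : qpath a b) : gsum p (fun _ _ _ => 0) = 0.
Proof. by elim: p => [|b1 c1 f p IH] //=; rewrite IH addr0. Qed.

(** Coassociativity of deconcatenation. *)
Lemma gsum_assoc a b (p : qpath a b)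
    (F : forall c e, qpath e b -> qpath c e -> qpath a c -> V) :
  gsum p (fun c p1 p2 => gsum p1 (fun e q r => F c e q r p2)) =
  gsum p (fun e q r0 => gsum r0 (fun c r p2 => F c e q r p2)).
Proof.
elim: p F => [|b1 c1 f p IH] F //=.
by rewrite !gsumD -!addrA (IH (fun c e q r p2 => F c e (qcons f q) r p2)).
Qed.

End Splits.

Lemma gsum_sum (V : nmodType) I (s : seq I) a b (p : qpath a b)
    (G : I -> forall c, qpath c b -> qpath a c -> V) :
  gsum p (fun c q r => \sum_(i <- s) G i c q r) = \sum_(i <- s) gsum p (G i).
Proof. by elim: p G => [|b1 c1 f p IH] G //=; rewrite IH big_split. Qed.

Lemma gsum_lin (V W : nmodType) (g : V -> W) : g 0 = 0 -> {morph g : x y / x + y} ->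
  forall a b (p : qpath a b) (G : forall c, qpath c b -> qpath a c -> V),
  g (gsum p G) = gsum p (fun c q r => g (G c q r)).
Proof.
by move=> g0 gD a b; elim=> [|b1 c1 f p IH] G //=; rewrite gD IH.
Qed.

Lemma gsum_closed (V : nmodType) (S : V -> Prop) a b (p : qpath a b)
    (G : forall c, qpath c b -> qpath a c -> V) :
  (forall x y, S x -> S y -> S (x + y)) ->
  (forall c (q : qpath c b) (r : qpath a c), p = qcat q r -> S (G c q r)) -> S (gsum p G).
Proof.
move=> SD; elim: p G => [|b1 c1 f p IH] G e /=; first exact: e.
by apply: SD; [apply: e | apply: IH => c q r E; apply: e; rewrite /= E].
Qed.
End Paths.

Lemma gsum_exchange (V : nmodType) (O O' : Type) (H : O -> O -> Type) (H' : O' -> O' -> Type)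
    a b (p : qpath H a b) a' b' (u : qpath H' a' b')
    (G : forall c, qpath H c b -> qpath H a c -> forall e, qpath H' e b' -> qpath H' a' e -> V) :
  gsum p (fun c q r => gsum u (G c q r)) =
  gsum u (fun e v w => gsum p (fun c q r => G c q r e v w)).
Proof.
by elim: p G => [|b1 c1 f p IH] G //=; rewrite IH gsumD.
Qed.

Lemma gsumZ (k : comNzRingType) (V : lmodType k) (O : Type) (H : O -> O -> Type) t
    a b (p : qpath H a b) (G : forall c, qpath H c b -> qpath H a c -> V) :
  t *: gsum p G = gsum p (fun c q r => t *: G c q r).
Proof. by rewrite (gsum_lin (g := *:%R t)) ?scaler0 // => x y; rewrite scalerDr. Qed.

Section Insertion.
Variable k : comNzRingType.

(** A letter is stored together with a parity, so that the Koszul signs are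
    defined for letters that are not homogeneous. *)
Definition dlet (O : Type) (M : O -> O -> lmodType k) a b : Type := (bool * M a b)%type.

Section Parity.
Variables (O : Type) (M : O -> O -> lmodType k).
Local Notation path := (qpath (dlet M)).

Fixpoint qpar a b (p : path a b) : bool :=
  if p is qcons _ _ f p' then f.1 (+) qpar p' else false.

Lemma qpar_cat a b c (u : path b c) (v : path a b) : qpar (qcat u v) = qpar u (+) qpar v.
Proof. by elim: u v => //= b' c' f u IH v; rewrite IH addbA. Qed.

Definition qmulti (V : lmodType k) a b (K : path a b -> V) : Prop :=
  forall c e (u : path e b) x (v : path a c),
    linear (fun m : M c e => K (qcat u (qcons (x, m) v))).
End Parity.

Section Action.
Variables (O1 : Type) (M1 : O1 -> O1 -> lmodType k).
Variables (O2 : Type) (M2 : O2 -> O2 -> lmodType k).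
Local Notation path1 := (qpath (dlet M1)).
Local Notation path2 := (qpath (dlet M2)).
Variable av : forall a1 b1, dlet M1 a1 b1 -> forall a b, path2 a b -> M2 a b.

Definition act a1 b1 (x : dlet M1 a1 b1) a b (q : path2 a b) : dlet M2 a b :=
  (x.1 (+) qpar q, av x q).

Section Values.
Variable V : lmodType k.

(** Each letter of u is applied to a segment of p, possibly empty; the segments
    are disjoint and in the order of u. The resulting paths are passed to K. Every
    letter contributes the Koszul sign of moving it past the part of p to its
    left. *)
Fixpoint ins a1 b1 (u : path1 a1 b1) {struct u} :
    forall a b, path2 a b -> (path2 a b -> V) -> V :=
  match u with
  | qnil => fun a b p K => K p
  | qcons b1 c1 x u' =>
    fix insx a b (p : path2 a b) {struct p} : (path2 a b -> V) -> V :=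
      fun K =>
      gsum p (fun c q r => sg k (qpar u' && qpar q) *:
                           ins u' r (fun r' => K (qcons (act x q) r')))
      + match p in qpath _ _ b0 return (path2 a b0 -> V) -> V with
        | qnil => fun _ => 0
        | qcons _ _ f p' => fun K0 =>
            sg k (f.1 && (x.1 (+) qpar u')) *: insx _ _ p' (fun r => K0 (qcons f r))
        end K
  end.

Arguments ins : simpl never.

Lemma ins_nil c1 a b (p : path2 a b) (K : path2 a b -> V) : ins (qnil _ c1) p K = K p.
Proof. by []. Qed.

(** The terms of [ins] in which the first letter of the word is applied at the
    beginning of the path. *)
Definition insa a1 b1 c1 (x : dlet M1 b1 c1) (u : path1 a1 b1) a b (p : path2 a b)
    (K : path2 a b -> V) : V :=
  gsum p (fun c q r => sg k (qpar u && qpar q) *: ins u r (fun r' => K (qcons (act x q) r'))).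
(** The terms of [ins] in which all letters of the word move past the first
    letter of the path. *)
Definition insr a1 b1 c1 (x : dlet M1 b1 c1) (u : path1 a1 b1) a b (p : path2 a b) :
    (path2 a b -> V) -> V :=
  match p in qpath _ _ b0 return (path2 a b0 -> V) -> V with
  | qnil => fun _ => 0
  | qcons _ _ f p' => fun K =>
      sg k (f.1 && (x.1 (+) qpar u)) *: ins (qcons x u) p' (fun r => K (qcons f r))
  end.

Lemma insE a1 b1 c1 (x : dlet M1 b1 c1) (u : path1 a1 b1) a b (p : path2 a b) K :
  ins (qcons x u) p K = insa x u p K + insr x u p K.
Proof. by case: p K. Qed.

Lemma ins_ext a1 b1 (u : path1 a1 b1) a b (p : path2 a b) (K K' : path2 a b -> V) :
  (forall q, qpar q = qpar u (+) qpar p -> K q = K' q) -> ins u p K = ins u p K'.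
Proof.
elim: u a b p K K' => [|b2 c2 x u IHu] a b p K K'; first by move=> e; apply: e.
elim: p K K' => [|b3 c3 f p IHp] K K' e; rewrite !insE; congr (_ + _).
- apply: gsum_ext => c q r E; congr (_ *: _); apply: IHu => r' er; apply: e.
  rewrite E qpar_cat /= er; move: (qpar r) (qpar q) (qpar u) (x.1).
  by do 4!case.
- apply: gsum_ext => c q r E; congr (_ *: _); apply: IHu => r' er; apply: e.
  rewrite E qpar_cat /= er; move: (qpar r) (qpar q) (qpar u) (x.1).
  by do 4!case.
- rewrite /=; congr (_ *: _); apply: IHp => q eq; apply: e; rewrite /= eq /=.
  by move: (qpar p) (qpar u) (x.1) (f.1); do 4!case.
Qed.

Lemma insD a1 b1 (u : path1 a1 b1) a b (p : path2 a b) (K K' : path2 a b -> V) :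
  ins u p (fun q => K q + K' q) = ins u p K + ins u p K'.
Proof.
elim: u a b p K K' => [|b2 c2 x u IHu] a b p K K' //.
have ea c d (q : path2 c d) (L L' : path2 c d -> V) :
    insa x u q (fun q => L q + L' q) = insa x u q L + insa x u q L'.
  by rewrite /insa -gsumD; apply: gsum_ext => e q' r _; rewrite IHu scalerDr.
elim: p K K' => [|b3 c3 f p IHp] K K'; rewrite !insE ea /=; first by rewrite !addr0.
by rewrite IHp scalerDr addrACA.
Qed.

Lemma insZ a1 b1 (u : path1 a1 b1) a b (p : path2 a b) t (K : path2 a b -> V) :
  ins u p (fun q => t *: K q) = t *: ins u p K.
Proof.
elim: u a b p K => [|b2 c2 x u IHu] a b p K //.
have ea c d (q : path2 c d) (L : path2 c d -> V) :
    insa x u q (fun q => t *: L q) = t *: insa x u q L.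
  rewrite /insa (gsum_lin (g := *:%R t)) ?scaler0 //; last by move=> y z; rewrite scalerDr.
  by apply: gsum_ext => e q' r _; rewrite IHu !scalerA mulrC.
elim: p K => [|b3 c3 f p IHp] K; rewrite !insE ea /=; first by rewrite !addr0.
by rewrite IHp [RHS]scalerDr !scalerA [_ * t]mulrC.
Qed.

Lemma ins0 a1 b1 (u : path1 a1 b1) a b (p : path2 a b) : ins u p (fun _ => 0) = 0.
Proof. by have := insZ u p 0 (fun _ => 0); rewrite scaler0 scale0r. Qed.

Lemma ins_gsum (O' : Type) (H' : O' -> O' -> Type) a' b' (w : qpath H' a' b')
    a1 b1 (u : path1 a1 b1) a b (p : path2 a b)
    (K : forall c, qpath H' c b' -> qpath H' a' c -> path2 a b -> V) :
  ins u p (fun q => gsum w (fun c w1 w2 => K c w1 w2 q)) =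
  gsum w (fun c w1 w2 => ins u p (K c w1 w2)).
Proof. by elim: w K => [|b3 c3 f w IH] K //=; rewrite insD IH. Qed.

(** Cutting the result of an insertion cuts the path and the word; the
    letters that end up in the second half have moved past the first half of the
    path. A segment to which a letter has been applied is never cut. *)
Lemma ins_split a1 b1 (u : path1 a1 b1) a b (p : path2 a b)
    (G : forall c, path2 c b -> path2 a c -> V) :
  ins u p (fun q => gsum q G) =
  gsum p (fun c p1 p2 => gsum u (fun e u1 u2 => sg k (qpar u2 && qpar p1) *:
    ins u1 p1 (fun q1 => ins u2 p2 (fun q2 => G c q1 q2)))).
Proof.
elim: u a b p G => [|b2 c2 x u IHu] a b p G.
  by rewrite /=; apply: gsum_ext => c q r _; rewrite /sg expr0 scale1r.
have ea a' b' (p' : path2 a' b') (G' : forall c, path2 c b' -> path2 a' c -> V) :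
    insa x u p' (fun q => gsum q G') = insa x u p' (G' _ (qnil _ _)) +
    gsum p' (fun c p1 p2 => gsum u (fun e u1 u2 => sg k (qpar u2 && qpar p1) *:
      insa x u1 p1 (fun q1 => ins u2 p2 (fun q2 => G' c q1 q2)))).
  rewrite /insa -/(gsum _ _); under gsum_ext => c q r _ do
    rewrite /= insD scalerDr IHu.
  rewrite gsumD; congr (_ + _).
  pose F c e (q : path2 e b') (r : path2 c e) (p2 : path2 a' c) : V :=
    gsum u (fun e' u1 u2 =>
      (sg k (qpar u2 && (qpar q (+) qpar r)) * sg k (qpar u1 && qpar q)) *:
      ins u1 r (fun q1 => ins u2 p2 (fun q2 => G' c (qcons (act x q) q1) q2))).
  transitivity (gsum p' (fun c p1 p2 => gsum p1 (fun e q r => F c e q r p2))).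
    rewrite gsum_assoc; apply: gsum_ext => c q r _; rewrite gsumZ.
    apply: gsum_ext => e r1 p2 _; rewrite gsumZ; apply: gsum_ext => e' u1 u2 ->.
    rewrite scalerA -!sgD qpar_cat; congr (sg k _ *: _).
    by move: (qpar u1) (qpar u2) (qpar q) (qpar r1); do 4!case.
  apply: gsum_ext => c p1 p2 _; rewrite /F gsum_exchange; apply: gsum_ext => e' u1 u2 _.
  rewrite /insa gsumZ; apply: gsum_ext => e q r ->.
  by rewrite scalerA qpar_cat.
have key a' b' (p' : path2 a' b') (G' : forall c, path2 c b' -> path2 a' c -> V) :
    insa x u p' (G' _ (qnil _ _)) + insr x u p' (fun q => gsum q G') =
    gsum p' (fun c p1 p2 => sg k ((x.1 (+) qpar u) && qpar p1) *: ins (qcons x u) p2 (G' c p1))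
    + gsum p' (fun c p1 p2 => gsum u (fun e u1 u2 => sg k (qpar u2 && qpar p1) *:
      insr x u1 p1 (fun q1 => ins u2 p2 (fun q2 => G' c q1 q2)))) ->
    ins (qcons x u) p' (fun q => gsum q G') =
    gsum p' (fun c p1 p2 => gsum (qcons x u) (fun e u1 u2 => sg k (qpar u2 && qpar p1) *:
      ins u1 p1 (fun q1 => ins u2 p2 (fun q2 => G' c q1 q2)))).
  move=> h; rewrite insE ea addrAC h -addrA -!gsumD; apply: gsum_ext => c p1 p2 _ /=.
  rewrite -gsumD; congr (_ + _); apply: gsum_ext => e u1 u2 _.
  by rewrite insE [RHS]scalerDr addrC.
have z a' b' (p1 : path2 a' b') : gsum u (fun e u1 u2 => sg k (qpar u2 && qpar p1) *: (0 : V)) = 0.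
  by rewrite -[RHS](gsum0 V u); apply: gsum_ext => e u1 u2 _; rewrite scaler0.
elim: p G => [|b3 c3 f p IHp] G; apply: key.
  have := z a a (qnil _ a); rewrite /= => ->.
  by rewrite andbF scale1r insE !addr0.
have := z c3 c3 (qnil _ c3); rewrite /= => ->.
rewrite add0r andbF scale1r (insE x u (qcons f p)) /= insD IHp scalerDr -!addrA; congr (_ + (_ + _)).
rewrite gsumZ -gsumD; congr (_ + _); apply: gsum_ext => c p1 p2 E /=.
rewrite scalerDr scalerA -sgD gsumZ; congr (sg k _ *: _ + _).
  by move: (f.1) (x.1) (qpar u) (qpar p1); do 4!case.
apply: gsum_ext => e u1 u2 ->; rewrite !scalerA -!sgD qpar_cat; congr (sg k _ *: _).
by move: (f.1) (x.1) (qpar u1) (qpar u2) (qpar p1); do 5!case.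
Qed.
End Values.
#[local] Arguments ins : simpl never.

Lemma ins_lin (V W : lmodType k) (g : V -> W) : linear g ->
  forall a1 b1 (u : path1 a1 b1) a b (p : path2 a b) (K : path2 a b -> V),
  g (ins u p K) = ins u p (fun q => g (K q)).
Proof.
move=> gl a1 b1; have g0 : g 0 = 0 := lin0 (mklin gl).
have gD y z : g (y + z) = g y + g z := linD (mklin gl) y z.
have gZ t y : g (t *: y) = t *: g y := linZ (mklin gl) t y.
have gs c d (q : path2 c d) (F : forall e, path2 e d -> path2 c e -> V) :
    g (gsum q F) = gsum q (fun e q1 q2 => g (F e q1 q2)).
  by apply: gsum_lin.
elim=> [|b2 c2 x u IHu] a b p K //.
have ea c d (q : path2 c d) (L : path2 c d -> V) :
    g (insa x u q L) = insa x u q (fun q => g (L q)).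
  by rewrite /insa gs; apply: gsum_ext => e q' r _; rewrite -IHu gZ.
elim: p K => [|b3 c3 f p IHp] K; rewrite !insE gD /= ea; first by rewrite g0.
by rewrite gZ IHp.
Qed.
End Action.
#[global] Arguments ins : simpl never.

Section Composition.
Variables (O1 : Type) (M1 : O1 -> O1 -> lmodType k).
Variables (O2 : Type) (M2 : O2 -> O2 -> lmodType k).
Local Notation path1 := (qpath (dlet M1)).
Local Notation path2 := (qpath (dlet M2)).
Variable av1 : forall a1 b1, dlet M1 a1 b1 -> forall a b, path1 a b -> M1 a b.
Variable av2 : forall a1 b1, dlet M1 a1 b1 -> forall a b, path2 a b -> M2 a b.
Variable wd : forall a b, path2 a b -> Prop.
Hypothesis wd_cat : forall a b c (u : path2 b c) (v : path2 a b),
  wd (qcat u v) -> wd u /\ wd v.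
Hypothesis av_ins : forall a1 b1 (x : dlet M1 a1 b1) c d (v : path1 c d)
    a b (p : path2 a b), wd p ->
  av2 (act av1 x v) p = ins av2 v p (fun q => av2 x q).
Variable V : lmodType k.

Lemma qmulti_cons a b c (f : dlet M2 b c) (K : path2 a c -> V) :
  qmulti K -> qmulti (fun q => K (qcons f q)).
Proof. by move=> hK d e u x v; apply: (hK d e (qcons f u)). Qed.

(** Inserting v into p and then u, each letter of u is applied to a segment
    that consists of letters of p and of results of letters of v. Grouping it with
    the letters of v that lie in this segment gives an insertion of u into v,
    followed by one into p. The proof is by induction on u, v and p, in this
    order, comparing the first letters of the results: a letter of u whose segment
    starts here, a result of a letter of v, or a letter of p. *)
Theorem ins_comp a1 b1 (u : path1 a1 b1) a2 b2 (v : path1 a2 b2) a b (p : path2 a b)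
    (K : path2 a b -> V) : wd p -> qmulti K ->
  ins av2 v p (fun q => ins av2 u q K) = ins av1 u v (fun w => ins av2 w p K).
Proof.
elim: u a2 b2 v a b p K => [|b3 c3 x u IHu] //.
have part_a d e (v : path1 d e) a b (p : path2 a b) (K : path2 a b -> V) : wd p -> qmulti K ->
    ins av2 v p (fun q => insa av2 x u q K) =
    gsum v (fun c v1 v2 => sg k (qpar u && qpar v1) *:
      ins av1 u v2 (fun w => insa av2 (act av1 x v1) w p K)).
  move=> hp hK; rewrite /insa ins_split gsum_exchange; apply: gsum_ext => c v1 v2 Ev.
  transitivity (sg k (qpar u && qpar v1) *: gsum p (fun c' p1 p2 => ins av1 u v2 (fun w =>
    sg k (qpar w && qpar p1) *: ins av2 w p2 (fun r' => K (qcons (act av2 (act av1 x v1) p1) r'))))).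
    2: by rewrite ins_gsum.
  rewrite gsumZ; apply: gsum_ext => c' p1 p2 Ep; rewrite {}Ep in hp.
  have [hp1 hp2] := wd_cat hp.
  pose Psi (l : dlet M2 _ _) : V := ins av1 u v2 (fun w => ins av2 w p2 (fun r => K (qcons l r))).
  have Psi_lin s : linear (fun m => Psi (s, m)).
    move=> t m m'; rewrite /Psi -insZ -insD; apply: ins_ext => w _.
    rewrite -insZ -insD; apply: ins_ext => r _.
    exact: (hK _ _ (qnil _ _)).
  transitivity ((sg k (qpar v2 && qpar p1) * sg k (qpar u && (qpar v1 (+) qpar p1))) *:
     Psi (act av2 (act av1 x v1) p1)).
    rewrite -scalerA; congr (_ *: _); rewrite /act av_ins // -/(act _ _ _) /=.
    rewrite [Psi _](ins_lin av2 (Psi_lin _)) -insZ; apply: ins_ext => q1 eq1.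
    rewrite -addbA -eq1 insZ; congr (_ *: _).
    by rewrite IHu // => *; apply: qmulti_cons.
  rewrite /Psi -!insZ; apply: ins_ext => w ew; rewrite scalerA ew -!sgD.
  congr (sg k _ *: _).
  by move: (qpar v1) (qpar v2) (qpar p1) (qpar u); do 4!case.
have red d e (v : path1 d e) a b (p : path2 a b) (K : path2 a b -> V) : wd p -> qmulti K ->
    ins av2 v p (fun q => insr av2 x u q K) =
      gsum v (fun c v1 v2 => sg k (qpar u && qpar v1) *:
        ins av1 u v2 (fun w => insr av2 (act av1 x v1) w p K))
      + insr av1 x u v (fun w => ins av2 w p K) ->
    ins av2 v p (fun q => ins av2 (qcons x u) q K) =
    ins av1 (qcons x u) v (fun w => ins av2 w p K).
  move=> hp hK h; rewrite insE.
  transitivity (ins av2 v p (fun q => insa av2 x u q K + insr av2 x u q K)).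
    by apply: ins_ext => q _; rewrite insE.
  rewrite insD part_a // h addrA; congr (_ + _).
  rewrite -gsumD; apply: gsum_ext => c v1 v2 _; rewrite -scalerDr -insD; congr (_ *: _).
  by apply: ins_ext => w _; rewrite insE.
move=> a2 b2; elim=> [|b4 c4 y v IHv] a b p.
  elim: p => [|b5 c5 f p IHp] K hp hK; apply: red => //.
    by rewrite /= ins0 scaler0 addr0.
  have [_ hp'] := @wd_cat _ _ _ (qcons f (qnil _ _)) p hp.
  have := IHp (fun q => K (qcons f q)) hp' (qmulti_cons f hK).
  rewrite !ins_nil /= addr0 andbF scale1r => ->.
  rewrite insE /= addr0 /insa /= andbF scale1r -insZ; apply: ins_ext => w ew.
  by rewrite ew /= !addbF.
have part_y d e (q : path2 d e) (K : path2 d e -> V) : wd q -> qmulti K ->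
    insa av2 y v q (fun r => insr av2 x u r K) =
    sg k (y.1 && (x.1 (+) qpar u)) *: ins av1 (qcons x u) v (fun w => insa av2 y w q K).
  move=> hq hK; rewrite /insa ins_gsum gsumZ; apply: gsum_ext => c q1 q2 Eq.
  rewrite {}Eq in hq; have [_ hq2] := wd_cat hq; rewrite /= insZ IHv //; last exact: qmulti_cons.
  rewrite scalerA -!insZ; apply: ins_ext => w ew; rewrite scalerA -!sgD ew /=.
  by congr (sg k _ *: _); move: (qpar v) (qpar q1) (qpar u) (y.1) (x.1); do 5!case.
have part_r d e (q : path2 d e) (K : path2 d e -> V) :
    insr av1 x u (qcons y v) (fun w => ins av2 w q K) =
    sg k (y.1 && (x.1 (+) qpar u)) *: ins av1 (qcons x u) v (fun w => insa av2 y w q K) +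
    sg k (y.1 && (x.1 (+) qpar u)) *: ins av1 (qcons x u) v (fun w => insr av2 y w q K).
  rewrite -scalerDr -insD; congr (_ *: _).
  by apply: ins_ext => w _; rewrite insE.
elim: p => [|b5 c5 f p IHp] K hp hK; apply: red => //; rewrite insE part_y // part_r.
  rewrite addrCA; congr (_ + _).
  have -> : insr av2 y v (qnil _ a) (fun q => insr av2 x u q K) = 0 by [].
  rewrite [X in _ + X]/= ins0 scaler0 addr0 -[LHS](gsum0 V (qcons y v)).
  by apply: gsum_ext => c v1 v2 _; rewrite ins0 scaler0.
have [_ hp'] := @wd_cat _ _ _ (qcons f (qnil _ _)) p hp.
rewrite addrCA; congr (_ + _).
have e : insr av2 y v (qcons f p) (fun q => insr av2 x u q K) =
    (sg k (f.1 && (y.1 (+) qpar v)) * sg k (f.1 && (x.1 (+) qpar u))) *: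
    ins av2 (qcons y v) p (fun q => ins av2 (qcons x u) q (fun r => K (qcons f r))).
  by rewrite /= -scalerA insZ.
rewrite {}e (IHp _ hp' (qmulti_cons f hK)) -sgD insE scalerDr; congr (_ + _).
  rewrite gsumZ; apply: gsum_ext => c v1 v2 Ev; rewrite scalerA mulrC -scalerA; congr (_ *: _).
  rewrite -insZ; apply: ins_ext => w ew; rewrite /= ew.
  have : qpar (qcons y v) = qpar v1 (+) qpar v2 by rewrite Ev qpar_cat.
  move=> /= ev; congr (sg k _ *: _); move: ev.
  by move: (qpar v) (qpar v1) (qpar v2) (qpar u) (y.1) (x.1) (f.1); do 7!case.
rewrite /= scalerA mulrC -scalerA; congr (_ *: _).
rewrite -insZ; apply: ins_ext => w ew; rewrite /= ew /=; congr (sg k _ *: _).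
by move: (qpar v) (qpar u) (y.1) (x.1) (f.1); do 5!case.
Qed.
End Composition.
End Insertion.

(** * Multilinearity and degrees of insertions *)

Section Multilinearity.
Variable k : comNzRingType.
Variables (O : Type) (M : O -> O -> lmodType k).
Local Notation path := (qpath (dlet M)).
Variable V : lmodType k.

Lemma gsum_multi a b (G : forall c, path c b -> path a c -> V) :
  (forall c (r : path a c), qmulti (fun q : path c b => G c q r)) ->
  (forall c (q : path c b), qmulti (G c q)) ->
  qmulti (fun p => gsum p G).
Proof.
move=> hl hr c e u; elim: u G hl hr => [|b1 c1 f u IH] G hl hr x v; apply: lin_add => /=.
- exact: (hr _ (qnil _ _) _ _ (qnil _ _)).
- move=> t m m' /=; rewrite gsumZ -gsumD; apply: gsum_ext => d q r _.
  exact: (hl _ r _ _ (qnil _ _)).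
- exact: (hr _ (qnil _ _) _ _ (qcons f u)).
- apply: (IH (fun c q r => G c (qcons f q) r)) => [d r|d q]; last exact: hr.
  move=> d1 d2 u1; exact: (hl _ r _ _ (qcons f u1)).
Qed.
End Multilinearity.

Section InsertionProperties.
Variable k : comNzRingType.
Variables (O1 : Type) (M1 : O1 -> O1 -> lmodType k).
Variables (O2 : Type) (M2 : O2 -> O2 -> lmodType k).
Local Notation path1 := (qpath (dlet M1)).
Local Notation path2 := (qpath (dlet M2)).
Variable av : forall a1 b1, dlet M1 a1 b1 -> forall a b, path2 a b -> M2 a b.
Hypothesis av_multi : forall a1 b1 (x : dlet M1 a1 b1) a b,
  qmulti (fun q : path2 a b => av x q).
Hypothesis av_lin : forall a1 b1 s a b (q : path2 a b),
  linear (fun m : M1 a1 b1 => av (s, m) q).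
Variable V : lmodType k.

Lemma ins_multi_path a1 b1 (u : path1 a1 b1) a b (K : path2 a b -> V) :
  qmulti K -> qmulti (fun p => ins av u p K).
Proof.
elim: u a b K => [|b2 c2 x u IHu] a b K hK //.
have ha a' b' (L : path2 a' b' -> V) : qmulti L -> qmulti (fun p => insa av x u p L).
  move=> hL; apply: gsum_multi => [c r|c q].
    move=> d e v y w t m m'; rewrite !qpar_cat /=; set s := sg k _.
    rewrite !scalerA mulrC -scalerA -scalerDr; congr (_ *: _); rewrite -insZ -insD.
    apply: ins_ext => r' _; rewrite /act !qpar_cat /= av_multi.
    exact: (hL _ _ (qnil _ _)).
  move=> d e v y w; apply: lin_scale; apply: IHu => d' e' v'.
  exact: (hL _ _ (qcons (act av x q) v')).
have ha' a' b' c' d' (L : path2 a' b' -> V) (v : path2 d' b') y (w : path2 a' c') t m m' :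
    qmulti L -> insa av x u (qcat v (qcons (y, t *: m + m') w)) L =
    t *: insa av x u (qcat v (qcons (y, m) w)) L + insa av x u (qcat v (qcons (y, m') w)) L.
  by move=> hL; apply: ha.
move=> d e v; elim: v K hK => [|b3 c3 f v IHv] K hK y w t m m'; rewrite !insE ha' // [in RHS]scalerDr addrACA; congr (_ + _).
  rewrite /= !scalerA mulrC -scalerA -scalerDr; congr (_ *: _); rewrite -insZ -insD.
  by apply: ins_ext => r' _; apply: (hK _ _ (qnil _ _)).
rewrite /= scalerA mulrC -scalerA -scalerDr; congr (_ *: _).
by apply: (IHv (fun r => K (qcons f r))); apply: qmulti_cons.
Qed.

Lemma ins_multi_word a1 b1 a b (p : path2 a b) (K : path2 a b -> V) :
  qmulti K -> qmulti (fun u : path1 a1 b1 => ins av u p K).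
Proof.
move=> hK d e v; elim: v a b p K hK => [|b3 c3 f v IHv] a b p K hK y w t m m'.
  elim: p K hK => [|b3 c3 f p IHp] K hK; rewrite /= !insE.
    rewrite /= !addr0 /insa /= scalerA mulrC -scalerA -scalerDr; congr (_ *: _); rewrite -insZ -insD.
    by apply: ins_ext => r _; rewrite /act av_lin; apply: (hK _ _ (qnil _ _)).
  rewrite scalerDr addrACA; congr (_ + _).
    rewrite /insa gsumZ -gsumD; apply: gsum_ext => c q r _.
    rewrite scalerA mulrC -scalerA -scalerDr; congr (_ *: _); rewrite -insZ -insD.
    by apply: ins_ext => r' _; rewrite /act av_lin; apply: (hK _ _ (qnil _ _)).
  rewrite /= scalerA mulrC -scalerA -scalerDr; congr (_ *: _).
  by apply: (IHp (fun r => K (qcons f r))); apply: qmulti_cons.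
elim: p K hK => [|b4 c4 g p IHp] K hK; rewrite /= !insE.
  rewrite /= !addr0 /insa /= !qpar_cat /= scalerA mulrC -scalerA -scalerDr; congr (_ *: _).
  exact/IHv/qmulti_cons.
rewrite scalerDr addrACA; congr (_ + _).
  rewrite /insa gsumZ -gsumD; apply: gsum_ext => c q r _; rewrite !qpar_cat /=.
  rewrite scalerA mulrC -scalerA -scalerDr; congr (_ *: _).
  exact/IHv/qmulti_cons.
rewrite /= !qpar_cat /= scalerA mulrC -scalerA -scalerDr; congr (_ *: _).
by apply: (IHp (fun r => K (qcons g r))); apply: qmulti_cons.
Qed.
End InsertionProperties.

Section Grading.
Variable k : comNzRingType.

Section QAll.
Variables (O : Type) (M : O -> O -> lmodType k).
Variable D : forall a b, int -> dlet M a b -> Prop.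
Fixpoint qall (ds : seq int) a b (p : qpath (dlet M) a b) : Prop :=
  match p, ds with
  | qnil, [::] => True
  | qcons _ _ f p', d :: ds' => D d f /\ qall ds' p'
  | _, _ => False
  end.

Lemma qall_cat ds es a b c (u : qpath (dlet M) b c) (v : qpath (dlet M) a b) :
  qall ds u -> qall es v -> qall (ds ++ es) (qcat u v).
Proof.
elim: u ds v => [|b1 c1 f u IH] [|d ds] v //= [hf hu] hv.
by split=> //; apply: IH.
Qed.

Lemma qall_catP ds a b c (u : qpath (dlet M) b c) (v : qpath (dlet M) a b) :
  qall ds (qcat u v) -> exists d1 d2, [/\ ds = d1 ++ d2, qall d1 u & qall d2 v].
Proof.
elim: u ds v => [|b1 c1 f u IH] ds v /=; first by exists [::], ds.
case: ds => // d ds [hf /IH[d1 [d2 [-> h1 h2]]]].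
by exists (d :: d1), d2.
Qed.

Lemma qall_takedrop ds a b c (u : qpath (dlet M) b c) (v : qpath (dlet M) a b) :
  qall ds (qcat u v) -> qall (take (qsize u) ds) u /\ qall (drop (qsize u) ds) v.
Proof.
elim: u ds v => [|b1 c1 f u IH] ds v /=; first by rewrite take0 drop0.
by case: ds => // d ds [hf /IH[h1 h2]] /=.
Qed.
End QAll.

Variables (O1 : Type) (M1 : O1 -> O1 -> lmodType k).
Variables (O2 : Type) (M2 : O2 -> O2 -> lmodType k).
Local Notation path1 := (qpath (dlet M1)).
Local Notation path2 := (qpath (dlet M2)).
Variable av : forall a1 b1, dlet M1 a1 b1 -> forall a b, path2 a b -> M2 a b.
Variables (D1 : forall a b, int -> dlet M1 a b -> Prop).
Variables (D2 : forall a b, int -> dlet M2 a b -> Prop).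
Hypothesis act_D : forall a1 b1 (x : dlet M1 a1 b1) d a b (q : path2 a b) es,
  D1 d x -> qall D2 es q -> D2 (d + sumz es) (act av x q).
Variable V : lmodType k.

(** Insertion preserves the total degree, for every notion of degree of a
    letter that is compatible with the action of letters on segments. *)
Lemma ins_closed (S : V -> Prop) a1 b1 (u : path1 a1 b1) ds a b (p : path2 a b) es
    (K : path2 a b -> V) :
  S 0 -> (forall t x y, S x -> S y -> S (t *: x + y)) ->
  qall D1 ds u -> qall D2 es p ->
  (forall fs q, (qsize u <= qsize q)%N -> sumz fs = sumz ds + sumz es -> qall D2 fs q -> S (K q)) ->
  S (ins av u p K).
Proof.
move=> S0 SP; have SD x y : S x -> S y -> S (x + y).
  by move=> hx hy; rewrite -[x]scale1r; apply: SP.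
have SZ t x : S x -> S (t *: x) by move=> hx; rewrite -[_ *: _]addr0; apply: SP.
elim: u ds a b p es K => [|b2 c2 x u IHu] [|d ds] a b p es K hu // hp hK.
  by rewrite ins_nil; apply: (hK es) => //; rewrite sumz_nil add0r.
have [hx hu'] := hu.
elim: p es K hp hK => [|b3 c3 f p IHp] es K hp hK; rewrite insE.
  rewrite /insa /= addr0; apply: SZ; apply: (IHu ds _ _ _ [::]) => // fs q sq efs hq.
  move: hp hK; case: es => // _ hK; apply: (hK ((d + sumz [::]) :: fs)) => //=.
    by rewrite !sumz_cons efs sumz_nil; ring.
  by split=> //; apply: act_D.
apply: (SD); last first.
  case: es hp hK => // e es [hf hp] hK /=; apply: SZ; apply: (IHp es) => // fs q sq efs hq.
  apply: (hK (e :: fs)) => //=; first by rewrite ltnW.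
  by rewrite sumz_cons efs !sumz_cons addrCA.
apply: (gsum_closed SD) => c q r E; rewrite E in hp; have [e1 [e2 [ee h1 h2]]] := qall_catP hp.
apply: SZ; apply: (IHu ds _ _ _ e2) => // fs q' sq' efs hq'.
apply: (hK ((d + sumz e1) :: fs)) => //=.
  by rewrite !sumz_cons efs ee sumz_cat; ring.
by split=> //; apply: act_D.
Qed.

Lemma ins_hom_ext a1 b1 (u : path1 a1 b1) ds a b (p : path2 a b) es (K K' : path2 a b -> V) :
  qall D1 ds u -> qall D2 es p ->
  (forall fs q, (qsize u <= qsize q)%N -> sumz fs = sumz ds + sumz es -> qall D2 fs q -> K q = K' q) ->
  ins av u p K = ins av u p K'.
Proof.
move=> hu hp e; apply/eqP; rewrite -subr_eq0; apply/eqP.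
have -> : ins av u p K - ins av u p K' = ins av u p (fun q => K q + (-1) *: K' q).
  by rewrite insD insZ scaleN1r.
apply: (@ins_closed (fun x => x = 0) _ _ u ds _ _ p es) => //.
  by move=> t x y -> ->; rewrite scaler0 addr0.
by move=> fs q sq efs hq; rewrite (e fs) // scaleN1r subrr.
Qed.
End Grading.

Lemma ins_small (k : comNzRingType) (O1 : Type) (M1 : O1 -> O1 -> lmodType k)
    (O2 : Type) (M2 : O2 -> O2 -> lmodType k)
    (av : forall a1 b1, dlet M1 a1 b1 -> forall a b, qpath (dlet M2) a b -> M2 a b)
    (V : lmodType k) a1 b1 (u : qpath (dlet M1) a1 b1) a b (p : qpath (dlet M2) a b)
    (K : qpath (dlet M2) a b -> V) :
  (forall q, (qsize u <= qsize q)%N -> K q = 0) -> ins av u p K = 0.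
Proof.
move=> hK; pose Tr O (M : O -> O -> lmodType k) (a b : O) (_ : int) (_ : dlet M a b) := True.
have tr O (M : O -> O -> lmodType k) c d (q : qpath (dlet M) c d) : qall (@Tr O M) (nseq (qsize q) 0) q.
  by elim: q.
apply: (@ins_closed _ _ _ _ _ av (@Tr _ _) (@Tr _ _) _ _ (fun x => x = 0) _ _ _ _ _ _ _ _ _ _ _ (tr _ _ _ _ u) (tr _ _ _ _ p)) => //.
  by move=> t x y -> ->; rewrite scaler0 addr0.
by move=> fs q hq _ _; apply: hK.
Qed.

(** * From decorated to plain paths *)

Section Decoration.
Variable k : comNzRingType.
Variables (O : Type) (M : O -> O -> grmod k).
Local Notation L := (fun a b => gcar (M a b)).
Local Notation upath := (qpath L).
Local Notation dpath := (qpath (dlet L)).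

Fixpoint strip a b (p : dpath a b) : upath a b :=
  match p in qpath _ _ b0 return upath a b0 with
  | qnil => qnil _ a
  | qcons _ _ f p' => qcons (f.2 : L _ _) (strip p')
  end.

Fixpoint deco (ds : seq int) a b (p : upath a b) : dpath a b :=
  match p in qpath _ _ b0 return dpath a b0 with
  | qnil => qnil _ a
  | qcons _ _ f p' => qcons ((oddz (head 0 ds), f) : dlet L _ _) (deco (behead ds) p')
  end.

(** Homogeneous, with the parity that the degree dictates. *)
Definition dhom_let a b (d : int) (x : dlet L a b) := gdeg d x.2 /\ x.1 = oddz d.
(** Homogeneous, with an unrelated parity: the degree of a brace does not
    depend on the decoration. *)
Definition whom_let a b (d : int) (x : dlet L a b) := gdeg d x.2.

Fixpoint uhom (ds : seq int) a b (p : upath a b) : Prop :=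
  match p, ds with
  | qnil, [::] => True
  | qcons _ _ f p', d :: ds' => gdeg d (f : M _ _) /\ uhom ds' p'
  | _, _ => False
  end.

Lemma strip_cat a b c (u : dpath b c) (v : dpath a b) : strip (qcat u v) = qcat (strip u) (strip v).
Proof. by elim: u v => //= b' c' f u IH v; rewrite IH. Qed.

Lemma strip_deco ds a b (u : upath a b) : strip (deco ds u) = u.
Proof. by elim: u ds => //= b' c' f u IH ds; rewrite IH. Qed.

Lemma deco_hom ds a b (u : upath a b) : uhom ds u -> qall dhom_let ds (deco ds u).
Proof. by elim: u ds => [|b' c' f u IH] [|d ds] //= [hf hu]; split=> //; apply: IH. Qed.

Lemma strip_hom ds a b (p : dpath a b) : qall dhom_let ds p -> uhom ds (strip p).
Proof. by elim: p ds => [|b' c' f u IH] [|d ds] //= [[hf _] hu]; split=> //; apply: IH. Qed.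

Lemma deco_strip ds a b (p : dpath a b) : qall dhom_let ds p -> deco ds (strip p) = p.
Proof.
elim: p ds => [|b' c' [s f] u IH] [|d ds] //= [[_ /= ->] hu].
by rewrite IH.
Qed.

Lemma qpar_hom ds a b (p : dpath a b) : qall dhom_let ds p -> qpar p = oddz (sumz ds).
Proof.
elim: p ds => [|b' c' f u IH] [|d ds] //=; first by rewrite sumz_nil.
by move=> [[_ ->] hu]; rewrite sumz_cons oddzD (IH ds).
Qed.

Lemma qall_dw ds a b (p : dpath a b) : qall dhom_let ds p -> qall whom_let ds p.
Proof. by elim: p ds => [|b' c' f u IH] [|d ds] //= [[hf _] hu]; split=> //; apply: IH. Qed.

Lemma dpath_hind a b (P : dpath a b -> Prop) :
  (forall c e (u : dpath e b) s (v : dpath a c), P (qcat u (qcons ((s, 0) : dlet L c e) v))) ->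
  (forall c e (u : dpath e b) s (x y : M c e) (v : dpath a c),
     P (qcat u (qcons ((s, x) : dlet L c e) v)) -> P (qcat u (qcons ((s, y) : dlet L c e) v)) ->
     P (qcat u (qcons ((s, x + y) : dlet L c e) v))) ->
  (forall ds p, qall whom_let ds p -> P p) -> forall p, P p.
Proof.
move=> P0 PD Ph p; suff H c ds (v : dpath a c) (u : dpath c b) : qall whom_let ds u -> P (qcat u v).
  by apply: (H b [::] p (qnil _ b)).
elim: v ds u => [|c1 c2 [s f] v IH] ds u hu; first by rewrite qcat_nil; apply: Ph hu.
elim/hom_ind: f => [|x y hx hy|i x hx]; [exact: P0 | exact: PD |].
rewrite -[qcons _ _]/(qcat (qcons ((s, x) : dlet L _ _) (qnil _ _)) v) qcatA.
by apply: (IH (ds ++ [:: i])); apply: qall_cat.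
Qed.

Variable V : lmodType k.

Definition umulti a b (F : upath a b -> V) : Prop :=
  forall c e (u : upath e b) (v : upath a c),
    linear (fun m : M c e => F (qcat u (qcons (m : L _ _) v))).

(** The multilinear extension of a function of decorated paths to plain ones:
    every letter is replaced by its two parity parts. On a homogeneous path only
    the decoration by the degrees survives ([psum_hom]). *)
Fixpoint psum a b (p : upath a b) : (dpath a b -> V) -> V :=
  match p in qpath _ _ b0 return (dpath a b0 -> V) -> V with
  | qnil => fun F => F (qnil _ a)
  | qcons _ _ f p' => fun F =>
      psum p' (fun q => F (qcons ((false, par false (f : M _ _)) : dlet L _ _) q)) +
      psum p' (fun q => F (qcons ((true, par true (f : M _ _)) : dlet L _ _) q))
  end.

Lemma psum_ext a b (p : upath a b) (F G : dpath a b -> V) :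
  (forall q, qsize q = qsize p -> F q = G q) -> psum p F = psum p G.
Proof.
elim: p F G => [|b' c' f p IH] F G e /=; first exact: e.
by congr (_ + _); apply: IH => q eq; apply: e; rewrite /= eq.
Qed.

Lemma psum0 a b (p : upath a b) : psum p (fun _ => 0) = 0.
Proof. by elim: p => [|b' c' f p IH] //=; rewrite IH addr0. Qed.

Lemma psumP t a b (p : upath a b) (F G : dpath a b -> V) :
  psum p (fun q => t *: F q + G q) = t *: psum p F + psum p G.
Proof.
elim: p F G => [|b' c' f p IH] F G //=.
by rewrite !IH addrACA -scalerDr.
Qed.

Lemma psum_multi a b (F : dpath a b -> V) : qmulti F -> umulti (fun p => psum p F).
Proof.
move=> hF c e u; elim: u F hF => [|b1 c1 f u IH] F hF v t m m' /=.
  have h s : psum v (fun q => F (qcons ((s, par s (t *: m + m')) : dlet L _ _) q)) =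
      t *: psum v (fun q => F (qcons ((s, par s m) : dlet L _ _) q)) +
      psum v (fun q => F (qcons ((s, par s m') : dlet L _ _) q)).
    rewrite -psumP; apply: psum_ext => q _; rewrite linearP.
    exact: (hF _ _ (qnil _ _)).
  by rewrite !h addrACA -scalerDr.
have h s := IH _ (@qmulti_cons k O _ V _ _ _ ((s, par s (f : M _ _)) : dlet L _ _) F hF) v t m m'.
by rewrite /= in h; rewrite !h addrACA -scalerDr.
Qed.

Lemma psum_hom ds a b (p : upath a b) (F : dpath a b -> V) : qmulti F -> uhom ds p ->
  psum p F = F (deco ds p).
Proof.
elim: p ds F => [|b' c' f p IH] [|d ds] F hF //= [hf hp].
have h s : psum p (fun q => F (qcons ((s, par s (f : M _ _)) : dlet L _ _) q)) =
    if oddz d == s then F (qcons ((s, f) : dlet L _ _) (deco ds p)) else 0.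
  rewrite (par_hom _ hf); case: eqP => e; rewrite (IH ds) //; try exact: qmulti_cons.
  exact: (lin0 (mklin (hF _ _ (qnil _ _) s (deco ds p)))).
by rewrite !h; case: (oddz d); rewrite ?addr0 ?add0r.
Qed.

Lemma psum_strip ds a b (p : dpath a b) (F : dpath a b -> V) : qmulti F -> qall dhom_let ds p ->
  psum (strip p) F = F p.
Proof. by move=> hF hp; rewrite (psum_hom hF (strip_hom hp)) deco_strip. Qed.

End Decoration.

Lemma psum_lin (k : comNzRingType) (O : Type) (M : O -> O -> grmod k) (V W : lmodType k)
    (g : V -> W) a b (p : qpath (fun a b => gcar (M a b)) a b) F : linear g ->
  g (psum p F) = psum p (fun q => g (F q)).
Proof.
move=> gl; elim: p F => [|b' c' f p IH] F //=.
by rewrite -!IH; exact: (linD (mklin gl)).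
Qed.

(** * Words as paths *)

Section DecoratedWords.
Variables (k : comNzRingType) (M : grmod k).
Local Notation L := (fun _ _ : unit => gcar M).
Local Notation D := (fun _ _ : unit => M).
Local Notation upath := (qpath L).
Local Notation dpath := (qpath (dlet L)).

Fixpoint tow a b (p : upath a b) : seq M :=
  if p is qcons _ _ f p' then f :: tow p' else [::].

Fixpoint ofw (w : seq M) : upath tt tt :=
  if w is x :: w' then @qcons _ _ tt tt tt x (ofw w') else qnil _ tt.

Lemma tow_ofw w : tow (ofw w) = w. Proof. by elim: w => //= x w ->. Qed.

Lemma ofw_cat u v : ofw (u ++ v) = qcat (ofw u) (ofw v).
Proof. by elim: u => //= x u ->. Qed.

Lemma tow_cat a b c (u : upath b c) (v : upath a b) : tow (qcat u v) = tow u ++ tow v.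
Proof. by elim: u v => //= b' c' f u IH v; rewrite IH. Qed.

Lemma ofw_tow (p : upath tt tt) : ofw (tow p) = p.
Proof.
suff H a b (q : upath a b) :
    (match a as a0, b as b0 return upath a0 b0 -> Prop with
     | tt, tt => fun q => ofw (tow q) = q end) q by exact: (H _ _ p).
elim: q => [|b1 c1 f q IH]; first by case: a.
by case: a b1 c1 f q IH => [] [] [] f q /= ->.
Qed.

Definition letters a b (p : dpath a b) : seq M := tow (strip (M := D) p).
Definition dec ds (w : seq M) : dpath tt tt := deco (M := D) ds (ofw w).

Lemma letters_dec ds w : letters (dec ds w) = w.
Proof. by rewrite /letters /dec strip_deco tow_ofw. Qed.

Lemma letters_cat a b c (u : dpath b c) (v : dpath a b) : letters (qcat u v) = letters u ++ letters v.
Proof. by rewrite /letters strip_cat tow_cat. Qed.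

Lemma letters_size a b (p : dpath a b) : size (letters p) = qsize p.
Proof. by elim: p => //= b' c' f p IH; rewrite /letters /= -/(letters p) IH. Qed.

Local Notation hom := (qall (@dhom_let k unit D)).

Lemma whom_uhom ds w : whom ds w <-> uhom (M := D) ds (ofw w).
Proof. by elim: w ds => [|x w IH] [|d ds] //=; rewrite IH. Qed.

Lemma dec_hom ds w : whom ds w -> hom ds (dec ds w).
Proof. by move=> /whom_uhom hw; apply: deco_hom. Qed.

Lemma dec_letters ds (p : dpath tt tt) : hom ds p -> dec ds (letters p) = p.
Proof. by move=> hp; rewrite /dec /letters ofw_tow deco_strip. Qed.

Lemma letters_whom ds a b (p : dpath a b) : hom ds p -> whom ds (letters p).
Proof. by elim: p ds => [|b' c' f p IH] [|d ds] //= [[hf _] hp]; split=> //; apply: IH. Qed.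

Variable V : lmodType k.

(** Sums over positions and sums over decompositions of a path are two ways of
    writing deconcatenation. *)
Lemma gsum_take (G : seq int -> seq M -> seq int -> seq M -> V) ds a b (p : dpath a b) :
  \sum_(0 <= i < (qsize p).+1) G (take i ds) (take i (letters p)) (drop i ds) (drop i (letters p)) =
  gsum p (fun c q r => G (take (qsize q) ds) (letters q) (drop (qsize q) ds) (letters r)).
Proof.
elim: p ds G => [|b1 c1 f p IH] ds G /=; first by rewrite big_nat1 take0 drop0.
rewrite big_nat_recl // !take0 !drop0; congr (_ + _).
have := IH (behead ds) (fun d1 w1 d2 w2 =>
  G (if ds is d :: _ then d :: d1 else [::]) (f.2 :: w1) d2 w2).
case: ds => [|d ds] /=.
  by move=> <-; apply: eq_bigr => i _; rewrite /letters /=.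
by move=> <-; apply: eq_bigr => i _.
Qed.

Definition wsum (w : seq M) (F : dpath tt tt -> V) : V := psum (M := D) (ofw w) F.

Lemma wsum_multi F : qmulti F -> wmultilin (wsum^~ F).
Proof.
move=> hF u a x y w; rewrite /wsum !ofw_cat /=; exact: (psum_multi (M := D) hF).
Qed.

Lemma wsum_hom ds w F : qmulti F -> whom ds w -> wsum w F = F (dec ds w).
Proof. by move=> hF /whom_uhom hw; rewrite /wsum (psum_hom hF hw). Qed.

Lemma wsum_letters ds (p : dpath tt tt) F : qmulti F -> hom ds p -> wsum (letters p) F = F p.
Proof. by move=> hF hp; rewrite (wsum_hom hF (letters_whom hp)) dec_letters. Qed.

Lemma letters_multi (f : seq M -> V) a b : wmultilin f -> qmulti (fun p : dpath a b => f (letters p)).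
Proof. by move=> hf c e u s v t m m'; rewrite !letters_cat; apply: hf. Qed.

End DecoratedWords.

(** * The Hopf algebra of a brace algebra *)

(** The data are a module M with braces, x{v} = [av x v], that satisfy the
    higher pre-Lie identity [av_ins]. The bar construction on M is given by its
    universal properties, as B and T. *)
Section BraceAlgebra.
Variables (k : comNzRingType) (M : grmod k) (B T : lmodType k).
Variables (word : seq M -> B) (tp : B -> B -> T) (com : {linear B -> T}).
Variables (ltr : {linear B -> M}) (eps : {linear B -> k^o}).
Hypotheses (word_multi : wmultilin word)
  (word_ext : forall (P : lmodType k) (f g : {linear B -> P}),
     (forall ds w, whom ds w -> f (word w) = g (word w)) -> forall X, f X = g X)
  (word_lift : forall (P : lmodType k) (f : seq M -> P), wmultilin f ->
     {h : {linear B -> P} | forall w, h (word w) = f w})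
  (tp_linl : forall Y, linear (tp^~ Y)) (tp_linr : forall X, linear (tp X))
  (comE : forall w, com (word w) =
     \sum_(0 <= i < (size w).+1) tp (word (take i w)) (word (drop i w)))
  (ltrE : forall w, ltr (word w) = if w is [:: x] then x else 0)
  (epsE : forall w, eps (word w) = (w == [::])%:R).
Local Notation L := (fun _ _ : unit => gcar M).
Local Notation D := (fun _ _ : unit => M).
Local Notation dpath := (qpath (dlet L)).
Local Notation homl := (@dhom_let k unit D).
Local Notation hom := (qall homl).
Variable av : forall a1 b1 : unit, dlet L a1 b1 -> forall a b, dpath a b -> M.
Hypotheses (av_multi : forall a1 b1 (x : dlet L a1 b1) a b, qmulti (fun q : dpath a b => av x q))
  (av_lin : forall a1 b1 s a b (q : dpath a b), linear (fun x : M => av ((s, x) : dlet L a1 b1) q))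
  (av_sign : forall a1 b1 s s' x a b (q : dpath a b),
     av ((s, x) : dlet L a1 b1) q = av ((s', x) : dlet L a1 b1) q)
  (av_deg : forall a1 b1 d (x : dlet L a1 b1) a b (q : dpath a b) es,
     gdeg d (x.2 : M) -> hom es q -> gdeg (d + sumz es) (av x q))
  (av_nil : forall a1 b1 (x : dlet L a1 b1) a, av x (qnil _ a) = x.2)
  (av_ins : forall a1 b1 (x : dlet L a1 b1) c d (v : dpath c d) a b (p : dpath a b),
     (exists ds, hom ds p) -> av (act av x v) p = ins av v p (fun q => av x q)).

Implicit Types (X Y : B).

Definition bw a b (q : dpath a b) : B := word (letters q).

Lemma bw_multi a b : qmulti (@bw a b).
Proof. exact: letters_multi. Qed.

Lemma bw_ext (P : lmodType k) (f g : B -> P) : linear f -> linear g ->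
  (forall ds (q : dpath tt tt), hom ds q -> f (bw q) = g (bw q)) -> forall X, f X = g X.
Proof.
move=> hf hg e X; apply: (word_ext (f := mklin hf) (g := mklin hg)) => ds w hw /=.
by have := e ds _ (dec_hom hw); rewrite /bw letters_dec.
Qed.

(** The product of two words: the sum of all insertions of the first into the
    second. *)
Definition pr a1 b1 (u : dpath a1 b1) a b (v : dpath a b) : B := ins av u v (@bw a b).

Lemma pr_multil a1 b1 a b (v : dpath a b) : qmulti (fun u : dpath a1 b1 => pr u v).
Proof. by apply: ins_multi_word => //; apply: bw_multi. Qed.

Lemma pr_multir a1 b1 (u : dpath a1 b1) a b : qmulti (@pr a1 b1 u a b).
Proof. by apply: ins_multi_path => //; apply: bw_multi. Qed.

Definition mulr_word (u : dpath tt tt) : {linear B -> B} :=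
  sval (word_lift (wsum_multi (@pr_multir _ _ u tt tt))).

Lemma mulr_wordE u w : mulr_word u (word w) = wsum w (@pr _ _ u tt tt).
Proof. by rewrite /mulr_word; case: word_lift. Qed.

Lemma mulr_word_multi Y : qmulti (fun u => mulr_word u Y).
Proof.
move=> c e u s v t m m'.
apply: (@bw_ext _ _ (fun Y => t *: mulr_word (qcat u (qcons (s, m) v)) Y +
   mulr_word (qcat u (qcons (s, m') v)) Y) (linP _)).
  by apply: lin_add; [apply: lin_scale|]; apply: linP.
move=> ds q hq; rewrite /bw !mulr_wordE !(wsum_letters _ hq); try exact: pr_multir.
exact: pr_multil.
Qed.

Definition mul_by Y : {linear B -> B} := sval (word_lift (wsum_multi (@mulr_word_multi Y))).
(** The extension of [pr] from homogeneous words to B, first in the second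
    argument and then in the first. *)
Definition mul X Y : B := mul_by Y X.

Lemma mul_wordl w Y : mul (word w) Y = wsum w (fun u => mulr_word u Y).
Proof. by rewrite /mul /mul_by; case: word_lift. Qed.

Lemma mul_linl Y : linear (mul^~ Y). Proof. exact: linP. Qed.

Lemma mul_linr X : linear (mul X).
Proof.
move=> t Y Y'.
apply: (@bw_ext _ (mul^~ (t *: Y + Y')) (fun X => t *: mul X Y + mul X Y')).
- exact: mul_linl.
- by apply: lin_add; [apply: lin_scale|]; apply: mul_linl.
move=> ds q hq; rewrite /bw !mul_wordl !(wsum_letters _ hq); try exact: mulr_word_multi.
exact: linP.
Qed.

Lemma bmul0l X : mul 0 X = 0. Proof. exact: (lin0 (mklin (mul_linl X))). Qed.
Lemma bmul0r X : mul X 0 = 0. Proof. exact: (lin0 (mklin (mul_linr X))). Qed.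
Lemma bmulBl Z X Y : mul (X - Y) Z = mul X Z - mul Y Z.
Proof. exact: (linB (mklin (mul_linl Z))). Qed.
Lemma bmulBr Z X Y : mul Z (X - Y) = mul Z X - mul Z Y.
Proof. exact: (linB (mklin (mul_linr Z))). Qed.
Lemma bmulZl Z a X : mul (a *: X) Z = a *: mul X Z.
Proof. exact: (linZ (mklin (mul_linl Z))). Qed.
Lemma bmulZr Z a X : mul Z (a *: X) = a *: mul Z X.
Proof. exact: (linZ (mklin (mul_linr Z))). Qed.
Lemma bmulNl Z X : mul (- X) Z = - mul X Z.
Proof. exact: (linN (mklin (mul_linl Z))). Qed.

Lemma bmulNr Z X : mul Z (- X) = - mul Z X.
Proof. exact: (linN (mklin (mul_linr Z))). Qed.
Lemma bmulDl Z X Y : mul (X + Y) Z = mul X Z + mul Y Z.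
Proof. exact: (linD (mklin (mul_linl Z))). Qed.

Lemma bmul_suml I (s : seq I) (P : pred I) (F : I -> B) Z :
  mul (\sum_(i <- s | P i) F i) Z = \sum_(i <- s | P i) mul (F i) Z.
Proof. exact: (linS (mklin (mul_linl Z))). Qed.
Lemma bmul_sumr I (s : seq I) (P : pred I) (F : I -> B) Z :
  mul Z (\sum_(i <- s | P i) F i) = \sum_(i <- s | P i) mul Z (F i).
Proof. exact: (linS (mklin (mul_linr Z))). Qed.
Lemma bmulDr Z X Y : mul Z (X + Y) = mul Z X + mul Z Y.
Proof. exact: (linD (mklin (mul_linr Z))). Qed.

Lemma bmulE ds es a1 b1 (u : dpath a1 b1) a b (v : dpath a b) : hom ds u -> hom es v ->
  mul (bw u) (bw v) = pr u v.
Proof.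
case: a1 b1 a b u v => [] [] [] [] u v hu hv.
rewrite {1}/bw mul_wordl (wsum_letters _ hu); last exact: mulr_word_multi.
by rewrite /bw mulr_wordE (wsum_letters _ hv) //; apply: pr_multir.
Qed.

Lemma act_hom a1 b1 (x : dlet L a1 b1) d a b (q : dpath a b) es :
  homl d x -> hom es q -> @dhom_let k unit D _ _ (d + sumz es) (act av x q).
Proof.
move=> [hx ex] hq; split; first exact: av_deg hx hq.
by rewrite /= ex oddzD (qpar_hom (M := D) hq).
Qed.

(** On words this is [ins_comp]. *)
Lemma bmulA X Y Z : mul (mul X Y) Z = mul X (mul Y Z).
Proof.
move: X; apply: bw_ext => [||ds u hu].
- exact: (lin_comp (mul_linl Z) (mul_linl Y)).
- exact: mul_linl.
move: Y; apply: bw_ext => [||es v hv].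
- exact: (lin_comp (mul_linl Z) (mul_linr _)).
- exact: (lin_comp (mul_linr _) (mul_linl Z)).
move: Z; apply: bw_ext => [||fs w hw].
- exact: mul_linr.
- exact: (lin_comp (mul_linr _) (mul_linr _)).
rewrite (bmulE hu hv) (bmulE hv hw) (ins_lin _ (mul_linl (bw w))) (ins_lin _ (mul_linr (bw u))).
rewrite (ins_hom_ext (K' := fun q => pr q w) act_hom hu hv); last first.
  by move=> gs q _ _ hq; apply: bmulE hq hw.
rewrite [RHS](ins_hom_ext (K' := fun q => pr u q) act_hom hv hw); last first.
  by move=> gs q _ _ hq; apply: bmulE hu hq.
rewrite (@ins_comp _ _ _ _ _ av av (fun a b p => exists ds, hom ds p)) //.
- move=> a b c p q [gs hg]; have [g1 [g2 [_ h1 h2]]] := qall_catP hg.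
  by split; [exists g1 | exists g2].
- by exists fs.
- exact: bw_multi.
Qed.

Lemma bmul1l X : mul (word [::]) X = X.
Proof.
move: X; apply: bw_ext => [||ds v hv]; [exact: mul_linr | by [] |].
exact: (bmulE (u := qnil _ tt) (ds := [::]) I hv).
Qed.

Lemma dpath_ind (P : dpath tt tt -> Prop) : P (qnil _ tt) ->
  (forall x p, P p -> P (@qcons _ _ tt tt tt x p)) -> forall p, P p.
Proof.
move=> h0 h1 p.
suff H a b (q : dpath a b) :
    (match a as a0, b as b0 return dpath a0 b0 -> Prop with tt, tt => P end) q
  by exact: (H _ _ p).
elim: q => [|b2 c2 f q IH]; first by case: a.
by case: a b2 c2 f q IH => [] [] [] f q /= hq; apply: h1.
Qed.

Lemma bmul1r X : mul X (word [::]) = X.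
Proof.
move: X; apply: bw_ext => [||ds u hu]; [exact: mul_linl | by [] |].
rewrite [LHS](bmulE (v := qnil _ tt) (es := [::]) hu I) /pr {ds hu}.
elim/dpath_ind: u (@bw tt tt) => [|x u IH] K //.
rewrite insE /insa /= addr0 andbF scale1r IH /act av_nil addbF.
by case: x.
Qed.

Lemma com_bw a b (q : dpath a b) : com (bw q) = gsum q (fun c q1 q2 => tp (bw q1) (bw q2)).
Proof.
rewrite /bw comE letters_size.
exact: (gsum_take (fun _ w1 _ w2 => tp (word w1) (word w2)) [::]).
Qed.

(** On words this is [ins_split]. *)
Lemma com_mul_path ds es (u v : dpath tt tt) : hom ds u -> hom es v ->
  com (mul (bw u) (bw v)) =
    \sum_(0 <= i < (qsize u).+1) \sum_(0 <= j < (qsize v).+1)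
      ksign k (sumz (drop i ds) * sumz (take j es)) *:
        tp (mul (word (take i (letters u))) (word (take j (letters v))))
           (mul (word (drop i (letters u))) (word (drop j (letters v)))).
Proof.
move=> hu hv; rewrite (bmulE hu hv) (ins_lin _ (linP com)).
transitivity (ins av u v (fun q => gsum q (fun c q1 q2 => tp (bw q1) (bw q2)))).
  by apply: ins_ext => q _; apply: com_bw.
rewrite ins_split gsum_exchange.
under eq_bigr => i _ do rewrite (gsum_take (fun d1 v1 d2 v2 => ksign k (sumz (drop i ds) * sumz d1) *:
  tp (mul (word (take i (letters u))) (word v1)) (mul (word (drop i (letters u))) (word v2))) es).
rewrite (gsum_take (fun d1 u1 d2 u2 => gsum v (fun c q r =>
  ksign k (sumz d2 * sumz (take (qsize q) es)) *:
  tp (mul (word u1) (word (letters q))) (mul (word u2) (word (letters r))))) ds).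
apply: gsum_ext => c u1 u2 Eu; rewrite Eu in hu; have [hu1 hu2] := qall_takedrop hu.
apply: gsum_ext => d v1 v2 Ev; rewrite Ev in hv; have [hv1 hv2] := qall_takedrop hv.
rewrite -/(bw u1) -/(bw u2) -/(bw v1) -/(bw v2) (bmulE hu1 hv1) (bmulE hu2 hv2).
rewrite (qpar_hom (M := D) hu2) (qpar_hom (M := D) hv1) ksignE oddzM; congr (_ *: _).
rewrite [RHS](ins_lin av (tp_linl (pr u2 v2))); apply: ins_ext => q _.
by rewrite (ins_lin av (tp_linr (bw q))).
Qed.

Lemma com_mul ds es (u v : seq M) : whom ds u -> whom es v ->
  com (mul (word u) (word v)) =
    \sum_(0 <= i < (size u).+1) \sum_(0 <= j < (size v).+1)
      ksign k (sumz (drop i ds) * sumz (take j es)) *: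
        tp (mul (word (take i u)) (word (take j v))) (mul (word (drop i u)) (word (drop j v))).
Proof.
move=> /dec_hom hu /dec_hom hv; have := com_mul_path hu hv.
by rewrite /bw -!letters_size !letters_dec.
Qed.

Lemma eps_mul X Y : eps (mul X Y) = (eps X : k) * eps Y.
Proof.
move: X; apply: (@bw_ext _ (fun X => eps (mul X Y)) (fun X => (eps X : k) *: (eps Y : k^o))) => [||ds u hu].
- exact: (lin_comp (linP eps) (mul_linl Y)).
- exact: (lin_mul _ (linP eps)).
move: Y; apply: bw_ext => [||es v hv].
- exact: (lin_comp (linP eps) (mul_linr _)).
- exact: (lin_scale _ (linP eps)).
rewrite (bmulE hu hv) (ins_lin _ (linP eps)) /bw !epsE.
elim/dpath_ind: u hu => [|x u _] hu; first by rewrite ins_nil epsE scale1r.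
rewrite ins_small; first by rewrite /letters /= scale0r.
by move=> q; rewrite epsE -size_eq0 letters_size; case: (qsize q).
Qed.

Lemma mul_deg ds es (u v : seq M) : whom ds u -> whom es v ->
  wdeg word (sumz ds + sumz es) (mul (word u) (word v)).
Proof.
move=> /dec_hom hu /dec_hom hv; have := bmulE hu hv; rewrite /bw !letters_dec => ->.
apply: (ins_closed act_hom _ _ hu hv).
- exact: lspan0.
- by move=> t x y hx hy; apply: lspanD => //; apply: lspanZ.
move=> fs q _ efs hq; apply: lspan_gen; exists fs => //.
by exists (letters q) => //; apply: letters_whom hq.
Qed.

(** An insertion never shortens the inserted word. *)
Lemma ltr_mul_long (u : seq M) Y : (1 < size u)%N -> ltr (mul (word u) Y) = 0.
Proof.
move=> su; move: Y; apply: (@bw_ext _ _ (fun _ => 0)) => [||es v hv].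
- exact: (lin_comp (linP ltr) (mul_linr _)).
- by move=> t x y; rewrite scaler0 addr0.
rewrite mul_wordl /wsum (psum_lin _ _ (linP ltr)).
rewrite -[RHS](psum0 (M := D) _ (ofw u)); apply: psum_ext => q eq.
rewrite /bw mulr_wordE (wsum_letters _ hv); last exact: pr_multir.
rewrite (ins_lin _ (linP ltr)) ins_small // => r hr.
have : (1 < size (letters r))%N.
  rewrite letters_size; apply: leq_trans hr; rewrite eq.
  by rewrite (_ : qsize (ofw u) = size u) //; elim: (u) => //= y w ->.
by rewrite /bw ltrE; case: (letters r) => [|y [|]].
Qed.

Lemma gsum_last (P : nmodType) a b (p : dpath a b) (F : forall c, dpath c b -> P) :
  gsum p (fun c q r => if r is qnil then F c q else 0) = F a p.
Proof. by elim: p F => //= c d f p IH F; rewrite add0r (IH (fun c q => F c (qcons f q))). Qed.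

Lemma ltr_pr_letter a1 b1 (x : dlet L a1 b1) a b (p : dpath a b) :
  ltr (pr (qcons x (qnil _ a1)) p) = av x p.
Proof.
rewrite (ins_lin _ (linP ltr)) insE.
have -> : insr av x (qnil _ a1) p (fun q => ltr (bw q)) = 0.
  case: p => [|c d f p] //=; rewrite ins_small ?scaler0 // => q hq.
  have : (1 < size (letters (qcons f q)))%N by rewrite letters_size.
  by rewrite /bw ltrE; case: (letters _) => [|y [|]].
rewrite addr0 -[RHS](gsum_last p (fun _ q => av x q)); apply: gsum_ext => c q r _.
by rewrite /= scale1r ins_nil /bw ltrE; move: q; case: c / r => [|c d f r] q; rewrite /letters /=.
Qed.

(** The only term with one letter is the one in which x is applied to the whole
    word. *)
Lemma ltr_mul_letter ds x (v : seq M) : whom ds v ->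
  ltr (mul (word [:: x]) (word v)) = av ((false, x) : dlet L tt tt) (dec ds v).
Proof.
move=> hv; move: x; apply: (@hom_ind k M) => [|x y ex ey|d x hx].
- have h := lin0 (mklin (@av_lin tt tt false tt tt (dec ds v))); rewrite /= in h; rewrite h.
  by have /= -> := wmulti0 word_multi [::] [::]; rewrite bmul0l lin0.
- have h := linD (mklin (@av_lin tt tt false tt tt (dec ds v))) x y.
  rewrite /= in h; rewrite h -ex -ey -linD -(linD (mklin (mul_linl (word v)))) /=.
  by have /= -> := wmultiD word_multi [::] x y [::].
have hu : whom [:: d] [:: x] by split.
have := bmulE (dec_hom hu) (dec_hom hv); rewrite /bw !letters_dec => ->.
by rewrite ltr_pr_letter; apply: av_sign.
Qed.

Section Differential.
Variable m : M.
Hypotheses (m_deg : gdeg 1 m)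
  (m_sq : av ((true, m) : dlet L tt tt) (qcons ((true, m) : dlet L tt tt) (qnil _ tt)) = 0).
Let W : B := word [:: m].

Let word_sgn_multi : wmultilin (fun w => word (map (@sgn k M) w)).
Proof. by move=> u a x y w; rewrite !map_cat /= linearP word_multi. Qed.

Definition wsgn : {linear B -> B} := sval (word_lift word_sgn_multi).

Lemma wsgnE w : wsgn (word w) = word (map (@sgn k M) w).
Proof. by rewrite /wsgn; case: word_lift. Qed.

Lemma wsgn_word ds w : whom ds w -> wsgn (word w) = ksign k (sumz ds) *: word w.
Proof. by move=> hw; rewrite wsgnE (multi_sgn_hom word_multi hw). Qed.

Lemma wsgn_bw ds a b (q : dpath a b) : hom ds q -> wsgn (bw q) = ksign k (sumz ds) *: bw q.
Proof. by move=> hq; apply/wsgn_word/letters_whom. Qed.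

Lemma wsgnK X : wsgn (wsgn X) = X.
Proof.
move: X; apply: bw_ext => [||ds v hv].
- exact: (lin_comp (linP wsgn) (linP wsgn)).
- by [].
by rewrite (wsgn_bw hv) linZ (wsgn_bw hv) scalerA !ksignE sgK scale1r.
Qed.

Lemma wsgn_mul X Y : wsgn (mul X Y) = mul (wsgn X) (wsgn Y).
Proof.
move: X; apply: bw_ext => [||ds u hu].
- exact: (lin_comp (linP wsgn) (mul_linl Y)).
- exact: (lin_comp (mul_linl _) (linP wsgn)).
move: Y; apply: bw_ext => [||es v hv].
- exact: (lin_comp (linP wsgn) (mul_linr _)).
- exact: (lin_comp (mul_linr _) (linP wsgn)).
rewrite (wsgn_bw hu) (wsgn_bw hv) bmulZl bmulZr scalerA (bmulE hu hv) !ksignE -sgD -oddzD -ksignE.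
apply: (ins_closed (S := fun X => wsgn X = _ *: X) act_hom _ _ hu hv).
- by rewrite lin0 scaler0.
- by move=> t x y hx hy; rewrite linP hx hy scalerDr !scalerA [_ * t]mulrC.
by move=> fs q _ <- hq; apply: wsgn_bw.
Qed.

Let hW : whom [:: 1] [:: m]. Proof. by split. Qed.

Let wsgnW : wsgn W = - W.
Proof. by rewrite (wsgn_word hW) sumz_cons sumz_nil addr0 ksignE /sg expr1 scaleN1r. Qed.

Let WW : mul W W = 0.
Proof.
have := bmulE (dec_hom hW) (dec_hom hW); rewrite /bw !letters_dec /dec /= => ->.
(* The words m|m from inserting m before and after m have opposite signs; the
   remaining term is the letter m o m. *)
set x := (_, m) : dlet L tt tt; rewrite /pr insE /insa /= insE /insa /= !ins_nil !addr0.
have -> : act av x (qnil _ tt) = x by rewrite /act av_nil addbF.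
rewrite /act m_sq [sg k false]expr0 [sg k true]expr1 !scale1r scaleN1r addrAC subrr add0r.
exact: (wmulti0 word_multi [::] [::]).
Qed.

(** The graded commutator with the letter m, which has degree 1. *)
Definition diff X : B := mul W X - mul (wsgn X) W.

Lemma diff_linear : linear diff.
Proof. exact: (lin_sub (mul_linr W) (lin_comp (mul_linl W) (linP wsgn))). Qed.

Lemma diff_word ds w : whom ds w ->
  diff (word w) = mul W (word w) - ksign k (sumz ds) *: mul (word w) W.
Proof. by move=> hw; rewrite /diff (wsgn_word hw) bmulZl. Qed.

Lemma diff_deg ds w : whom ds w -> wdeg word (sumz ds + 1) (diff (word w)).
Proof.
move=> hw; rewrite (diff_word hw) -scaleNr; apply: lspanD; last apply: lspanZ.
  by have := mul_deg hW hw; rewrite sumz_cons sumz_nil addr0 addrC.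
by have := mul_deg hw hW; rewrite sumz_cons sumz_nil addr0.
Qed.

Lemma wsgn_diff X : wsgn (diff X) = - mul W (wsgn X) + mul X W.
Proof. by rewrite /diff (linB wsgn) !wsgn_mul wsgnK wsgnW bmulNl bmulNr opprK. Qed.

(** The square of a graded commutator with an odd element is the commutator
    with its square, and m m = 0. *)
Lemma diff_sq X : diff (diff X) = 0.
Proof.
rewrite {1}/diff wsgn_diff /diff bmulBr -bmulA WW bmul0l sub0r.
rewrite bmulDl bmulNl [mul (mul X W) W]bmulA WW bmul0r addr0.
by rewrite !bmulA opprK addNr.
Qed.

Lemma diff_mul ds (u : seq M) X : whom ds u ->
  diff (mul (word u) X) = mul (diff (word u)) X + ksign k (sumz ds) *: mul (word u) (diff X).
Proof.
move=> hu; rewrite (diff_word hu) /diff wsgn_mul (wsgn_word hu) bmulBl bmulBr !bmulZl !bmulA.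
by rewrite scalerBr addrA subrK.
Qed.

(** A commutator with a primitive element is a coderivation. *)
Lemma com_diff ds (u : seq M) : whom ds u ->
  com (diff (word u)) = \sum_(0 <= i < (size u).+1)
     (tp (diff (word (take i u))) (word (drop i u))
      + ksign k (sumz (take i ds)) *: tp (word (take i u)) (diff (word (drop i u)))).
Proof.
move=> hu; rewrite (diff_word hu) (linB com) (linZ com) (com_mul hW hu) (com_mul hu hW) /=.
rewrite big_nat_recl // big_nat1 -big_split scaler_sumr -sumrB; apply: eq_bigr => i _ /=.
rewrite big_nat_recl // big_nat1 /= !sumz_nil !sumz_cons !sumz_nil addr0 mulr0 mul0r mul1r mulr1.
rewrite !bmul1l !bmul1r !ksignE [sg k (oddz 0)]expr0 !scale1r.
rewrite (diff_word (whom_take i hu)) (diff_word (whom_drop i hu)) -/W !ksignE.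
rewrite -{2}(cat_take_drop i ds) sumz_cat oddzD sgD.
set a := sg k _; set b := sg k _; set x := word _; set y := word _.
have eb : b * b = 1 by apply: sgK.
have -> : tp (mul W x - a *: mul x W) y = tp (mul W x) y - a *: tp (mul x W) y.
  by rewrite [LHS](linB (mklin (tp_linl y))) /= [X in _ - X](linZ (mklin (tp_linl y))).
have -> : tp x (mul W y - b *: mul y W) = tp x (mul W y) - b *: tp x (mul y W).
  by rewrite [LHS](linB (mklin (tp_linr x))) /= [X in _ - X](linZ (mklin (tp_linr x))).
rewrite scalerBr scalerDr !scalerA -mulrA eb mulr1 opprD.
by rewrite [X in X + _]addrC [X in _ + X]addrC addrACA.
Qed.

Lemma eps_diff X : eps (diff X) = 0.
Proof.
rewrite /diff (linB eps) !eps_mul epsE mul0r.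
by rewrite [LHS]sub0r mulr0 oppr0.
Qed.
End Differential.

Section Antipode.

(** The convolution product of functions on paths with values in B. *)
Definition conv (f g : forall a b, dpath a b -> B) a b (q : dpath a b) : B :=
  gsum q (fun c q1 q2 => mul (f _ _ q1) (g _ _ q2)).

Lemma mul_gsuml a b (q : dpath a b) (G : forall c, dpath c b -> dpath a c -> B) Y :
  mul (gsum q G) Y = gsum q (fun c q1 q2 => mul (G c q1 q2) Y).
Proof. by apply: (gsum_lin (g := mul^~ Y)); [apply: bmul0l | move=> ? ?; apply: bmulDl]. Qed.

Lemma mul_gsumr a b (q : dpath a b) (G : forall c, dpath c b -> dpath a c -> B) X :
  mul X (gsum q G) = gsum q (fun c q1 q2 => mul X (G c q1 q2)).
Proof.
apply: (gsum_lin (g := mul X)); [exact: bmul0r | move=> Y Y'].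
exact: (linD (mklin (mul_linr X))).
Qed.

Lemma convA f g h a b (q : dpath a b) : conv (conv f g) h q = conv f (conv g h) q.
Proof.
rewrite /conv; under gsum_ext => c q1 q2 _ do rewrite mul_gsuml.
rewrite gsum_assoc; apply: gsum_ext => c q1 q2 _; rewrite mul_gsumr.
by apply: gsum_ext => d r1 r2 _; rewrite bmulA.
Qed.

Lemma conv_ext f g f' g' a b (q : dpath a b) :
  (forall c (q1 : dpath c b) (q2 : dpath a c), q = qcat q1 q2 -> f _ _ q1 = f' _ _ q1) ->
  (forall c (q1 : dpath c b) (q2 : dpath a c), q = qcat q1 q2 -> g _ _ q2 = g' _ _ q2) ->
  conv f g q = conv f' g' q.
Proof. by move=> ef eg; apply: gsum_ext => c q1 q2 E; rewrite (ef _ _ _ E) (eg _ _ _ E). Qed.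

Definition cone a b (q : dpath a b) : B := if q is qnil then word [::] else 0.
Definition bwp a b (q : dpath a b) : B := if q is qnil then 0 else bw q.

Lemma bw_split a b (q : dpath a b) : bw q = cone q + bwp q.
Proof. by case: q => [|c d x q]; rewrite /= ?addr0 ?add0r. Qed.

Lemma conv1 f a b (q : dpath a b) : conv f cone q = f _ _ q.
Proof.
rewrite /conv -[RHS](gsum_last q (fun c q => f c b q)); apply: gsum_ext => c q1 q2 _.
by move: q1; case: c / q2 => [|c d x q2] q1; rewrite /= ?bmul1r ?bmul0r.
Qed.

Lemma conv1l f a b (q : dpath a b) : conv cone f q = f _ _ q.
Proof.
case: q => [|c d x q]; rewrite /conv /= bmul1l //.
rewrite -[X in _ + X]/(gsum q (fun c q1 q2 => mul (cone (qcons x q1)) (f _ _ q2))).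
by under gsum_ext => e q1 q2 _ do rewrite bmul0l; rewrite gsum0 addr0.
Qed.

Fixpoint cpow n : forall a b, dpath a b -> B :=
  if n is n'.+1 then conv (cpow n') bwp else cone.

Lemma cpow_small n a b (q : dpath a b) : (qsize q < n)%N -> cpow n q = 0.
Proof.
elim: n a b q => // n IH a b q hq; rewrite /= /conv -[RHS](gsum0 _ q).
apply: gsum_ext => c q1 q2 E; move: hq; rewrite E qsize_cat => hq.
move: q1 E hq; case: c / q2 => [|c d x q2] q1 E /= hq; first by rewrite bmul0r.
by rewrite IH ?bmul0l //; lia.
Qed.

(** Powers for an associative product can be formed from either side, so the
    series in [anti] is an inverse on both sides. *)
Lemma cpowSl n a b (q : dpath a b) : conv bwp (cpow n) q = cpow n.+1 q.
Proof.
elim: n a b q => [|n IH] a b q; first by rewrite /= conv1 conv1l.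
rewrite -[cpow n.+1]/(conv (cpow n) bwp) -convA.
by apply: conv_ext => // c q1 q2 _; apply: IH.
Qed.

Lemma bwp_multi a b : qmulti (@bwp a b).
Proof. by move=> c d u s v; have := @bw_multi _ _ _ _ u s v; case: u. Qed.

Lemma cpow_multi n a b : qmulti (@cpow n a b).
Proof.
elim: n a b => [|n IH] a b.
  by move=> c d [|e f x u] s v t m m' /=; rewrite scaler0 addr0.
apply: gsum_multi => [c r|c q] d e u s v.
  exact: (lin_comp (mul_linl _) (IH _ _ _ _ u s v)).
exact: (lin_comp (mul_linr _) (bwp_multi u s v)).
Qed.

(** The inverse of the identity for convolution is the geometric series in the
    difference bwp between the identity and the unit. It is finite on every path,
    because the n-th convolution power of bwp vanishes on paths with fewer than n
    letters. *)
Definition anti a b (q : dpath a b) : B :=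
  \sum_(0 <= n < (qsize q).+1) sg k (odd n) *: cpow n q.

Lemma antiE N a b (q : dpath a b) : (qsize q < N)%N ->
  anti q = \sum_(0 <= n < N) sg k (odd n) *: cpow n q.
Proof.
move=> hN; rewrite [RHS](big_cat_nat (leq0n _) hN) /= [X in _ = _ + X]big_nat_cond [X in _ = _ + X]big1 ?addr0 // => n.
by rewrite andbT => /andP[hn _]; rewrite cpow_small // scaler0.
Qed.

Lemma anti_multi a b : qmulti (@anti a b).
Proof.
move=> c d u s v t m m'; rewrite /anti !qsize_cat /= scaler_sumr -big_split /=.
apply: eq_bigr => n _; rewrite cpow_multi.
by rewrite scalerDr !scalerA mulrC.
Qed.

Lemma telescope_alt N (a : nat -> B) :
  \sum_(0 <= n < N) sg k (odd n) *: (a n + a n.+1) = a 0%N - sg k (odd N) *: a N.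
Proof.
elim: N => [|N IH]; first by rewrite big_nil [sg k _]expr0 scale1r subrr.
rewrite big_nat_recr //= IH scalerDr addrA subrK; congr (_ + _).
by rewrite /sg; case: (odd N); rewrite ?expr0 ?expr1 ?scaleN1r ?scale1r ?opprK.
Qed.

Lemma conv_anti_l a b (q : dpath a b) : conv anti bw q = cone q.
Proof.
set N := (qsize q).+1.
transitivity (\sum_(0 <= n < N) sg k (odd n) *: (cpow n q + cpow n.+1 q)); last first.
  by rewrite telescope_alt (@cpow_small N) // scaler0 subr0.
transitivity (gsum q (fun c q1 q2 => \sum_(0 <= n < N) sg k (odd n) *: mul (cpow n q1) (bw q2))).
  apply: gsum_ext => c q1 q2 E; rewrite (@antiE N); last by rewrite /N E qsize_cat; lia.
  by rewrite bmul_suml; apply: eq_bigr => n _; rewrite -bmulZl.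
rewrite gsum_sum; apply: eq_bigr => n _; rewrite -gsumZ; congr (_ *: _).
rewrite -[X in X + _]conv1 -gsumD; apply: gsum_ext => c q1 q2 _.
by rewrite bw_split bmulDr.
Qed.

Lemma conv_anti_r a b (q : dpath a b) : conv bw anti q = cone q.
Proof.
set N := (qsize q).+1.
transitivity (\sum_(0 <= n < N) sg k (odd n) *: (cpow n q + cpow n.+1 q)); last first.
  by rewrite telescope_alt (@cpow_small N) // scaler0 subr0.
transitivity (gsum q (fun c q1 q2 => \sum_(0 <= n < N) sg k (odd n) *: mul (bw q1) (cpow n q2))).
  apply: gsum_ext => c q1 q2 E; rewrite (@antiE N); last by rewrite /N E qsize_cat; lia.
  by rewrite bmul_sumr; apply: eq_bigr => n _; rewrite -bmulZr.
rewrite gsum_sum; apply: eq_bigr => n _; rewrite -gsumZ; congr (_ *: _).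
rewrite -[X in X + _]conv1l -cpowSl -gsumD; apply: gsum_ext => c q1 q2 _.
by rewrite bw_split bmulDl.
Qed.

Definition antipode : {linear B -> B} := sval (word_lift (wsum_multi (@anti_multi tt tt))).

Lemma antipode_bw ds a b (q : dpath a b) : hom ds q -> antipode (bw q) = anti q.
Proof.
case: a b q => [] [] q hq; rewrite /antipode; case: word_lift => /= S hS.
by rewrite /bw hS (wsum_letters _ hq) //; apply: anti_multi.
Qed.

Lemma cone_letters a b (q : dpath a b) : cone q = ((letters q == [::])%:R : k) *: word [::].
Proof. by case: q => [|c d x q]; rewrite /letters /= ?scale1r ?scale0r. Qed.

Lemma antipode_path ds (q : dpath tt tt) : hom ds q ->
  \sum_(0 <= i < (qsize q).+1) mul (antipode (word (take i (letters q)))) (word (drop i (letters q))) =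
    cone q /\
  \sum_(0 <= i < (qsize q).+1) mul (word (take i (letters q))) (antipode (word (drop i (letters q)))) =
    cone q.
Proof.
move=> hq; split.
  rewrite (gsum_take (fun _ w1 _ w2 => mul (antipode (word w1)) (word w2)) [::]).
  rewrite -[RHS]conv_anti_l; apply: gsum_ext => c q1 q2 E.
  rewrite E in hq; have [h1 _] := qall_takedrop hq.
  by rewrite -/(bw q1) (antipode_bw h1).
rewrite (gsum_take (fun _ w1 _ w2 => mul (word w1) (antipode (word w2))) [::]).
rewrite -[RHS]conv_anti_r; apply: gsum_ext => c q1 q2 E.
rewrite E in hq; have [_ h2] := qall_takedrop hq.
by rewrite -/(bw q2) (antipode_bw h2).
Qed.

Lemma antipode_word ds w : whom ds w ->
  \sum_(0 <= i < (size w).+1) mul (antipode (word (take i w))) (word (drop i w)) =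
    ((w == [::])%:R : k) *: word [::] /\
  \sum_(0 <= i < (size w).+1) mul (word (take i w)) (antipode (word (drop i w))) =
    ((w == [::])%:R : k) *: word [::].
Proof. by move=> /dec_hom/antipode_path; rewrite cone_letters -letters_size letters_dec. Qed.
End Antipode.

Section Packaging.
Hypothesis tp_lift : forall (P : lmodType k) (f : B -> B -> P),
     (forall Y, linear (f^~ Y)) -> (forall X, linear (f X)) ->
     {h : {linear T -> P} | forall X Y, h (tp X Y) = f X Y}.
Variable tm : {linear B -> B} -> {linear B -> B} -> {linear T -> T}.
Hypothesis tmE : forall f g X Y, tm f g (tp X Y) = tp (f X) (g Y).

Definition bpr : {linear T -> B} := sval (tp_lift mul_linl mul_linr).

Lemma bprE X Y : bpr (tp X Y) = mul X Y.
Proof. by rewrite /bpr; case: tp_lift. Qed.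

Lemma bpr_deg ds es (u v : seq M) : whom ds u -> whom es v ->
  wdeg word (sumz ds + sumz es) (bpr (tp (word u) (word v))).
Proof. by rewrite bprE; apply: mul_deg. Qed.

Lemma bprA X Y Z : bpr (tp (bpr (tp X Y)) Z) = bpr (tp X (bpr (tp Y Z))).
Proof. by rewrite !bprE bmulA. Qed.

Lemma bpr1l X : bpr (tp (word [::]) X) = X.
Proof. by rewrite bprE bmul1l. Qed.

Lemma bpr1r X : bpr (tp X (word [::])) = X.
Proof. by rewrite bprE bmul1r. Qed.

Lemma com_bpr ds es (u v : seq M) : whom ds u -> whom es v ->
  com (bpr (tp (word u) (word v))) =
    \sum_(0 <= i < (size u).+1) \sum_(0 <= j < (size v).+1)
      ksign k (sumz (drop i ds) * sumz (take j es)) *: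
        tp (bpr (tp (word (take i u)) (word (take j v)))) (bpr (tp (word (drop i u)) (word (drop j v)))).
Proof.
move=> hu hv; rewrite bprE (com_mul hu hv); apply: eq_bigr => i _; apply: eq_bigr => j _.
by rewrite !bprE.
Qed.

Lemma eps_bpr X Y : eps (bpr (tp X Y)) = (eps X : k) * eps Y.
Proof. by rewrite bprE eps_mul. Qed.

(** The left and right inverses of the identity for convolution are the two
    halves of the antipode axiom. *)
Lemma bpr_antipode : exists S : {linear B -> B}, forall X,
  bpr (tm S idfun (com X)) = (eps X : k) *: word [::] /\
  bpr (tm idfun S (com X)) = (eps X : k) *: word [::].
Proof.
exists antipode => X; split; move: X.
  apply: (@word_ext _ (mklin (lin_comp (lin_comp (linP bpr) (linP (tm antipode idfun))) (linP com)))
     (mklin (lin_mul (word [::]) (linP eps)))) => ds w hw /=.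
  rewrite comE epsE -(proj1 (antipode_word hw)) !linear_sum /=; apply: eq_bigr => i _.
  by rewrite tmE bprE.
apply: (@word_ext _ (mklin (lin_comp (lin_comp (linP bpr) (linP (tm idfun antipode))) (linP com)))
   (mklin (lin_mul (word [::]) (linP eps)))) => ds w hw /=.
rewrite comE epsE -(proj2 (antipode_word hw)) !linear_sum /=; apply: eq_bigr => i _.
by rewrite tmE bprE.
Qed.

Section WithDifferential.
Variable m : M.
Hypotheses (m_deg : gdeg 1 m)
  (m_sq : av ((true, m) : dlet L tt tt) (qcons ((true, m) : dlet L tt tt) (qnil _ tt)) = 0).

Definition bdf : {linear B -> B} := mklin (diff_linear m).

Lemma bdf_bpr ds (u : seq M) X : whom ds u ->
  bdf (bpr (tp (word u) X)) =
  bpr (tp (bdf (word u)) X) + ksign k (sumz ds) *: bpr (tp (word u) (bdf X)).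
Proof. by rewrite !bprE; apply: diff_mul. Qed.

Lemma ltr_bpr_long (u : seq M) Y : (1 < size u)%N -> ltr (bpr (tp (word u) Y)) = 0.
Proof. by rewrite bprE; apply: ltr_mul_long. Qed.

Lemma ltr_bpr_letter ds x (v : seq M) : whom ds v ->
  ltr (bpr (tp (word [:: x]) (word v))) = av ((false, x) : dlet L tt tt) (dec ds v).
Proof. by rewrite bprE; apply: ltr_mul_letter. Qed.

Lemma ltr_bdf_letter d x : gdeg d x ->
  ltr (bdf (word [:: x])) =
  ltr (bpr (tp (word [:: m]) (word [:: x]))) - ksign k d *: ltr (bpr (tp (word [:: x]) (word [:: m]))).
Proof.
move=> hx; have hw : whom [:: d] [:: x] by split.
rewrite /bdf /= (diff_word m hw) sumz_cons sumz_nil addr0 !bprE (linB ltr) (linZ ltr).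
by [].
Qed.

Lemma ltr_bdf_long (w : seq M) : (1 < size w)%N ->
  ltr (bdf (word w)) = ltr (bpr (tp (word [:: m]) (word w))).
Proof.
move=> hw; rewrite /bdf /= /diff (linB ltr) bprE wsgnE [X in _ - X]ltr_mul_long ?size_map //.
by rewrite subr0.
Qed.
End WithDifferential.
End Packaging.
End BraceAlgebra.

(** * Braces of Hochschild cochains *)

Section Cochains.
Variables (k : comNzRingType) (A : dgcat k).
Local Notation cochain := (cochain A).
Local Notation hochS := (susp (hoch A)).
Local Notation L1 := (fun _ _ : unit => gcar hochS).
Local Notation D1 := (fun _ _ : unit => hochS).
Local Notation D2 := (fun a b : dob A => susp (dhom a b)).
Local Notation L2 := (fun a b : dob A => gcar (susp (dhom a b))).
Local Notation path1 := (qpath (dlet L1)).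
Local Notation path2 := (qpath (dlet L2)).
Local Notation upath := (qpath L2).
Local Notation hom1 := (qall (@dhom_let k unit D1)).
Local Notation hom2 := (qall (@dhom_let k _ D2)).

Fixpoint top a b (p : upath a b) : dgpath a b :=
  match p in qpath _ _ b0 return dgpath a b0 with
  | qnil => pnil a
  | qcons _ _ f p' => pcons f (top p')
  end.

Fixpoint ofp a b (p : dgpath a b) : upath a b :=
  match p in dgpath _ b0 return upath a b0 with
  | pnil => qnil _ a
  | pcons _ _ f p' => @qcons _ L2 _ _ _ f (ofp p')
  end.

Definition undec a b (p : path2 a b) : dgpath a b := top (strip (M := D2) p).
Definition decp (es : seq int) a b (p : dgpath a b) : path2 a b :=
  deco (M := D2) (map (fun e => e - 1) es) (ofp p).

Lemma top_ofp a b (p : dgpath a b) : top (ofp p) = p.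
Proof. by elim: p => //= b' c' f p ->. Qed.

Lemma ofp_top a b (p : upath a b) : ofp (top p) = p.
Proof. by elim: p => //= b' c' f p ->. Qed.

Lemma top_cat a b c (u : upath b c) (v : upath a b) : top (qcat u v) = pcat (top u) (top v).
Proof. by elim: u v => //= b' c' f u IH v; rewrite IH. Qed.

Lemma ofp_cat a b c (u : dgpath b c) (v : dgpath a b) : ofp (pcat u v) = qcat (ofp u) (ofp v).
Proof. by elim: u v => //= b' c' f u IH v; rewrite IH. Qed.

Lemma undec_cat a b c (u : path2 b c) (v : path2 a b) : undec (qcat u v) = pcat (undec u) (undec v).
Proof. by rewrite /undec strip_cat top_cat. Qed.

Lemma undec_decp es a b (p : dgpath a b) : undec (decp es p) = p.
Proof. by rewrite /undec /decp strip_deco top_ofp. Qed.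

Lemma undec_size a b (p : path2 a b) : psize (undec p) = qsize p.
Proof. by elim: p => //= b' c' f p; rewrite /undec /= => ->. Qed.

Lemma phom_uhom es a b (p : dgpath a b) : phom es p <-> uhom (M := D2) (map (fun e => e - 1) es) (ofp p).
Proof.
elim: p es => [|b' c' f p IH] [|e es] //=.
by rewrite IH /susp_deg subrK.
Qed.

Lemma decp_hom es a b (p : dgpath a b) : phom es p -> hom2 (map (fun e => e - 1) es) (decp es p).
Proof. by move=> /phom_uhom hp; apply: deco_hom. Qed.

Lemma undec_phom ds a b (p : path2 a b) :
  qall (@whom_let k _ D2) ds p -> phom (map (fun e => e + 1) ds) (undec p).
Proof. by elim: p ds => [|b' c' f p IH] [|d ds] //= [hf hp]; split=> //; apply: IH. Qed.

Lemma psum_undec (V : lmodType k) ds a b (p : path2 a b) (F : path2 a b -> V) :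
  qmulti F -> hom2 ds p -> psum (M := D2) (ofp (undec p)) F = F p.
Proof. by move=> hF hp; rewrite /undec ofp_top; apply: psum_strip hp. Qed.

Lemma psum_decp (V : lmodType k) es a b (p : dgpath a b) (F : path2 a b -> V) :
  qmulti F -> phom es p -> psum (M := D2) (ofp p) F = F (decp es p).
Proof. by move=> hF /phom_uhom hp; apply: psum_hom. Qed.

Lemma sumz_map1 ds : sumz (map (fun e => e + 1) ds) = sumz ds + (size ds)%:Z.
Proof.
elim: ds => [|d ds IH]; first by rewrite !sumz_nil.
by rewrite /= !sumz_cons IH; rewrite -addn1 PoszD; ring.
Qed.

Lemma sumz_mapB1 ds : sumz (map (fun e => e - 1) ds) = sumz ds - (size ds)%:Z.
Proof.
elim: ds => [|d ds IH]; first by rewrite !sumz_nil.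
by rewrite /= !sumz_cons IH -addn1 PoszD; ring.
Qed.

Lemma qall_size (O : Type) (M : O -> O -> lmodType k) P ds a b (p : qpath (dlet M) a b) :
  qall P ds p -> size ds = qsize p.
Proof. by elim: p ds => [|b' c' f p IH] [|d ds] //= [_ /IH ->]. Qed.

Definition av2 a1 b1 (x : dlet L1 a1 b1) a b (q : path2 a b) : L2 a b := (x.2 : cochain) a b (undec q).

Lemma cochain_undec_multi (x : cochain) a b : qmulti (fun q : path2 a b => x a b (undec q)).
Proof. by move=> c d u s v t m m' /=; rewrite !undec_cat; apply: cfun_multi. Qed.

Lemma av2_multi a1 b1 (x : dlet L1 a1 b1) a b : qmulti (fun q : path2 a b => av2 x q).
Proof. exact: cochain_undec_multi. Qed.

Lemma av2_lin a1 b1 s a b (q : path2 a b) : linear (fun x : L1 a1 b1 => av2 ((s, x) : dlet L1 a1 b1) q).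
Proof. by move=> t x y; apply: cfunP. Qed.

Lemma av2_deg a1 b1 d (x : dlet L1 a1 b1) a b (q : path2 a b) es :
  gdeg d (x.2 : hochS) -> qall (@whom_let k _ D2) es q -> gdeg (d + sumz es) (av2 x q : D2 a b).
Proof.
move=> hx hq; have := hx _ _ _ _ (undec_phom hq).
rewrite undec_size -(qall_size hq) sumz_map1; congr gdeg; ring.
Qed.

Lemma act2_whom a1 b1 (x : dlet L1 a1 b1) d a b (q : path2 a b) es :
  @whom_let k unit D1 _ _ d x -> qall (@whom_let k _ D2) es q ->
  @whom_let k _ D2 _ _ (d + sumz es) (act av2 x q).
Proof. exact: av2_deg. Qed.

Lemma act2_hom a1 b1 (x : dlet L1 a1 b1) d a b (q : path2 a b) es :
  @dhom_let k unit D1 _ _ d x -> hom2 es q -> @dhom_let k _ D2 _ _ (d + sumz es) (act av2 x q).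
Proof.
move=> [hx ex] hq; split; first exact: av2_deg hx (qall_dw hq).
by rewrite /= ex oddzD (qpar_hom (M := D2) hq).
Qed.

(** The brace x{v}, for a word v of cochains with given parities. *)
Definition brace_fun (x : cochain) c d (v : path1 c d) : cochain_fun A := fun a b p =>
  psum (M := D2) (ofp p) (fun q => ins av2 v q (fun r => x a b (undec r))).

Lemma brace_ins_multi (x : cochain) c d (v : path1 c d) a b :
  qmulti (fun q : path2 a b => ins av2 v q (fun r => x a b (undec r))).
Proof. by apply: ins_multi_path; [apply: av2_multi | apply: cochain_undec_multi]. Qed.

Lemma brace_fun_multi x c d (v : path1 c d) : pmultilin (brace_fun x v).
Proof.
move=> a b c' d' u t f g w; rewrite /brace_fun !ofp_cat /=.
exact: (psum_multi (M := D2) (@brace_ins_multi x c d v a d')).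
Qed.

Lemma brace_fun_deg x e c d (v : path1 c d) ds : hoch_deg e x -> qall (@whom_let k unit D1) ds v ->
  cochain_deg (e + sumz ds) (brace_fun x v).
Proof.
move=> hx hv a b p es hp; rewrite /brace_fun (psum_decp (@brace_ins_multi x c d v a b) hp).
apply: (ins_closed act2_whom _ _ hv (qall_dw (decp_hom hp))).
- exact: gdeg0.
- by move=> t y z; apply: gdegP.
move=> fs q _ efs hq; have := hx _ _ _ _ (undec_phom hq).
rewrite undec_size -(qall_size hq) sumz_map1 efs; congr gdeg.
have -> : psize p = size es.
  by move: (p) (es) hp; elim=> [|b' c' f p' IH] [|e' es'] //= [_ /IH ->].
by rewrite sumz_mapB1; ring.
Qed.

Lemma cochain_fin_ext (f g : cochain_fun A) :
  (forall a b p, f a b p = g a b p) -> cochain_fin f -> cochain_fin g.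
Proof. by move=> e [s [c [us cm cd cE]]]; exists s, c; split=> // a b p; rewrite -e. Qed.

Lemma cochain_fin_hom n (f : cochain_fun A) : pmultilin f -> cochain_deg n f -> cochain_fin f.
Proof.
move=> fm fd; exists [:: n], (fun i => if i == n then f else fun a b _ => 0); split=> //.
- by move=> i; case: eqP => // _; apply: pmultilin0.
- by move=> i; case: eqP => [->|_] //; apply: cochain_deg0.
- by move=> a b p; rewrite big_seq1 eqxx.
Qed.

Lemma brace_fun_linl t x y c d (v : path1 c d) a b (p : dgpath a b) :
  brace_fun (t *: x + y) v p = t *: brace_fun x v p + brace_fun y v p.
Proof.
rewrite /brace_fun -psumP; apply: psum_ext => q _.
by rewrite -insZ -insD; apply: ins_ext => r _; apply: cfunP.
Qed.

Lemma brace_fun_word x c d a b (p : dgpath a b) : qmulti (fun v : path1 c d => brace_fun x v p).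
Proof.
move=> c' d' u s w t m m'; rewrite /brace_fun -psumP; apply: psum_ext => q _.
apply: (ins_multi_word av2_lin); exact: cochain_undec_multi.
Qed.

(** Both x and the letters of v are finite sums of homogeneous cochains, and
    the brace of homogeneous cochains is homogeneous. *)
Lemma brace_fun_fin x c d (v : path1 c d) : cochain_fin (brace_fun x v).
Proof.
have fin0 (f : cochain_fun A) : (forall a b p, f a b p = 0) -> cochain_fin f.
  by move=> e; apply: cochain_fin_ext (cochain_fin0 A) => a b p; rewrite e.
have finD (f g h : cochain_fun A) : (forall a b p, h a b p = f a b p + g a b p) ->
    cochain_fin f -> cochain_fin g -> cochain_fin h.
  move=> e hf hg; apply: cochain_fin_ext (cochain_finP 1 hf hg) => a b p.
  by rewrite e scale1r.
elim/(@dpath_hind k unit D1): v.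
- move=> c' e u s v; apply: fin0 => a b p.
  exact: (lin0 (mklin (@brace_fun_word x c d a b p _ _ u s v))).
- move=> c' e u s y z v hy hz; apply: finD hy hz => a b p.
  exact: (linD (mklin (@brace_fun_word x c d a b p _ _ u s v))).
move=> ds p hp; move: x; apply: (@hom_ind k (hoch A)).
- apply: fin0 => a b q; have := brace_fun_linl (-1) 0 0 p q.
  by rewrite scaler0 addr0 scaleN1r addNr.
- move=> x y; apply: finD => a b q; have := brace_fun_linl 1 x y p q.
  by rewrite !scale1r.
move=> i x hx; apply: cochain_fin_hom (brace_fun_deg hx hp); exact: brace_fun_multi.
Qed.

Definition brc x c d (v : path1 c d) : hochS := Cochain (brace_fun_multi x v) (brace_fun_fin x v).

(** Cochains are multilinear, so they are determined by their values on
    homogeneous strings. *)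
Lemma cochain_hext (x y : cochain) :
  (forall es a b (p : dgpath a b), phom es p -> x a b p = y a b p) -> x = y.
Proof.
move=> e; apply: cochainP => a b p; apply/eqP; rewrite -subr_eq0 -scaleN1r addrC.
rewrite -(cfunP (-1) y x); apply/eqP; apply: (pmultilin_eq0 (cfun_multi (-1 *: y + x))).
by move=> es c d q hq; rewrite cfunP (e _ _ _ _ hq) scaleN1r addNr.
Qed.

Lemma brcE x c d (v : path1 c d) es a b (p : dgpath a b) : phom es p ->
  (brc x v : cochain) a b p = ins av2 v (decp es p) (fun r => x a b (undec r)).
Proof. by move=> hp; apply: (psum_decp (@brace_ins_multi x c d v a b) hp). Qed.

Lemma brc_undec x c d (v : path1 c d) ds a b (p : path2 a b) : hom2 ds p ->
  (brc x v : cochain) a b (undec p) = ins av2 v p (fun r => x a b (undec r)).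
Proof. by move=> hp; apply: psum_undec hp; apply: brace_ins_multi. Qed.

Definition av1 a1 b1 (x : dlet L1 a1 b1) a b (v : path1 a b) : L1 a1 b1 := brc x.2 v.

Lemma av1_multi a1 b1 (x : dlet L1 a1 b1) a b : qmulti (fun v : path1 a b => av1 x v).
Proof.
move=> c d u s w t m m'; apply: cochainP => a' b' p; rewrite cfunP.
exact: brace_fun_word.
Qed.

Lemma av1_lin a1 b1 s a b (v : path1 a b) : linear (fun x : L1 a1 b1 => av1 ((s, x) : dlet L1 a1 b1) v).
Proof. by move=> t x y; apply: cochainP => a' b' p; rewrite cfunP; apply: brace_fun_linl. Qed.

Lemma av1_deg a1 b1 d (x : dlet L1 a1 b1) a b (v : path1 a b) es :
  gdeg d (x.2 : hochS) -> hom1 es v -> gdeg (d + sumz es) (av1 x v : hochS).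
Proof.
move=> hx hv; have := @brace_fun_deg x.2 (d + 1) _ _ _ _ hx (qall_dw hv).
by rewrite addrAC.
Qed.

Lemma av1_nil a1 b1 (x : dlet L1 a1 b1) a : av1 x (qnil _ a) = x.2.
Proof.
by apply: cochain_hext => es a' b p hp; rewrite (brcE _ _ hp) ins_nil undec_decp.
Qed.

(** The higher pre-Lie identity of the braces is [ins_comp] for strings of
    morphisms. *)
Lemma av1_ins a1 b1 (x : dlet L1 a1 b1) c d (v : path1 c d) a b (w : path1 a b) :
  (exists ds, hom1 ds w) -> av1 (act av1 x v) w = ins av1 v w (fun q => av1 x q).
Proof.
move=> [ds hw]; apply: cochain_hext => es a' b' p hp; rewrite (brcE _ _ hp).
rewrite (ins_hom_ext (K' := fun q => ins av2 v q (fun r => (x.2 : cochain) a' b' (undec r))) act2_hom hw (decp_hom hp)); last first.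
  by move=> fs q _ _ hq; apply: brc_undec hq.
rewrite (@ins_comp _ _ _ _ _ av1 av2 (fun a b p => exists ds, hom2 ds p)).
- have ev : linear (fun y : hochS => (y : cochain) a' b' p : L2 a' b') by move=> t y z; apply: cfunP.
  rewrite [RHS](ins_lin av1 ev); apply: ins_ext => q _.
  by rewrite (brcE _ _ hp).
- move=> c' d' e u q [gs hg]; have [g1 [g2 [_ h1 h2]]] := qall_catP hg.
  by split; [exists g1 | exists g2].
- by move=> a2 b2 y c' d' u e f q [gs hq]; apply: brc_undec hq.
- by exists (map (fun e => e - 1) es); apply: decp_hom.
- exact: cochain_undec_multi.
Qed.
End Cochains.

(** * The structure cochain *)

Section StructureCochain.
Variables (k : comNzRingType) (A : dgcat k).
Local Notation hochS := (susp (hoch A)).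
Local Notation L1 := (fun _ _ : unit => gcar hochS).
Local Notation D2 := (fun a b : dob A => susp (dhom a b)).
Local Notation L2 := (fun a b : dob A => gcar (susp (dhom a b))).
Local Notation path2 := (qpath (dlet L2)).

(** The sign of the composition depends on the degree of the first factor, and
    is extended to all morphisms by [sgn]. *)
Definition str2 (a b c : dob A) (f : dhom b c) (q : dgpath a b) : dhom a c :=
  match q in dgpath _ b0 return dhom b0 c -> dhom a c with
  | pnil => fun f => ddiff a c f
  | pcons b1 c1 g q' =>
      match q' in dgpath _ b2 return dhom b2 c1 -> dhom c1 c -> dhom a c with
      | pnil => fun g f => dcomp (sgn f) g
      | pcons _ _ _ _ => fun _ _ => 0
      end g
  end f.

Definition str_fun : cochain_fun A := fun a b p =>
  match p in dgpath _ b0 return dhom a b0 with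
  | pnil => 0
  | pcons _ _ f q => str2 f q
  end.

Lemma str_fun_long a b (p : dgpath a b) : (2 < psize p)%N -> str_fun p = 0.
Proof.
case: p => //= b1 c1 f p; move: f; case: b1 / p => //= b2 c2 g p; move: g.
by case: b2 / p.
Qed.

Lemma str_fun_multi : pmultilin str_fun.
Proof.
move=> a b c d u x f g v; case: u => [|b1 c1 h u] /=.
  case: v f g => [|b2 c2 w v] f g /=; first exact: linearP.
  case: v w => [|b3 c3 w' v] w /=; last by rewrite scaler0 addr0.
  by rewrite linearP; apply: dcomp_linl.
case: u h => [|b2 c2 h' u] h /=; last by case: u h' => [|? ? ? ?] ?; rewrite /= scaler0 addr0.
case: v f g => [|b2 c2 w v] f g /=; first exact: dcomp_linr.
by rewrite scaler0 addr0.
Qed.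

Lemma str_fun_deg : cochain_deg 2 str_fun.
Proof.
move=> a b p es; case: p => [|b1 c1 f p] /=; first by move=> _; apply: gdeg0.
case: es => // e es [hf]; case: p f hf => [|b2 c2 g p] f hf /=.
  case: es => // _; rewrite sumz_cons sumz_nil addr0.
  exact: (ddiff_deg hf).
case: es => // e' es [hg]; case: p g hg => [|b3 c3 h p] g hg /=; last by move=> _; apply: gdeg0.
case: es => // _; rewrite !sumz_cons sumz_nil addr0 addr0.
by apply: dcomp_deg => //; rewrite (sgn_hom hf); apply: gdegZ.
Qed.

Definition str : cochain A := Cochain str_fun_multi (cochain_fin_hom str_fun_multi str_fun_deg).

Lemma str_structure : structure_cochain str.
Proof.
split=> //; first by move=> a b c i f g hf; rewrite /= (sgn_hom hf); apply: (linZ (mklin (dcomp_linl g))).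
by move=> a b p; apply: str_fun_long.
Qed.

Lemma str_deg : gdeg 1 (str : hochS).
Proof. exact: str_fun_deg. Qed.

Let mlet : dlet L1 tt tt := (true, str : hochS).
Let mK a b (q : path2 a b) : dhom a b := str_fun (undec q).

Let mK_multi a b : qmulti (V := dhom a b) (@mK a b).
Proof. exact: (cochain_undec_multi str). Qed.

Let mK_long a b (q : path2 a b) : (2 < qsize q)%N -> mK q = 0.
Proof. by rewrite -undec_size; apply: str_fun_long. Qed.

Let mK0 a b c e (u : path2 e b) s (v : path2 a c) :
  mK (qcat u (qcons ((s, 0) : dlet L2 c e) v)) = 0.
Proof. exact: (lin0 (mklin (@mK_multi a b _ _ u s v))). Qed.

Let act_long a b (q : path2 a b) : (2 < qsize q)%N -> exists s, act (@av2 k A) mlet q = (s, 0).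
Proof. by move=> hq; exists (true (+) qpar q); congr pair; apply: mK_long. Qed.

(** In a string of at least four morphisms, either the inner or the outer
    occurrence of the structure cochain has at least three arguments. *)
Let insa_long a b (p : path2 a b) : (3 < qsize p)%N ->
  insa (@av2 k A) mlet (qnil _ tt) p (@mK a b) = 0.
Proof.
move=> hp; rewrite /insa -[RHS](gsum0 (dhom a b) p); apply: gsum_ext => c q r E.
rewrite ins_nil; have [hr|hr] := leqP 2 (qsize r).
  by rewrite mK_long ?scaler0.
have [|s ->] := act_long (q := q); first by move: hp; rewrite E qsize_cat; lia.
by rewrite (@mK0 _ _ _ _ (qnil _ _)) scaler0.
Qed.

Let insr_long a b (p : path2 a b) : (3 < qsize p)%N ->
  insr (@av2 k A) mlet (qnil _ tt) p (@mK a b) = 0.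
Proof.
case: p => [|b1 c1 f p] //= hp; rewrite insE; have hp' : (2 < qsize p)%N by [].
have -> : insr (@av2 k A) mlet (qnil _ tt) p (fun r => mK (qcons f r)) = 0.
  case: p f hp {hp'} => [|b2 c2 g p] f hp //=; rewrite ins_small ?scaler0 // => q hq.
  by rewrite mK_long.
rewrite addr0 /insa [X in _ *: X](_ : _ = 0) ?scaler0 //.
rewrite -[RHS](gsum0 (dhom a c1) p); apply: gsum_ext => c q r E.
rewrite ins_nil; have [hr|hr] := leqP 1 (qsize r).
  by rewrite mK_long ?scaler0.
have hs : (2 < qsize q)%N.
  have := hp'; rewrite E qsize_cat => h; apply: leq_trans h _.
  by rewrite -[X in (_ <= X)%N]addn0 leq_add2l -ltnS.
have [|s ->] := act_long (q := q); first exact: leq_trans hs (leqnn _).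
by rewrite (@mK0 _ _ _ _ (qcons f (qnil _ _))) scaler0.
Qed.

Lemma dcomp0l (a b c : dob A) (g : dhom a b) : dcomp (0 : dhom b c) g = 0.
Proof. exact: (lin0 (mklin (dcomp_linl g))). Qed.
Lemma dcomp0r (a b c : dob A) (f : dhom b c) : dcomp f (0 : dhom a b) = 0.
Proof. exact: (lin0 (mklin (dcomp_linr f))). Qed.
Lemma dcompZl (a b c : dob A) t (f : dhom b c) (g : dhom a b) : dcomp (t *: f) g = t *: dcomp f g.
Proof. exact: (linZ (mklin (dcomp_linl g))). Qed.
Lemma dcompZr (a b c : dob A) t (f : dhom b c) (g : dhom a b) : dcomp f (t *: g) = t *: dcomp f g.
Proof. exact: (linZ (mklin (dcomp_linr f))). Qed.

Let sgn_let a b d (x : dlet L2 a b) : @dhom_let k _ D2 _ _ d x ->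
  sgn (x.2 : dhom a b) = (- sg k x.1) *: (x.2 : dhom a b).
Proof.
move=> [hx ->]; rewrite (sgn_hom (M := dhom a b) hx) ksignE oddzD sgD.
by congr (_ *: _); rewrite mulrC /sg expr1 mulN1r.
Qed.

Let sgn_diff a b d (x : dlet L2 a b) : @dhom_let k _ D2 _ _ d x ->
  sgn (ddiff a b x.2) = sg k x.1 *: ddiff a b x.2.
Proof.
move=> [hx ->]; rewrite (sgn_hom (ddiff_deg hx)) ksignE; congr (sg k _ *: _).
by rewrite !oddzD; case: (oddz d).
Qed.

Let diff_comp a b c d (x : dlet L2 b c) (g : dhom a b) : @dhom_let k _ D2 _ _ d x ->
  ddiff a c (dcomp (x.2 : dhom b c) g) =
  dcomp (ddiff b c x.2) g - sg k x.1 *: dcomp (x.2 : dhom b c) (ddiff a b g).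
Proof.
move=> [hx ->]; rewrite (ddiff_comp _ hx) ksignE oddzD sgD; congr (_ + _).
by rewrite -scaleNr; congr (_ *: _); rewrite mulrC /sg expr1 mulN1r.
Qed.

(** The value of m o m on strings of one, two and three morphisms is,
    respectively, the square of the differential, the failure of the Leibniz rule
    and the failure of associativity. It vanishes on the other strings because m
    takes one or two arguments. *)
Lemma str_sq : av1 mlet (qcons mlet (qnil _ tt)) = 0.
Proof.
apply: cochain_hext => es a b p hp; rewrite (brcE _ _ hp).
transitivity (0 : dhom a b); last by [].
have := decp_hom hp; move: (decp es p) => {p hp} p; move: (map _ _) => {}es hp.
rewrite -/(@mK a b).
have [hs|hs] := ltnP 3 (qsize p).
  by rewrite insE insa_long // insr_long // addr0.
case: p es hp hs => [|b1 c1 x p] es hp hs.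
  by rewrite insE /insa /= ins_nil addr0 scale1r /mK /undec /= linear0.
case: es hp => // d es [hx hp].
case: p x es hp hx hs => [|b2 c2 y p] x es hp hx hs.
  rewrite insE /insa /= !ins_nil insE /insa /= ins_nil !addr0 !scale1r /mK /av2 /mlet /undec /=.
  by rewrite ddiff_sq linear0 dcomp0l dcomp0r scaler0 !addr0.
case: es hp => // e es [hy hp].
case: p y es hp hy hs => [|b3 c3 z p] y es hp hy hs.
  rewrite insE /insa /= !ins_nil insE /insa /= !ins_nil insE /insa /= !ins_nil !addr0 !scale1r.
  rewrite /mK /av2 /mlet /undec /= ?scaler0 ?add0r ?addr0.
  (* On two morphisms, the terms with the differential outside and inside
     cancel by the Leibniz rule. *)
  rewrite (sgn_diff hx) (sgn_let hx) !dcompZl andbT (linZ (ddiff _ _)) (diff_comp _ hx).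
  rewrite !scalerBr !scalerA !mulNr sgK !scaleNr scale1r opprK.
  by rewrite addrA subrr add0r mulrN sgK scaleN1r subrr.
case: es hp => // f es [hz hp].
case: p z es hp hz hs => [|b4 c4 w p] z es hp hz hs; last by [].
rewrite insE /insa /= !ins_nil insE /insa /= !ins_nil insE /insa /= !ins_nil insE /insa /= !ins_nil !addr0 !scale1r.
rewrite /mK /av2 /mlet /undec /= ?scaler0 ?add0r ?addr0.
(* On three morphisms the terms are (f g) h and f (g h), with opposite signs.
   *)
rewrite linear0 scaler0 !addr0 andbT (sgn_let hx) (sgn_let hy) !dcompZl dcompZr.
have hxy : gdeg (d + 1 + (e + 1)) (dcomp (x.2 : dhom _ _) (y.2 : dhom _ _)).
  by apply: dcomp_deg; [case: hx | case: hy].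
rewrite (linZ (mklin (@sgn_linear k _))) /= (sgn_hom hxy) !dcompZl dcompA !scalerA -scalerDl.
have -> : ksign k (d + 1 + (e + 1)) = sg k x.1 * sg k y.1.
  rewrite ksignE -sgD; case: hx hy => [_ ->] [_ ->]; congr (sg k _).
  by rewrite !oddzD; case: (oddz d) (oddz e) => [] [].
rewrite [X in X *: _](_ : _ = 0) ?scale0r //.
by rewrite mulrNN !mulNr !mulrA sgK mul1r addNr.
Qed.
End StructureCochain.

(** * Insertions into strings of morphisms *)

Section Insertions.
Variables (k : comNzRingType) (A : dgcat k).
Local Notation hochS := (susp (hoch A)).
Local Notation L1 := (fun _ _ : unit => gcar hochS).
Local Notation D2 := (fun a b : dob A => susp (dhom a b)).
Local Notation L2 := (fun a b : dob A => gcar (susp (dhom a b))).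
Local Notation path2 := (qpath (dlet L2)).
Local Notation hom2 := (qall (@dhom_let k _ D2)).
Local Notation undec := (@undec k A _ _).
Variable V : lmodType k.

Lemma decp_undec ds a b (q : path2 a b) : hom2 ds q -> decp (map (fun e => e + 1) ds) (undec q) = q.
Proof.
move=> hq; rewrite /decp /undec ofp_top -map_comp map_id_in ?deco_strip // => e _ /=.
by rewrite addrK.
Qed.

Lemma psplits_gsum es a b (p : dgpath a b) (G : forall c, dgpath c b -> dgpath a c -> V) :
  \sum_(s <- psplits p) G (tag s) (tagged s).1 (tagged s).2 =
  gsum (decp es p) (fun c q r => G c (undec q) (undec r)).
Proof.
elim: p es G => [|b1 c1 f p IH] es G; first by rewrite /= big_seq1.
rewrite /= big_cons big_map; congr (_ + _).
  by rewrite -[in LHS](undec_decp (behead es) p) /decp /= behead_map.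
rewrite (IH (behead es) (fun c q r => G c (pcons f q) r)) /decp behead_map.
by [].
Qed.

Lemma sumz_sdegs es : sdegs es = sumz (map (fun e => e - 1) es).
Proof. by rewrite /sdegs /sumz big_map. Qed.

(** The recursive definition of [insertions] chooses the whole segment to the
    left of y_1 at once, [ins] moves the word past one morphism at a time. The
    integer l accounts for the morphisms that have already been passed. *)
Lemma insertions_ins ds (ys : seq hochS) : whom ds ys ->
  forall l es a b (p : dgpath a b) (K : dgpath a b -> V), phom es p ->
  insertions (zip ds (ys : seq (cochain A))) l es p K =
  sg k (oddz l && oddz (sumz ds)) *:
    ins (@av2 k A) (dec ds ys) (decp es p) (fun r => K (undec r)).
Proof.
elim: ys ds => [|y ys IHy] [|d ds] //= hw l es a b p K hp.
  by rewrite sumz_nil andbF scale1r ins_nil undec_decp.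
case: hw => hy hys; rewrite /dec /= -/(dec ds ys).
have hu := dec_hom hys.
have part_a l' es' b' (p' : dgpath a b') (K' : dgpath a b' -> V) : phom es' p' ->
    \sum_(r <- psplits p') ksign k (d * l') *:
      insertions (zip ds (ys : seq (cochain A))) (l' + sdegs (take (psize (tagged r).1) es'))
        (drop (psize (tagged r).1) es') (tagged r).2
        (fun v => K' (pcons ((y : cochain A) _ _ (tagged r).1) v)) =
    sg k (oddz l' && oddz (sumz (d :: ds))) *:
      insa (@av2 k A) ((oddz d, y) : dlet L1 tt tt) (dec ds ys) (decp es' p') (fun r => K' (undec r)).
  move=> hp'.
  rewrite (psplits_gsum es' p' (fun c u r => ksign k (d * l') *:
      insertions (zip ds (ys : seq (cochain A))) (l' + sdegs (take (psize u) es'))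
        (drop (psize u) es') r (fun v => K' (pcons ((y : cochain A) _ _ u) v)))).
  rewrite /insa gsumZ; apply: gsum_ext => c q r E.
  have hqr := decp_hom hp'; rewrite E in hqr; have [h1 h2] := qall_takedrop hqr.
  have eq : map (fun e => e + 1) (drop (qsize q) (map (fun e => e - 1) es')) = drop (psize (undec q)) es'.
    by rewrite undec_size -map_drop -map_comp map_id_in // => e _ /=; rewrite subrK.
  have hr : phom (drop (psize (undec q)) es') (undec r) by rewrite -eq; apply/undec_phom/qall_dw.
  rewrite (IHy ds hys _ _ _ _ _ _ hr) -eq (decp_undec h2) !scalerA; congr (_ *: _).
  rewrite ksignE -!sgD (qpar_hom hu) (qpar_hom h1) undec_size sumz_sdegs map_take sumz_cons !oddzD oddzM.
  congr (sg k _); move: (oddz d) (oddz l') (oddz (sumz _)) (oddz (sumz _)).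
  by do 4!case.
elim: p l es K hp => [|b1 c1 f p IHp] l es K hp; rewrite insE scalerDr.
  rewrite /= scaler0 addr0 big_seq1 -part_a //=.
  by apply: eq_bigr => r _ /=; rewrite /sdegs take0 big_nil addr0.
rewrite [X in X = _]/= big_cons big_map; congr (_ + _).
  rewrite -part_a //; apply: eq_bigr => r _ /=.
  by rewrite /sdegs take0 big_nil addr0.
case: es hp => // e es [hf hp].
transitivity (\sum_(s <- psplits p) \sum_(r <- psplits (tagged s).2)
   ksign k (d * ((l + (e - 1)) + sdegs (take (psize (tagged s).1) es))) *:
   insertions (zip ds (ys : seq (cochain A)))
      ((l + (e - 1)) + sdegs (take (psize (tagged s).1 + psize (tagged r).1) es))
      (drop (psize (tagged s).1 + psize (tagged r).1) es) (tagged r).2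
     (fun v => K (pcons f (pcat (tagged s).1 (pcons ((y : cochain A) _ _ (tagged r).1) v))))).
  apply: eq_bigr => s _; apply: eq_bigr => r _ /=.
  by rewrite /sdegs !big_cons !addrA.
rewrite (IHp (l + (e - 1)) es (fun q => K (pcons f q)) hp) /decp /= scalerA (qpar_hom hu).
rewrite -sgD !sumz_cons !oddzD; congr (sg k _ *: _).
by move: (oddz l) (oddz d) (oddz (sumz ds)) (oddz e); do 4!case.
Qed.

End Insertions.

(** * B-infinity-structures from braces *)

Section BraceBinf.
Variables (k : comNzRingType) (C : grmod k).
Local Notation V := (susp C).
Local Notation L := (fun _ _ : unit => gcar (susp C)).
Local Notation D := (fun _ _ : unit => susp C).
Local Notation dpath := (qpath (dlet L)).
Local Notation homl := (@dhom_let k unit D).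
Local Notation hom := (qall homl).
Variable av : forall a1 b1 : unit, dlet L a1 b1 -> forall a b, dpath a b -> V.
Hypotheses (av_multi : forall a1 b1 (x : dlet L a1 b1) a b, qmulti (fun q : dpath a b => av x q))
  (av_lin : forall a1 b1 s a b (q : dpath a b), linear (fun x : V => av ((s, x) : dlet L a1 b1) q))
  (av_sign : forall a1 b1 s s' x a b (q : dpath a b),
     av ((s, x) : dlet L a1 b1) q = av ((s', x) : dlet L a1 b1) q)
  (av_deg : forall a1 b1 d (x : dlet L a1 b1) a b (q : dpath a b) es,
     gdeg d (x.2 : V) -> hom es q -> gdeg (d + sumz es) (av x q))
  (av_nil : forall a1 b1 (x : dlet L a1 b1) a, av x (qnil _ a) = x.2)
  (av_ins : forall a1 b1 (x : dlet L a1 b1) c d (v : dpath c d) a b (p : dpath a b),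
     (exists ds, hom ds p) -> av (act av x v) p = ins av v p (fun q => av x q)).
Variable m : V.
Hypotheses (m_deg : gdeg 1 m)
  (m_sq : av ((true, m) : dlet L tt tt) (qcons ((true, m) : dlet L tt tt) (qnil _ tt)) = 0).

Let B : lmodType k := bar V.
Let T : lmodType k := tens (bar V) (bar V).
Let word : seq V -> B := @bword k V.
Let tp : B -> B -> T := @tprod k (bar V) (bar V).
Let com : {linear B -> T} := @bcomul k V.
Let ltr : {linear B -> V} := @bar1 k V.
Let eps : {linear B -> k^o} := @bcounit k V.

Let word_multi : wmultilin word. Proof. exact (@bword_multilin k V). Qed.
Let word_ext : forall (P : lmodType k) (f g : {linear B -> P}),
     (forall ds w, whom ds w -> f (word w) = g (word w)) -> forall X, f X = g X.
Proof. exact (@bar_hext k V). Qed.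
Let word_lift (P : lmodType k) (f : seq V -> P) (fm : wmultilin f) :
  {h : {linear B -> P} | forall w, h (word w) = f w} :=
  exist _ (blift fm) (bliftE fm).
Let tp_lift (P : lmodType k) (f : B -> B -> P) (hl : forall Y, linear (f^~ Y))
    (hr : forall X, linear (f X)) : {h : {linear T -> P} | forall X Y, h (tp X Y) = f X Y} :=
  exist _ (@tlift k (bar V) (bar V) P f hl hr) (@tliftE k (bar V) (bar V) P f hl hr).
Let tm (f g : {linear B -> B}) : {linear T -> T} := tmap f g.
Let tmE (f g : {linear B -> B}) X Y : tm f g (tp X Y) = tp (f X) (g Y).
Proof. exact (tmapE f g X Y). Qed.
Let tp_linl := @tprod_linl k (bar V) (bar V).
Let tp_linr := @tprod_linr k (bar V) (bar V).
Let comE : forall w, com (word w) =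
     \sum_(0 <= i < (size w).+1) tp (word (take i w)) (word (drop i w)).
Proof. exact (@bcomulE k V). Qed.
Let ltrE : forall w, ltr (word w) = if w is [:: x] then x else 0.
Proof. exact (@bar1E k V). Qed.
Let epsE : forall w, eps (word w) = (w == [::])%:R.
Proof. exact (@bcounitE k V). Qed.

Let D0 : {linear B -> B} := bdf word_multi word_ext word_lift av_multi av_lin m.
Let P0 : {linear T -> B} := bpr word_multi word_ext word_lift av_multi av_lin tp_lift.

(** The lemmas on B and T, for the bar construction itself. *)
Definition brace_binf : binf_on C := @BInfOn k C D0 P0
  (diff_deg word_multi word_ext word_lift av_multi av_lin av_deg m_deg)
  (bpr_deg word_multi word_ext word_lift av_multi av_lin av_deg tp_lift)
  (diff_sq word_multi word_ext word_lift av_multi av_lin av_deg av_nil av_ins m_deg m_sq)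
  (bprA word_multi word_ext word_lift av_multi av_lin av_deg av_ins tp_lift)
  (bpr1l word_multi word_ext word_lift av_multi av_lin tp_lift)
  (bpr1r word_multi word_ext word_lift av_multi av_lin av_nil tp_lift)
  (fun ds u X h => @bdf_bpr k V B T word tp word_multi word_ext word_lift av av_multi av_lin
     av_deg av_ins tp_lift m ds u X h)
  (com_diff word_multi word_ext word_lift tp_linl tp_linr comE av_multi av_lin av_nil m_deg)
  (eps_diff word_multi word_ext word_lift epsE av_multi av_lin m)
  (com_bpr word_multi word_ext word_lift tp_linl tp_linr comE av_multi av_lin tp_lift)
  (eps_bpr word_multi word_ext word_lift epsE av_multi av_lin tp_lift)
  (bpr_antipode word_multi word_ext word_lift comE epsE av_multi av_lin av_deg av_nil av_ins tp_lift tmE).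

Let S := BInf brace_binf.

Lemma brace_binf_bcomp (xs ys : seq (susp S)) : (1 < size xs)%N -> bcomp xs ys = 0.
Proof.
exact (@ltr_bpr_long k V B T word tp ltr word_multi word_ext word_lift ltrE av av_multi av_lin tp_lift xs (word ys)).
Qed.

Lemma brace_binf_brace ds (x : susp S) (ys : seq (susp S)) : whom ds ys ->
  brace x ys = av ((false, x) : dlet L tt tt) (dec ds ys).
Proof.
exact (@ltr_bpr_letter k V B T word tp ltr word_multi word_ext word_lift ltrE av av_multi av_lin av_sign tp_lift ds x ys).
Qed.

Lemma brace_binf_bdcomp1 d (x : susp S) : gdeg d x ->
  bdcomp [:: x] = circ (m : susp S) x - ksign k d *: circ x (m : susp S).
Proof.
exact (@ltr_bdf_letter k V B T word tp ltr word_multi word_ext word_lift av av_multi av_lin tp_lift m d x).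
Qed.

Lemma brace_binf_bdcomp (xs : seq (susp S)) : (1 < size xs)%N ->
  bdcomp xs = brace (m : susp S) xs.
Proof.
exact (@ltr_bdf_long k V B T word tp ltr word_multi word_ext word_lift ltrE av av_multi av_lin tp_lift m xs).
Qed.
End BraceBinf.

(** * The Hochschild B-infinity-algebra *)

Lemma wmulti_comp (k : comNzRingType) (V P Q : lmodType k) (f : seq V -> P) (h : P -> Q) :
  linear h -> wmultilin f -> wmultilin (fun w => h (f w)).
Proof. by move=> hl fm u a x y w; rewrite fm hl. Qed.

Lemma wmulti_long0 (k : comNzRingType) (M : grmod k) (P : lmodType k) (f : seq M -> P) n :
  wmultilin f -> (forall ds w, whom ds w -> (n < size w)%N -> f w = 0) ->
  forall w, (n < size w)%N -> f w = 0.
Proof.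
move=> fm f0; pose g w := if (n < size w)%N then f w else 0.
have gm : wmultilin g.
  move=> u a x y w; rewrite /g !size_cat /=; case: ifP => _; first exact: fm.
  by rewrite scaler0 addr0.
suff H w : g w = 0 by move=> w hw; have := H w; rewrite /g hw.
move: w; apply: (@word_hspan k M P g (fun x => x = 0) gm) => //.
  by move=> x y -> ->; rewrite addr0.
by move=> ds w hw; rewrite /g; case: ifP => // /(f0 ds w hw).
Qed.

Section HochschildStructure.
Variables (k : comNzRingType) (A : dgcat k).
Local Notation V := (susp (hoch A)).
Local Notation L := (fun _ _ : unit => gcar V).

(** The braces of cochains, with the structure cochain as the letter m. *)
Definition hoch_binf : binf_on (hoch A) :=
  @brace_binf k (hoch A) (@av1 k A) (@av1_multi k A) (@av1_lin k A) (@av1_deg k A)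
    (@av1_nil k A) (@av1_ins k A) (str A : V) (@str_deg k A) (@str_sq k A).
Let S := BInf hoch_binf.
Let m : susp S := str A.

Lemma hoch_brace ds (x : susp S) (ys : seq (susp S)) : whom ds ys ->
  brace x ys = av1 ((false, x) : dlet L tt tt) (dec ds ys).
Proof. exact (@brace_binf_brace k (hoch A) (@av1 k A) _ _ (fun a1 b1 s s' x a b q => erefl) _ _ _ m _ _ ds x ys). Qed.

Lemma hoch_brace_eval (x : susp S) ds (ys : seq (susp S)) : whom ds ys ->
  forall a b (p : dgpath a b) es, phom es p ->
  (brace x ys : cochain A) a b p =
    insertions (zip ds (ys : seq (cochain A))) 0 es p (fun q => (x : cochain A) a b q).
Proof.
intros hys a b p es hp; rewrite (hoch_brace x hys).
rewrite (insertions_ins hys 0 (fun q => (x : cochain A) a b q) hp) scale1r.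
exact (brcE x (dec ds ys) hp).
Qed.

Let brace_linear (X : susp S) : linear (fun Y : bar (susp S) => bar1 (bprod hoch_binf (tprod (bword [:: X]) Y))).
Proof.
exact (lin_comp (linP (@bar1 k V)) (lin_comp (linP (bprod hoch_binf)) (@tprod_linr k (bar V) (bar V) (bword [:: X])))).
Qed.

(** Inserting more than two cochains into m leaves m with more than two
    arguments. *)
Lemma brace_str_long (xs : seq (susp S)) : (2 < size xs)%N -> brace m xs = 0.
Proof.
revert xs; refine (@wmulti_long0 k V V (fun w => @brace k S m w) 2
  (wmulti_comp (brace_linear m) (@bword_multilin k V)) _).
intros ds w hw hs; rewrite (hoch_brace m hw).
apply: cochain_hext => es a b p hp; rewrite (brcE _ _ hp).
transitivity (0 : dhom a b); last by [].
rewrite ins_small // => q hq; apply: str_fun_long; rewrite undec_size.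
by apply: leq_trans hq; rewrite -letters_size letters_dec.
Qed.

Theorem hoch_is_hochschild : is_hochschild hoch_binf.
Proof.
exists (str A : hoch A); first exact: str_structure.
split.
- exact (@brace_binf_bdcomp1 k (hoch A) (@av1 k A) _ _ _ _ _ m _ _).
- intros x y; exact (@brace_binf_bdcomp k (hoch A) (@av1 k A) _ _ _ _ _ m _ _ [:: x; y] isT).
- intros xs hxs; refine (etrans _ (brace_str_long hxs)).
  exact (@brace_binf_bdcomp k (hoch A) (@av1 k A) _ _ _ _ _ m _ _ xs (ltnW hxs)).
- intros x ds ys hys; exact (hoch_brace_eval x hys).
- intros xs ys hxs; exact (@brace_binf_bcomp k (hoch A) (@av1 k A) _ _ _ _ _ m _ _ xs ys hxs).
Qed.
End HochschildStructure.

(** * Restriction along an embedding *)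

Section Restriction.
Variables (k : comNzRingType) (A B : dgcat k) (F : dgembedding A B).

Lemma restrict_linear : linear (restrict F).
Proof.
move=> t x y; apply: cochainP => a b p; rewrite cfunP -fmor_inv_linear.
by congr fmor_inv; apply: cfunP.
Qed.

Definition restrictL : {linear hoch B -> hoch A} := mklin restrict_linear.

Lemma psplits_map a b (p : dgpath a b) : psplits (dgpath_map F p) =
  [seq existT (fun c => dgpath c (F b) * dgpath (F a) c)%type (F (tag s))
         (dgpath_map F (tagged s).1, dgpath_map F (tagged s).2) | s <- psplits p].
Proof. by elim: p => //= b' c' f p ->; rewrite -!map_comp. Qed.

(** As F is full, the value of a restricted cochain on a string in A is the
    value of the cochain on the image of the string, and insertions into the image
    string correspond to insertions into the string. *)
Lemma insertions_restrict (V W : lmodType k) (g : V -> W) (ds : seq int) (ys : seq (hoch B)) :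
  linear g -> forall l es a b (p : dgpath a b) (K : dgpath (F a) (F b) -> V),
  insertions (zip ds (map (restrict F) ys : seq (cochain A))) l es p
    (fun q => g (K (dgpath_map F q))) =
  g (insertions (zip ds (ys : seq (cochain B))) l es (dgpath_map F p) K).
Proof.
move=> gl; have gS (I : Type) (s : seq I) (h : I -> V) : g (\sum_(i <- s) h i) = \sum_(i <- s) g (h i).
  exact: (linS (mklin gl)).
elim: ys ds => [|y ys IH] [|d ds] // l es a b p K /=.
rewrite psplits_map big_map gS; apply: eq_bigr => s _ /=.
rewrite psplits_map big_map gS; apply: eq_bigr => r _ /=.
have gZ t v : g (t *: v) = t *: g v := linZ (mklin gl) t v.
rewrite gZ !dgpath_map_size -IH; congr (_ *: _); congr insertions.
apply: functional_extensionality_dep => v.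
by rewrite dgpath_map_cat /= fmor_invK.
Qed.

Variables (SA : binf_on (hoch A)) (SB : binf_on (hoch B)).
Hypotheses (hA : is_hochschild SA) (hB : is_hochschild SB).
Local Notation CA := (BInf SA).
Local Notation CB := (BInf SB).

Lemma restrict_circ (x y : susp CB) :
  restrict F (circ x y) = circ (restrict F x : susp CA) (restrict F y : susp CA).
Proof.
move: y; apply: (@hom_ind k (susp CB)).
- refine (etrans (congr1 (restrict F) (lin0 (mklin (circ_linr x)))) (etrans (lin0 restrictL) _)).
  refine (esym (etrans (congr1 (@circ k CA (restrict F x)) (lin0 restrictL)) _)).
  exact (lin0 (mklin (circ_linr (restrict F x : susp CA)))).
- move=> y z ey ez.
  refine (etrans (congr1 (restrict F) (linD (mklin (circ_linr x)) y z)) _).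
  refine (etrans (linD restrictL _ _) (etrans (congr2 (fun u v : hoch A => u + v) ey ez) _)).
  refine (esym (etrans (congr1 (@circ k CA (restrict F x)) (linD restrictL y z)) _)).
  exact (linD (mklin (circ_linr (restrict F x : susp CA))) _ _).
move=> d y hy; apply: cochain_hext => es a b p hp.
case: hA => mA _ [_ _ _ eA _]; case: hB => mB _ [_ _ _ eB _].
have hy' : gdeg d (restrict F y : susp CA) by apply: (restrict_deg F hy).
rewrite (eA (restrict F x) [:: d] [:: restrict F y : susp CA] (conj hy' I) a b p es hp).
rewrite [LHS]/(fmor_inv _) (eB x [:: d] [:: y] (conj hy I) _ _ (dgpath_map F p) es (dgpath_map_hom F hp)).
exact (esym (insertions_restrict [:: d] [:: y] (@fmor_inv_linear _ _ _ F a b) 0 es p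
  (fun q => (x : cochain B) _ _ q))).
Qed.

(** F preserves the differential and the composition. *)
Lemma restrict_structure (mA : hoch A) (mB : hoch B) :
  structure_cochain mA -> structure_cochain mB -> restrict F mB = mA.
Proof.
move=> [u0 u1 u2 u3] [v0 v1 v2 v3]; apply: cochain_hext => es a b p hp.
have inj := @fmor_inj _ _ _ F; apply: inj; rewrite /= /restrict_fun fmor_invK.
case: p es hp => [|b1 c1 f p] es; first by rewrite /= v0 u0 linear0.
case: p f es => [|b2 c2 f' p] f es; first by rewrite /= v1 u1 fmor_diff.
case: p f' f es => [|b3 c3 f'' p] f' f [|e es] //= hp; last first.
  by rewrite v3 // u3 // linear0.
by case: hp => hf _; rewrite (v2 _ _ _ e) ?(u2 _ _ _ e) ?linearZ ?fmor_comp //; apply: fmor_deg.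
Qed.

(** The differential is the commutator with the structure cochain, which
    restricts to the structure cochain. *)
Lemma restrict_bd1 (x : CB) : restrict F (bd1 x) = bd1 (restrict F x : CA).
Proof.
case: (hA) => mA sA [dA _ _ _ _]; case: (hB) => mB sB [dB _ _ _ _].
move: x; apply: (@hom_ind k (susp CB)).
- refine (etrans (congr1 (restrict F) (lin0 (@bd1 k CB))) (etrans (lin0 restrictL) _)).
  exact (esym (etrans (congr1 (@bd1 k CA) (lin0 restrictL)) (lin0 (@bd1 k CA)))).
- move=> x y ex ey; refine (etrans (congr1 (restrict F) (linD (@bd1 k CB) x y)) _).
  refine (etrans (linD restrictL _ _) (etrans (congr2 (fun u v : hoch A => u + v) ex ey) _)).
  exact (esym (etrans (congr1 (@bd1 k CA) (linD restrictL x y)) (linD (@bd1 k CA) _ _))).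
move=> d x hx; have hx' : gdeg d (restrict F x : susp CA) by apply: (restrict_deg F hx).
have em := restrict_structure sA sB.
rewrite /bd1 (dA d _ hx') (dB d x hx) -em -!restrict_circ.
exact (etrans (linB restrictL _ _) (congr1 (fun u : hoch A => _ - u) (linZ restrictL _ _))).
Qed.

Lemma restrict_ppow n (x : susp CB) :
  restrict F (ppow n.+1 x) = ppow n.+1 (restrict F x : susp CA).
Proof.
case: (hA) => mA sA [_ _ _ _ cA]; case: (hB) => mB sB [_ _ _ _ cB].
rewrite (ppow_circ_pow (fun xs y => cA xs [:: y])) (ppow_circ_pow (fun xs y => cB xs [:: y])).
rewrite /circ_pow /=; elim: n => //= n <-; exact: restrict_circ.
Qed.
End Restriction.

Theorem theorem2 (p : nat) (k : comNzRingType) :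
  prime p -> noetherian k -> contains_field p k ->
  exists L : forall C : binf k, rgrlie p (susp (homology C)),
  [/\ forall C : binf k, induced_rgrlie (L C),
      forall (C D : binf k) (f : binf_map C D),
        exists2 h : {linear susp (homology C) -> susp (homology D)},
          induced_map f h & rlie_hom (L C) (L D) h,
      forall A : dgcat k, dg_projective A ->
        exists S : binf_on (hoch A), is_hochschild S &
      forall (A B : dgcat k) (F : dgembedding A B)
          (SA : binf_on (hoch A)) (SB : binf_on (hoch B)),
        dg_projective A -> dg_projective B ->
        is_hochschild SA -> is_hochschild SB ->
        exists2 h : {linear susp (homology (BInf SB)) ->
                            susp (homology (BInf SA))},
          induced_map (C := BInf SB) (D := BInf SA) (restrict F) h &
          rlie_hom (L (BInf SB)) (L (BInf SA)) h].
Proof.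
move=> p_pr _ [K [f [_ pK]]].
have pk0 : p%:R = 0 :> k by rewrite -(rmorph_nat f) (pcharf0 pK) rmorph0.
have ex (C : binf k) : exists R : rgrlie p (susp (homology C)), induced_by_chains R.
  exact: binf_rgrlie p_pr pk0.
pose L C := sval (cid (ex C)).
have L_ind C : induced_by_chains (L C) by exact (svalP (cid (ex C))).
exists L; split.
- move=> C; exact (induced_rgrlieP p_pr (L_ind C)).
- move=> C D g.
  exact (hmap_rlie_hom (f := bfun g) (L_ind C) (L_ind D) (bfun_deg g) (binf_map_bd1 g)
    (binf_map_circ g) (fun i x _ _ => binf_map_ppow g p x)).
- move=> A _; exists (hoch_binf A); exact: hoch_is_hochschild.
move=> A B F SA SB _ _ hA hB.
case: p p_pr {pK pk0 ex} L L_ind => // n p_pr L L_ind.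
exact (hmap_rlie_hom (C := BInf SB) (D := BInf SA) (f := restrictL F) (L_ind _) (L_ind _)
  (fun i x h => restrict_deg F h) (restrict_bd1 F hA hB) (restrict_circ F hA hB)
  (fun i x _ _ => restrict_ppow F hA hB n x)).
Qed.
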